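(* Let $\{(X(s),Y(s)):s\in\mathbb{Z}^N\}$ be a random field, with $X(s)$ $\mathbb{R}^d$-valued and $Y(s)$ real-valued and square integrable, such that all $(X(s),Y(s))$ have the same distribution, the field is strong spatial mixing with exponentially decreasing mixing coefficients, and $Y(s)=m(X(s))+\varsigma(X(s))\,\epsilon(s)$ with error terms as described in the context; let $\mu$ be the distribution of $X(s)$. Let $m$ and $\varsigma^2$ be essentially bounded and set $B=\|m\|_\infty$. Assume there are $\kappa_0,\kappa_1,\tau>0$ with $\mathbb{P}(|\epsilon(s)|>z)\le\kappa_0\exp(-\kappa_1z^\tau)$ for all $z\ge0$. Let $(n(k):k\in\mathbb{N}_+)\subseteq\mathbb{N}_+^N$ be increasing with $\inf_k\min_in_i(k)/\max_in_i(k)>0$ and $\lim_k\max_in_i(k)=\infty$. Let $(\mathcal{F}_k)$ be a sequence of linear sieve spaces (as in the context), $\mathcal{F}_k$ being spanned by $g_1,\dots,g_{K^*(k)}$, $\mathcal{F}_k\subseteq\mathcal{F}_{k+1}$, $\bigcup_k\mathcal{F}_k$ dense in $L^2(\mu)$. Assume, as $k\to\infty$, $$K^*(k)\lambda_k^2\to0\quad\text{and}\quad\frac{(K^*(k))^{1+2/\tau}\left(\prod_{i=1}^N\log n_i(k)\right)^{3+4/\tau}}{|I_{n(k)}|^{1/(N+1)}}\to0 .$$ Additionally, let the error terms be essentially bounded by $B'\in\mathbb{R}_+$, i.e. $|\epsilon(s)|\le B'$ for all $s\in\mathbb{Z}^N$, and set $\beta_k=B+\|\varsigma\|_\infty B'$.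 Then there is a constant $C\in\mathbb{R}_+$, which only depends on $B$, $B'$, $\|\varsigma\|_\infty$, the lattice dimension $N$ and the bound on the mixing coefficients, such that the truncated hard thresholding estimator $\hat m_k$ (with threshold $\lambda_k$ and truncation level $\beta_k$) satisfies for all $k\in\mathbb{N}_+$ $$\mathbb{E}\left[\int_{\mathbb{R}^d}|\hat m_k-m|^2d\mu\right]\le4\min_{1\le u\le K^*(k)}\left\{\lambda_k^2u+\inf_{f\in\mathcal{F}_k:\,f=\sum_{i=1}^ua_ig_i}\int_{\mathbb{R}^d}|f-m|^2d\mu\right\}+C\,\frac{K^*(k)\left(\prod_{i=1}^N\log n_i(k)\right)^{3}}{|I_{n(k)}|^{1/(N+1)}} .$$
   Context: **Mixing.** For a random field $Z=\{Z(s):s\in\mathbb{Z}^N\}$ put $\mathcal{F}(I)=\sigma\{Z(s):s\in I\}$ for $I\subseteq\mathbb{Z}^N$, $d_\infty(I,J)=\inf\{\|s-t\|_\infty:s\in I,t\in J\}$ and $$\alpha(k)=\sup_{I,J\subseteq\mathbb{Z}^N,\ d_\infty(I,J)\ge k}\ \sup_{A\in\mathcal{F}(I),\,B\in\mathcal{F}(J)}|\mathbb{P}(A\cap B)-\mathbb{P}(A)\mathbb{P}(B)|.$$ $Z$ is strong spatial mixing with exponentially decreasing mixing coefficients if $\alpha(k)\le c_0\exp(-c_1k)$ for some $c_0,c_1>0$ (''the bound on the mixing coefficients'' refers to $c_0,c_1$). **Errors.** The $\epsilon(s)$ have mean $0$, variance $1$, identical marginal distributions, and the field $\epsilon$ is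 independent of the field $X$; the $\epsilon(s)$ may be dependent among each other. **Observations.** $I_n=\{s\in\mathbb{Z}^N: (1,\dots,1)\le s\le n\}$ for $n\in\mathbb{N}_+^N$ (coordinatewise order). The data at stage $k$ are $(X(s),Y(s))$, $s\in I_n$ with $n=n(k)$; ''increasing'' means $n(k)\le n(k+1)$ coordinatewise. The empirical measure is $\mu_n=|I_n|^{-1}\sum_{s\in I_n}\delta_{X(s)}$ and $\langle f,g\rangle_n=\int fg\,d\mu_n$. **Sieve spaces.** $\mathcal{F}_k=\{\sum_{i=1}^{K^*(k)}a_ig_i:a_i\in\mathbb{R}\}$ for given deterministic functions $g_1,\dots,g_{K^*(k)}:\mathbb{R}^d\to\mathbb{R}$ (the list may depend on $k$), with $\mathcal{F}_k\subseteq\mathcal{F}_{k+1}$ and $\bigcup_k\mathcal{F}_k$ dense in $L^2(\mu)$. **Estimator.** Apply Gram–Schmidt orthonormalization with respect to $\langle\cdot,\cdot\rangle_n$ successively to $g_1,\dots,g_{K^*(k)}$, discarding functions which become zero in $L^2(\mu_n)$; this yields (random) functions $f_1,\dots,f_{\tilde K}\in\mathcal{F}_k$, $\tilde K\le K^*(k)$, orthonormal in $L^2(\mu_n)$ and spanning $\mathcal{F}_k$ in $L^2(\mu_n)$. Put $a_j^*=|I_n|^{-1}\sum_{s\in I_n}f_j(X(s))Y(s)$, $J^*=\{j\le\tilde K:|a_j^*|>\lambda_k\}$, $m_k=\sum_{j\in J^*}a_j^*f_j$, and $\hat m_k=T_{\beta_k}m_k$ with $T_L(y)=\max(\min(y,L),-L)$.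 Here $(\lambda_k)\subseteq\mathbb{R}_+$ is a sequence converging to zero.
   Formalization: The bound is stated for every k with n_i(k) ≥ 2 for all i, rather than all k: if some n_i(k) = 1 then ∏ log n_i(k) = 0, the remainder term vanishes and the bound can fail (e.g. N = 1, n(1) = 1, m = 0, Rademacher errors, g_1 = 1, λ_1 = 1/10). *)

(* Defs.v *)
From HB Require Import structures.
From mathcomp Require Import all_boot all_order all_algebra finmap.
From mathcomp Require Import all_classical all_reals all_analysis.

Set Implicit Arguments.
Unset Strict Implicit.
Unset Printing Implicit Defensive.

Import Order.TTheory GRing.Theory Num.Theory.
Import numFieldNormedType.Exports.

Local Open Scope classical_set_scope.
Local Open Scope ring_scope.

Notation lattice N := {ffun 'I_N -> int}.

(* R^d with its Borel sigma-algebra, which is the one generated by the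
   coordinate projections. *)
Notation Rvec R d := (d.-tuple R).

Section Mixing.

Definition dist_oo N (s t : lattice N) : nat :=
  \max_(i < N) `|s i - t i|%N.

(* The infimum is taken in \bar R, so that it is +oo when I or J is empty. *)
Definition set_dist_oo (R : realType) N (I J : set (lattice N)) : \bar R :=
  ereal_inf [set e | exists s t, [/\ I s, J t & e = (dist_oo s t)%:R%:E]].

Definition field_sigma N d d' (Omega : measurableType d)
    (T : measurableType d') (Z : lattice N -> Omega -> T)
    (I : set (lattice N)) : set (set Omega) :=
  <<s \bigcup_(s in I) preimage_set_system setT (Z s) measurable >>.

Definition mixing_coef (R : realType) N d d' (Omega : measurableType d)
    (T : measurableType d') (P : probability Omega R)
    (Z : lattice N -> Omega -> T) (k : nat) : \bar R :=
  ereal_sup [set e | exists (I J : set (lattice N)) (A B : set Omega),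
    [/\ (k%:R%:E <= set_dist_oo R I J)%E,
        field_sigma Z I A, field_sigma Z J B
      & e = `|P (A `&` B) - P A * P B|%E]].

Definition strong_mixing (R : realType) N d d' (Omega : measurableType d)
    (T : measurableType d') (P : probability Omega R)
    (Z : lattice N -> Omega -> T) (c0 c1 : R) : Prop :=
  forall k : nat, (mixing_coef P Z k <= (c0 * expR (- (c1 * k%:R)))%:E)%E.

Definition independent_fields (R : realType) N d d1 d2
    (Omega : measurableType d) (T1 : measurableType d1)
    (T2 : measurableType d2) (P : probability Omega R)
    (Z1 : lattice N -> Omega -> T1) (Z2 : lattice N -> Omega -> T2) : Prop :=
  forall A B, field_sigma Z1 setT A -> field_sigma Z2 setT B ->
    P (A `&` B) = (P A * P B)%E.

Definition identically_distributed (R : realType) N d d'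
    (Omega : measurableType d) (T : measurableType d')
    (P : probability Omega R) (Z : lattice N -> Omega -> T) : Prop :=
  forall s t A, measurable A -> P (Z s @^-1` A) = P (Z t @^-1` A).

End Mixing.

Section Windows.
Variables (N : nat) (n : 'I_N -> nat).

Definition window : set (lattice N) :=
  [set s | forall i, (1 <= s i)%R /\ (s i <= (n i)%:Z)%R].

Definition card_window : nat := #|` fset_set window|.

Definition max_side : nat := \max_(i < N) n i.

(* max_side is neutral here since it bounds every n i; this is the minimum of
   the n i as soon as 0 < N. *)
Definition min_side : nat := \big[minn/max_side]_(i < N) n i.

Definition prod_log (R : realType) : R := \prod_(i < N) ln (n i)%:R.

End Windows.

Section Sieves.
Variables (R : realType) (d : nat).

Definition sieve K (g : 'I_K -> Rvec R d -> R) : set (Rvec R d -> R) :=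
  [set (fun z => \sum_(i < K) a i * g i z) | a in [set: 'I_K -> R]].

(* Span of the first u of the K generating functions. *)
Definition subsieve K (g : 'I_K -> Rvec R d -> R) (u : nat) :
    set (Rvec R d -> R) :=
  [set (fun z => \sum_(i < K | (i < u)%N) a i * g i z)
    | a in [set: 'I_K -> R]].

Definition dense_in_L2 (mu : probability (Rvec R d) R)
    (F : nat -> set (Rvec R d -> R)) : Prop :=
  (forall k f, F k f -> f \in Lfun mu 2%:E) /\
  (forall h : Rvec R d -> R, h \in Lfun mu 2%:E ->
    forall e : R, 0 < e -> exists k f,
      F k f /\ ('N[mu]_2%:E[EFin \o (f \- h)%R] < e%:E)%E).

End Sieves.

(* The estimator is a deterministic function of the realized design x and of
   the realized responses y; only their values on the window matter. *)
Section Estimator.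
Variables (R : realType) (N d : nat) (n : 'I_N -> nat).
Variables (x : lattice N -> Rvec R d) (y : lattice N -> R).

Definition emp_inner (f h : Rvec R d -> R) : R :=
  (card_window n)%:R^-1 * \sum_(s \in window n) (f (x s) * h (x s)).

Definition gs_residual (fs : seq (Rvec R d -> R)) (g : Rvec R d -> R) :
    Rvec R d -> R :=
  fun z => g z - \sum_(f <- fs) emp_inner g f * f z.

Definition gs_step (fs : seq (Rvec R d -> R)) (g : Rvec R d -> R) :
    seq (Rvec R d -> R) :=
  let h := gs_residual fs g in
  if emp_inner h h == 0 then fs
  else rcons fs (fun z => h z / Num.sqrt (emp_inner h h)).

Definition gram_schmidt (gs : seq (Rvec R d -> R)) : seq (Rvec R d -> R) :=
  foldl gs_step [::] gs.

Definition emp_coef (f : Rvec R d -> R) : R :=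
  (card_window n)%:R^-1 * \sum_(s \in window n) (f (x s) * y s).

Definition hard_threshold (lambda : R) K (g : 'I_K -> Rvec R d -> R) :
    Rvec R d -> R :=
  fun z => \sum_(f <- gram_schmidt [seq g i | i <- enum 'I_K]
                  | lambda < `|emp_coef f|) emp_coef f * f z.

Definition trunc (L v : R) : R := Num.max (Num.min v L) (- L).

Definition truncated_estimator (beta lambda : R) K
    (g : 'I_K -> Rvec R d -> R) : Rvec R d -> R :=
  fun z => trunc beta (hard_threshold lambda g z).

End Estimator.

(* Main.v *)
(* Orthonormality in [L^2(mu_n)] turns the empirical risk of hard thresholding into
   an approximation term, [lambda ^+ 2] per retained function, and the energy of the
   projected noise; the latter has expectation [O(K / sqrt |I_n|)] because the
   covariances of the errors are summable under mixing.

   The empirical and the true [L^2] risk of the truncated estimator are compared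
   uniformly over the span of [g].  Symmetrization with a ghost sample is not available
   under alpha-mixing, so the truncated span is covered by brackets, few enough for a
   union bound: a cutting of the coefficient space into simplicial cones, each crossed
   by a small fraction of the hyperplanes on which some truncation level is attained,
   gives [|I_n| ^ O(K)] brackets of [L^1] size [O(1 / |I_n|)].  For one bracket, the
   window is split into sublattices of mesh [a ~ K log |I_n|], on which an exponential
   supermartingale factorizes up to [alpha a]. *)

Require Import Defs.
From mathcomp Require Import all_boot all_order all_algebra.
From mathcomp Require Import all_classical all_reals all_analysis.
From mathcomp Require Import measurable_realfun ess_sup_inf.
From mathcomp Require Import ring lra zify.

Set Implicit Arguments.
Unset Strict Implicit.
Unset Printing Implicit Defensive.

Import Order.TTheory GRing.Theory Num.Theory.
Import numFieldNormedType.Exports.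

Local Open Scope ring_scope.

(** * Cuttings by pulling triangulations of random samples *)

(** Write [M] for the number of sites. The union bound over [M ^ (48 * K)] brackets forces a
    deviation exponent of order [K * ln M], and the mixing error forces a mesh of the same order. A
    mesh [a] leaves about [M / a ^ N] effectively independent sites, so the governing ratio is
    [(K * ln M) ^ N.+1 / M]. This is the [N.+1]-th power of the rate, whence the exponent
    [1 / (N + 1)]. The coefficients of the estimator are unbounded and [mu] is arbitrary, so the
    number of brackets may depend neither on a bound for the coefficients nor on the number of cells
    into which [mu] is discretized. This is why cuttings are used: their size depends only on the
    dimension and on the fraction of hyperplanes that may cross a cone. Bounded coefficients are
    treated first, and a limit over growing boxes then costs nothing. Only one direction is
    required, the true risk being at most the empirical risk plus a deviation, so it is enough to
    control lower brackets of the loss. *)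

Lemma leq_expl a b k : (a <= b)%N -> (a ^ k <= b ^ k)%N.
Proof. by case: k => // k; rewrite leq_exp2r. Qed.

Section Cutting.
Variables (F : realFieldType) (n : nat).
Implicit Types (c u v w : 'rV[F]_n) (vs : seq 'rV[F]_n).

Definition dot u v : F := \sum_i u 0 i * v 0 i.

Lemma dotDl u v w : dot (u + v) w = dot u w + dot v w.
Proof. by rewrite /dot -big_split; apply: eq_bigr => i _; rewrite mxE mulrDl. Qed.

Lemma dotZl a u w : dot (a *: u) w = a * dot u w.
Proof. by rewrite /dot mulr_sumr; apply: eq_bigr => i _; rewrite mxE mulrA. Qed.

Lemma dot0l w : dot 0 w = 0.
Proof. by rewrite -[X in dot X](scale0r 0) dotZl mul0r. Qed.

Lemma dot0r w : dot w 0 = 0.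
Proof. by rewrite /dot big1 // => i _; rewrite mxE mulr0. Qed.

Lemma dotBl u v w : dot (u - v) w = dot u w - dot v w.
Proof. by rewrite -scaleN1r dotDl dotZl mulN1r. Qed.

Lemma dot_mulmx u w : u *m w^T = (dot u w)%:M.
Proof.
apply/matrixP => i j; rewrite !ord1 !mxE eqxx mulr1n.
by apply: eq_bigr => k _; rewrite mxE.
Qed.

Lemma kermx_rowsP m (Z : 'M[F]_(m, n)) u :
  reflect (forall i, dot u (row i Z) = 0) (u <= kermx Z^T)%MS.
Proof.
apply: (iffP sub_kermxP) => [H i|H].
  have /matrixP/(_ 0 i) := H; rewrite !mxE; apply: etrans.
  by apply: eq_bigr => k _; rewrite !mxE.
apply/matrixP => a i; rewrite !mxE ord1 -[RHS](H i) /dot.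
by apply: eq_bigr => k _; rewrite !mxE.
Qed.

(** Induction on the hyperplanes. A pattern on the earlier ones that occurs on both sides of the
    hyperplane of [z] also occurs on it, by convexity along a segment, so the doubled patterns are
    counted in [U :&: kermx z^T], whose rank is smaller. *)
Lemma sign_patterns (zs : seq 'rV[F]_n) k m (U : 'M[F]_(m, n)) :
  (\rank U <= k)%N ->
  exists S : seq (seq bool), (size S <= (size zs).+1 ^ k)%N /\
    forall c, (c <= U)%MS -> [seq dot c z < 0 | z <- zs] \in S.
Proof.
elim: zs k m U => [|z zs IH] k m U rU.
  by exists [:: [::]]; split => [|c _]; rewrite ?inE //= expn_gt0.
have [S1 [sS1 HS1]] := IH k m U rU.
have [U0|/row_subPn[i Ui]] := boolP (U <= kermx z^T)%MS.
  exists [seq false :: s | s <- S1]; split.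
    by rewrite size_map (leq_trans sS1) // leq_expl.
  move=> c cU /=; have -> : (dot c z < 0) = false.
    have /sub_kermxP := submx_trans cU U0.
    by rewrite dot_mulmx => /matrixP/(_ 0 0); rewrite !mxE eqxx mulr1n => ->; rewrite ltxx.
  by apply: map_f; exact: HS1.
have rU' : (\rank (U :&: kermx z^T)%MS < \rank U)%N.
  apply: rank_ltmx; rewrite ltmxE; apply/andP; split; first exact: capmxSl.
  apply/negP => /(submx_trans (row_sub i U)) H.
  by move: Ui; rewrite (submx_trans H) ?capmxSr.
case: k => [|k] in rU sS1 HS1 *; first by move: rU rU'; rewrite leqn0 => /eqP ->.
have [S2 [sS2 HS2]] := IH k _ (U :&: kermx z^T)%MS (leq_trans rU' rU).
(* The sign given to [s] by default: negative as soon as some vector of [U] with pattern [s] is on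
   the negative side. A vector with the other sign has its pattern in [S2]. *)
pose e (s : seq bool) := `[< exists c, [/\ (c <= U)%MS,
   [seq dot c z < 0 | z <- zs] = s & dot c z < 0] >].
exists ([seq e s :: s | s <- S1] ++ [seq false :: s | s <- S2]); split.
  rewrite size_cat !size_map (leq_trans (leq_add sS1 sS2)) //=.
  rewrite expnS -{2}[((size zs).+1 ^ k)%N]mul1n -mulnDl addn1 expnS leq_mul2l.
  by rewrite leq_expl ?orbT.
move=> c cU; rewrite mem_cat /=.
set s := [seq _ | z <- zs].
have sS := HS1 _ cU; rewrite -/s in sS.
have [es|es] := eqVneq (dot c z < 0) (e s).
  by apply/orP; left; rewrite es; apply: (map_f (fun s => e s :: s)).
have [cz|cz] := ltP (dot c z) 0.
  case/negP: es; rewrite cz; apply/eqP; apply/esym/asboolP.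
  by exists c.
have /asboolP[c' [c'U c's c'z]] : e s by move: es; case: (e s) => //; rewrite ltNge cz.
(* Parameter at which the segment from [c] to [c'] meets the hyperplane of [z]; it may be [0], but
   not [1]. *)
pose t := dot c z / (dot c z - dot c' z).
have d0 : 0 < dot c z - dot c' z by rewrite subr_gt0 (lt_le_trans c'z).
have t0 : 0 <= t by rewrite divr_ge0 // ltW.
have t1 : t < 1 by rewrite ltr_pdivrMr // mul1r ltrDl oppr_gt0.
pose c2 := (1 - t) *: c + t *: c'.
have -> : s = [seq dot c2 z < 0 | z <- zs].
  have : forall x, x \in zs -> (dot c x < 0) = (dot c' x < 0).
    move=> x xz; have := congr1 (nth false ^~ (index x zs)) c's.
    by rewrite /s !(nth_map x) ?index_mem // !nth_index.
  move=> H; apply/eq_in_map => x /H; rewrite dotDl !dotZl.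
  case: (ltP (dot c x) 0) => h1 /esym h2; apply/esym; [|move/negbT: h2; rewrite -leNgt => h2; apply/negbTE; rewrite -leNgt; nra].
  have [->|tn0] := eqVneq t 0; first by rewrite subr0 mul1r mul0r addr0.
  have tp : 0 < t by rewrite lt_def tn0.
  nra.
apply/orP; right; apply: map_f; apply: HS2; rewrite sub_capmx; apply/andP; split.
  by rewrite addmx_sub ?scalemx_sub.
apply/sub_kermxP; rewrite dot_mulmx dotDl !dotZl.
suff -> : (1 - t) * dot c z + t * dot c' z = 0 by rewrite raddf0.
by rewrite /t; field; rewrite gt_eqF.
Qed.

(** * Extreme rays of the cells of a central arrangement *)

Section Rays.
Variables (m : nat) (zeta : 'I_m -> 'rV[F]_n).
Hypothesis span : forall u, (forall i, dot u (zeta i) = 0) -> u = 0.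

Definition ray_row (o : option 'I_m) : 'rV[F]_n := if o is Some i then zeta i else 0.

(** A candidate extreme ray is named by at most [n] constraints, [None] being padding, instead of by
    its coordinates. The names can be counted, and each of them involves few vectors of the
    arrangement. *)
Definition ray (f : {ffun 'I_n -> option 'I_m}) : 'rV[F]_n :=
  nz_row (kermx (\matrix_j ray_row (f j))^T).

(** The first flag stands for the zero vector, the second for an orientation, which [ray] does not
    determine. *)
Definition code : finType := (bool * bool * {ffun 'I_n -> option 'I_m})%type.

Definition vec (q : code) : 'rV[F]_n :=
  (if q.1.1 then 0 else (-1) ^+ q.1.2) *: ray q.2.

Definition face (s : 'I_m -> bool) (A : {set 'I_m}) v : bool :=
  [forall i, 0 <= (-1) ^+ s i * dot v (zeta i)] &&
  [forall i in A, dot v (zeta i) == 0].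

Lemma faceP (s : 'I_m -> bool) (A : {set 'I_m}) v : reflect
  ((forall i, 0 <= (-1) ^+ s i * dot v (zeta i)) /\
   (forall i, i \in A -> dot v (zeta i) = 0)) (face s A v).
Proof.
apply: (iffP andP) => [[/forallP h1 /forall_inP h2]|[h1 h2]]; split => //.
- by move=> i /h2 /eqP.
- exact/forallP.
- by apply/forall_inP => i /h2 /eqP.
Qed.

Definition tight v : 'M[F]_(m, n) :=
  \matrix_i (if dot v (zeta i) == 0 then zeta i else 0).

Lemma row_tight v i : row i (tight v) = if dot v (zeta i) == 0 then zeta i else 0.
Proof. by rewrite rowK. Qed.

Lemma tight_ker v : (v <= kermx (tight v)^T)%MS.
Proof.
by apply/kermx_rowsP => i; rewrite row_tight; case: eqP => // _; rewrite dot0r.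
Qed.

(** A row basis of [tight v], extracted by [maxrankfun], has at most [n] rows and the same kernel,
    namely the line of [v]; the ray of these indices is therefore a nonzero multiple of [v]. *)
Lemma extreme_ray_code v : v != 0 -> (kermx (tight v)^T <= v)%MS ->
  exists (f : {ffun 'I_n -> option 'I_m}) a, a != 0 /\ v = a *: ray f.
Proof.
move=> v0 kv; set T := tight v in kv *.
pose g := maxrankfun T.
have gt (j : 'I_(\rank T)) : dot v (zeta (g j)) == 0.
  apply/negPn/negP => h.
  have : row j (rowsub g T) = 0 by rewrite row_rowsub row_tight (negbTE h).
  rewrite rowE => /eqP; rewrite mulmx_free_eq0 ?maxrowsub_free // => /eqP/matrixP/(_ 0 j).
  by rewrite !mxE !eqxx => /eqP; rewrite oner_eq0.
pose f : {ffun 'I_n -> option 'I_m} :=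
  [ffun j : 'I_n => omap g (insub (j : nat))].
set Z := \matrix_j ray_row (f j).
have kZ u : (u <= kermx Z^T)%MS = (u <= kermx T^T)%MS.
  have -> : (u <= kermx T^T)%MS = (u <= kermx (rowsub g T)^T)%MS.
    have /eqmxP h := eq_maxrowsub T.
    apply/idP/idP => /sub_kermxP H; apply/sub_kermxP.
      have /submxP[D ->] : (rowsub g T <= T)%MS by case/andP: h.
      by rewrite trmx_mul mulmxA H mul0mx.
    have /submxP[D ->] : (T <= rowsub g T)%MS by case/andP: h.
    by rewrite trmx_mul mulmxA H mul0mx.
  apply/kermx_rowsP/kermx_rowsP => H.
    move=> j; have jn : (j < n)%N := leq_trans (ltn_ord j) (rank_leq_col T).
    have := H (Ordinal jn); rewrite rowK ffunE /= insubT // => ltj.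
    rewrite row_rowsub row_tight gt => <-; congr (dot _ (zeta (g _))).
    exact: val_inj.
  move=> j; rewrite rowK ffunE; case: insubP => [k _ _|_] /=; last by rewrite dot0r.
  by have := H k; rewrite row_rowsub row_tight gt.
have rk : ray f != 0.
  rewrite /ray nz_row_eq0 -/Z; apply/eqP => Z0.
  have : (v <= kermx Z^T)%MS by rewrite kZ tight_ker.
  by rewrite Z0 submx0 (negbTE v0).
exists f.
have : (ray f <= v)%MS by rewrite (submx_trans _ kv) // -kZ nz_row_sub.
move=> /sub_rVP[a ea]; have a0 : a != 0.
  by apply: contraNneq rk => a0; rewrite ea a0 scale0r.
by exists a^-1; rewrite invr_neq0 // ea scalerA mulVf // scale1r.
Qed.

Lemma face_scale s A a v : 0 <= a -> face s A v -> face s A (a *: v).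
Proof.
move=> a0 /faceP[h1 h2]; apply/faceP; split => i; rewrite dotZl.
  by rewrite mulrCA mulr_ge0.
by move=> /h2 ->; rewrite mulr0.
Qed.

(** As long as the tight constraints admit a direction [u] off the line of [v], moving along [u] up
    to the first constraint met stays in the face and raises the rank of the tight system. Spanning
    ensures that a constraint is met. *)
Lemma extreme_ray (s : 'I_m -> bool) A v0 : face s A v0 -> v0 != 0 ->
  exists q : code, face s A (vec q) /\ vec q != 0.
Proof.
have [k] := ubnP (n - \rank (tight v0))%N; elim: k v0 => // k IH v rk fv v0.
have [kv|] := boolP (kermx (tight v)^T <= v)%MS.
  have [f [a [a0 ev]]] := extreme_ray_code v0 kv.
  exists (false, a < 0, f).
  have eq1 : vec (false, a < 0, f) = `|a|^-1 *: v.
    rewrite /vec /= ev scalerA; congr (_ *: _).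
    by rewrite [X in _ = _ * X]realEsign ?num_real // mulrCA mulVf ?mulr1 // normr_eq0.
  rewrite eq1 scaler_eq0 invr_eq0 normr_eq0 (negbTE a0) (negbTE v0).
  by split => //; apply: face_scale => //; rewrite invr_ge0.
case/row_subPn => i0; set u := row i0 _ => uv.
have uk : (u <= kermx (tight v)^T)%MS by exact: row_sub.
have ut i : dot v (zeta i) = 0 -> dot u (zeta i) = 0.
  by move/kermx_rowsP: uk => /(_ i); rewrite row_tight => + h; rewrite h eqxx.
have u0 : u != 0 by apply: contraNneq uv => ->; rewrite sub0mx.
have [i1 hi1] : exists i, dot u (zeta i) != 0.
  by apply/existsP; apply: contraNT u0 => /existsPn H; apply/eqP/span => i; apply/eqP/negPn/H.
(* Ratio test in absolute value: the minimizer gives a displacement that changes no coordinate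
   [dot v (zeta i)] by more than its size, so no sign is reversed, whatever the sign of [t]. *)
pose r (i : 'I_m) : F := `|dot v (zeta i) / dot u (zeta i)|.
case: (@arg_minP _ F _ i1 (fun i => dot u (zeta i) != 0) r hi1) => j hj jmin.
pose t := - (dot v (zeta j) / dot u (zeta j)).
pose v' := v + t *: u.
have tj : dot v' (zeta j) = 0 by rewrite dotDl dotZl /t mulNr divfK // subrr.
have tt i : `|t * dot u (zeta i)| <= `|dot v (zeta i)|.
  have [->|h] := eqVneq (dot u (zeta i)) 0; first by rewrite mulr0 normr0.
  rewrite normrM normrN -ler_pdivlMr ?normr_gt0 // -normfV -normrM.
  exact: jmin.
have fv' : face s A v'.
  have [h1 h2] := faceP _ _ _ fv; apply/faceP; split => i; rewrite dotDl dotZl.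
    have := tt i; have := h1 i; case: (s i); rewrite ?expr1 ?expr0 ?mul1r ?mulN1r.
      by rewrite oppr_ge0 => h; rewrite (ler0_norm h) ler_norml => /andP[]; lra.
    by move=> h; rewrite (ger0_norm h) ler_norml => /andP[]; lra.
  by move=> /h2 h; rewrite h ut // mulr0 addr0.
have v'0 : v' != 0.
  apply: contraNneq uv => /eqP; rewrite addr_eq0 => /eqP ev.
  have t0 : t != 0 by apply: contraNneq v0 => t0; rewrite ev t0 scale0r oppr0.
  apply/sub_rVP; exists (- t^-1).
  by rewrite ev scalerN scaleNr opprK scalerA mulVf // scale1r.
apply: (IH v') => //.
have lt : (\rank (tight v) < \rank (tight v'))%N.
  apply: rank_ltmx; rewrite ltmxE; apply/andP; split.
    apply/row_subP => i; rewrite row_tight; case: eqP => [h|_]; last exact: sub0mx.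
    have : row i (tight v') = zeta i by rewrite row_tight dotDl dotZl h ut // mulr0 addr0 eqxx.
    by move=> <-; exact: row_sub.
  apply/negP => /(submx_trans (row_sub j _)); rewrite row_tight tj eqxx => /submxP[D eD].
  case/negP: hj; have /sub_kermxP uk0 := uk.
  have : u *m (zeta j)^T = 0 by rewrite eD trmx_mul mulmxA uk0 mul0mx.
  rewrite dot_mulmx => /matrixP/(_ 0 0); rewrite !mxE eqxx mulr1n => ->.
  exact: eqxx.
have := rank_leq_col (tight v').
move: rk lt; clear; lia.
Qed.

(** The apex depends on the face only, not on the point to be covered, so a simplicial cone is
    determined by a sign vector and a list of constraints. The default code has zero vector and
    occurs only when the face is reduced to [0]. *)
Definition pull (s : 'I_m -> bool) (A : {set 'I_m}) : code :=
  odflt (true, true, [ffun _ => None])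
    [pick q : code | face s A (vec q) && (vec q != 0)].

Lemma face0 s A : face s A 0.
Proof. by apply/faceP; split => i; rewrite dot0l ?mulr0. Qed.

Lemma pull_face s A : face s A (vec (pull s A)).
Proof.
rewrite /pull; case: pickP => [q /andP[]//|_] /=.
by rewrite /vec /= scale0r face0.
Qed.

Lemma pull_neq0 s A v : face s A v -> v != 0 -> vec (pull s A) != 0.
Proof.
move=> fv v0; rewrite /pull; case: pickP => [q /andP[]//|H].
by have [q [h1 h2]] := extreme_ray fv v0; have := H q; rewrite h1 h2.
Qed.

Fixpoint pulls (s : 'I_m -> bool) (A : {set 'I_m}) (is_ : seq 'I_m) : seq code :=
  if is_ is i :: is' then pull s A :: pulls s (i |: A) is' else [::].

Lemma size_pulls s A is_ : size (pulls s A is_) = size is_.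
Proof. by elim: is_ A => //= i is_ IH A; rewrite IH. Qed.

Lemma face_subset s (A A' : {set 'I_m}) v : A \subset A' -> face s A' v -> face s A v.
Proof.
move=> /fintype.subsetP AA /faceP[h1 h2]; apply/faceP; split => // i /AA; exact: h2.
Qed.

Lemma pulls_face s A is_ q : q \in pulls s A is_ -> face s A (vec q).
Proof.
elim: is_ A => //= i is_ IH A; rewrite inE => /orP[/eqP ->|/IH]; first exact: pull_face.
by apply: face_subset; exact: finset.subsetUr.
Qed.

End Rays.

(** * Simplicial cones obtained by pulling *)

Fixpoint in_cone vs c : Prop :=
  if vs is v :: vs' then exists2 t, 0 <= t & in_cone vs' (c - t *: v) else c = 0.

Lemma in_cone0 vs : in_cone vs 0.
Proof. by elim: vs => //= v vs IH; exists 0; rewrite // scale0r subr0. Qed.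

Lemma in_cone_ge0 vs c w : in_cone vs c -> all (fun v => 0 <= dot v w) vs -> 0 <= dot c w.
Proof.
elim: vs c => [c -> _|v vs IH c /= [t t0 /IH H] /andP[h /H]]; first by rewrite dot0l.
by rewrite dotBl dotZl subr_ge0; apply: le_trans; rewrite mulr_ge0.
Qed.

Lemma in_cone_le0 vs c w : in_cone vs c -> all (fun v => dot v w <= 0) vs -> dot c w <= 0.
Proof.
elim: vs c => [c -> _|v vs IH c /= [t t0 /IH H] /andP[h /H]]; first by rewrite dot0l.
by rewrite dotBl dotZl subr_le0 => /le_trans; apply; rewrite mulr_ge0_le0.
Qed.

Section Pulling.
Variables (m : nat) (zeta : 'I_m -> 'rV[F]_n).
Hypothesis span : forall u, (forall i, dot u (zeta i) = 0) -> u = 0.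

Definition rows (A : {set 'I_m}) : 'M[F]_(m, n) :=
  \matrix_i (if i \in A then zeta i else 0).

Lemma row_rows A i : row i (rows A) = if i \in A then zeta i else 0.
Proof. by rewrite rowK. Qed.

(** Subtracting from [c] the largest multiple of the apex that stays in the face leads to a point
    where a new, independent constraint is tight. Once the tight constraints span, the remainder is
    [0]. *)
Lemma pulling s k A c : (0 < m)%N -> face zeta s A c -> (n - \rank (rows A) <= k)%N ->
  exists is_ : seq 'I_m, size is_ = k /\ in_cone (map (vec zeta) (pulls zeta s A is_)) c.
Proof.
move=> m0; elim: k A c => [|k IH] A c fc rk.
  exists [::]; split => //=; apply: span => i.
  have [h1 h2] := faceP _ _ _ _ fc.
  have fullA : row_full (rows A).
    by rewrite /row_full eqn_leq rank_leq_col; move: rk; clear; lia.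
  have /submxP[D eD] := submx_full (zeta i) fullA.
  have : (c <= kermx (rows A)^T)%MS.
    by apply/kermx_rowsP => j; rewrite row_rows; case: ifP => [/h2//|_]; rewrite dot0r.
  move=> /sub_kermxP H; have : c *m (zeta i)^T = 0 by rewrite eD trmx_mul mulmxA H mul0mx.
  by rewrite dot_mulmx => /matrixP/(_ 0 0); rewrite !mxE eqxx mulr1n => ->.
have [->|c0] := eqVneq c 0.
  (* A zero remainder lies in every cone; arbitrary indices bring the list to the prescribed
     length. *)
  exists (nseq k.+1 (Ordinal m0)); split; first exact: size_nseq.
  exact: in_cone0.
set v := vec zeta (pull zeta s A).
have v0 : v != 0 by apply: pull_neq0 fc c0.
have fv : face zeta s A v := pull_face zeta s A.
have [c1 c2] := faceP _ _ _ _ fc; have [v1 v2] := faceP _ _ _ _ fv.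
have [i1 hi1] : exists i, dot v (zeta i) != 0.
  by apply/existsP; apply: contraNT v0 => /existsPn H; apply/eqP/span => i; apply/eqP/negPn/H.
pose r (i : 'I_m) : F := dot c (zeta i) / dot v (zeta i).
case: (@arg_minP _ F _ i1 (fun i => dot v (zeta i) != 0) r hi1) => j hj jmin.
have rE i : dot v (zeta i) != 0 -> r i = ((-1) ^+ s i * dot c (zeta i)) / ((-1) ^+ s i * dot v (zeta i)).
  by move=> h; rewrite /r -mulf_div divff ?mul1r ?signr_eq0 ?mul1r.
have sv i : dot v (zeta i) != 0 -> 0 < (-1) ^+ s i * dot v (zeta i).
  by move=> h; rewrite lt_def v1 mulf_neq0 ?signr_eq0.
have r0 : 0 <= r j by rewrite rE // divr_ge0.
have fc' : face zeta s (j |: A) (c - r j *: v).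
  apply/faceP; split => i; rewrite dotBl dotZl.
    rewrite mulrBr subr_ge0 mulrCA.
    have [->|h] := eqVneq (dot v (zeta i)) 0; first by rewrite !mulr0.
    by rewrite -ler_pdivlMr ?sv // -rE //; exact: jmin.
  rewrite !inE => /orP[/eqP ->|iA]; first by rewrite /r divfK // subrr.
  by rewrite c2 // v2 // mulr0 subr0.
have [|is_ [sz cone]] := IH _ _ fc'.
  suff lt : (\rank (rows A) < \rank (rows (j |: A)))%N by move: rk lt; clear; lia.
  apply: rank_ltmx; rewrite ltmxE; apply/andP; split.
    apply/row_subP => i; rewrite row_rows; case: ifP => iA; last exact: sub0mx.
    have : row i (rows (j |: A)) = zeta i by rewrite row_rows !inE iA orbT.
    by move=> <-; exact: row_sub.
  apply/negP => /(submx_trans (row_sub j _)); rewrite row_rows !inE eqxx => /submxP[D eD].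
  case/negP: hj.
  have /sub_kermxP vk : (v <= kermx (rows A)^T)%MS.
    by apply/kermx_rowsP => i; rewrite row_rows; case: ifP => [/v2//|_]; rewrite dot0r.
  have : v *m (zeta j)^T = 0 by rewrite eD trmx_mul mulmxA vk mul0mx.
  rewrite dot_mulmx => /matrixP/(_ 0 0); rewrite !mxE eqxx mulr1n => ->.
  exact: eqxx.
by exists (j :: is_); split; [rewrite /= sz|exists (r j)].
Qed.

End Pulling.
End Cutting.

(** * Independent samples from a finite distribution *)

Section Sampling.
Variables (F : realFieldType) (W : finType) (p : W -> F) (R : nat).
Hypotheses (p0 : forall w, 0 <= p w) (p1 : \sum_w p w = 1).
Implicit Types (z : {ffun 'I_R -> W}) (G : {ffun 'I_R -> W} -> F).

Definition iid z : F := \prod_i p (z i).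

Definition upd z (i : 'I_R) (w : W) : {ffun 'I_R -> W} :=
  [ffun j => if j == i then w else z j].

Lemma iid_ge0 z : 0 <= iid z.
Proof. exact: prodr_ge0. Qed.

Lemma iid_sum : \sum_z iid z = 1.
Proof.
rewrite /iid -(@bigA_distr_bigA _ _ _ _ _ _ _ (fun (i : 'I_R) w => p w)) /=.
by rewrite big1 // => i _; rewrite p1.
Qed.

Lemma iid_upd z i w : iid (upd z i w) * p (z i) = iid z * p w.
Proof.
rewrite /iid (bigD1 i) //= [in RHS](bigD1 i) //= ffunE eqxx.
rewrite (eq_bigr (fun j => p (z j))) => [|j /negbTE ji]; last by rewrite ffunE ji.
ring.
Qed.

(** Exchanging [z i] with an independent [w] is a measure-preserving involution, so one coordinate
    may be resampled. *)
Lemma iid_average (i : 'I_R) G :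
  \sum_z iid z * G z = \sum_z iid z * \sum_w p w * G (upd z i w).
Proof.
transitivity (\sum_(u : {ffun 'I_R -> W} * W) iid u.1 * p u.2 * G u.1).
  rewrite -(pair_bigA _ (fun z w => iid z * p w * G z)) /=; apply: eq_bigr => z _.
  rewrite -[LHS]mulr1 -p1 mulr_sumr; apply: eq_bigr => w _; ring.
pose h (u : {ffun 'I_R -> W} * W) := (upd u.1 i u.2, u.1 i).
have hK : cancel h h.
  case=> z w; rewrite /h /= ffunE eqxx; congr pair.
  by apply/ffunP => j; rewrite !ffunE; case: eqP => [->|].
rewrite (reindex_inj (can_inj hK)) /=.
under eq_bigr => u _ do rewrite iid_upd.
rewrite -(pair_bigA _ (fun z w => iid z * p w * G (upd z i w))) /=.
by apply: eq_bigr => z _; rewrite mulr_sumr; apply: eq_bigr => w _; rewrite mulrA.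
Qed.

(** The set [D z] depends on the samples in [E] only, and each other sample misses it with
    probability at most [1 - e] when its mass exceeds [e]. The other samples are integrated out one
    at a time by [iid_average], which replaces conditioning. *)
Lemma iid_miss (E : {set 'I_R}) (D : {ffun 'I_R -> W} -> pred W) (e : F) :
  e <= 1 -> (forall z z', {in E, z =1 z'} -> D z = D z') ->
  \sum_z iid z * ((e < \sum_(w | D z w) p w) && [forall i in ~: E, ~~ D z (z i)])%:R
    <= (1 - e) ^+ (R - #|E|).
Proof.
move=> e1 HD.
have -> : (R - #|E| = #|~: E|)%N by rewrite [RHS]cardsCs finset.setCK card_ord.
suff H (A : {set 'I_R}) : A \subset ~: E ->
    \sum_z iid z * ((e < \sum_(w | D z w) p w) && [forall i in A, ~~ D z (z i)])%:R
      <= (1 - e) ^+ #|A| by exact: H.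
have [k] := ubnP #|A|.
elim: k A => // k IH A.
have [->|[i iA]] := set_0Vmem A => kA sA.
  rewrite cards0 expr0 -[leRHS]iid_sum ler_sum // => z _.
  by rewrite ler_piMr ?iid_ge0 // lern1 leq_b1.
have cA : #|A| = #|A :\ i|.+1 by rewrite (cardsD1 i A) iA.
have sA' : A :\ i \subset ~: E by apply: fintype.subset_trans sA; rewrite finset.subsetDl.
have iE : i \notin E by move/fintype.subsetP: sA => /(_ _ iA); rewrite inE.
have Dupd z w : D (upd z i w) = D z.
  by apply: HD => j jE; rewrite ffunE; case: eqP => // ji; rewrite -ji jE in iE.
have := IH (A :\ i) _ sA'; rewrite -ltnS -cA => /(_ kA) {}IH.
rewrite (iid_average i) cA exprS.
apply: le_trans (ler_wpM2l _ IH); last by rewrite subr_ge0.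
rewrite mulr_sumr ler_sum // => z _.
rewrite mulrCA ler_wpM2l ?iid_ge0 //.
set b := _ && _.
have [bT|bF] := boolP b; last first.
  rewrite mulr0 big1 // => w _; rewrite (_ : _ && _ = false) ?mulr0 //.
  apply: contraNF bF; rewrite Dupd /b => /andP[-> /forall_inP H] /=.
  apply/forall_inP => j; rewrite !inE => /andP[ji jA].
  by have := H j jA; rewrite ffunE (negbTE ji).
have -> : \sum_w p w * ((e < \sum_(w' | D (upd z i w) w') p w') &&
    [forall i0 in A, ~~ D (upd z i w) (upd z i w i0)])%:R = \sum_(w | ~~ D z w) p w.
  rewrite [RHS]big_mkcond /=; apply: eq_bigr => w _; rewrite Dupd.
  have /andP[-> /forall_inP H] /= := bT.
  case: ifP => Dw.
    rewrite (_ : [forall _ in _, _] = true) ?mulr1 //.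
    apply/forall_inP => j jA; rewrite ffunE; case: eqP => // ji.
    by apply: H; rewrite !inE jA andbT; apply/eqP.
  rewrite (_ : [forall _ in _, _] = false) ?mulr0 //.
  by apply/negP => /forall_inP/(_ i iA); rewrite ffunE eqxx Dw.
have /andP[h _] := bT.
rewrite mulr1 lerBrDr -[leRHS]p1 [leRHS](bigID (D z)) /= addrC lerD2l.
exact: ltW.
Qed.

End Sampling.

(** * Random samples as nets for simplicial cones *)

Section Net.
Variables (F : realFieldType) (n : nat) (W : finType) (p : W -> F) (w : W -> 'rV[F]_n).
Variable R : nat.
Hypotheses (p0 : forall i, 0 <= p i) (p1 : \sum_i p i = 1).

Definition crossed (vs : seq 'rV[F]_n) (u : 'rV[F]_n) : bool :=
  has (fun v => dot v u < 0) vs && has (fun v => 0 < dot v u) vs.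

(** The coordinate vectors are appended so that the family always spans, as pulling requires; the
    net property concerns the samples alone. *)
Definition sample_ext (z : {ffun 'I_R -> W}) (i : 'I_(R + n)) : 'rV[F]_n :=
  match fintype.split i with inl a => w (z a) | inr b => delta_mx 0 b end.

Lemma sample_extL z a : sample_ext z (lshift n a) = w (z a).
Proof. by rewrite /sample_ext -[lshift n a]/(unsplit (inl a)) unsplitK. Qed.

Lemma sample_ext_span z u : (forall i, dot u (sample_ext z i) = 0) -> u = 0.
Proof.
move=> H; apply/rowP => j; have := H (rshift R j).
rewrite /sample_ext -[rshift R j]/(unsplit (inr j)) unsplitK /dot (bigD1 j) //= big1 ?addr0.
  by rewrite !mxE !eqxx mulr1.
by move=> k kj; rewrite !mxE (negbTE kj) andbF mulr0.
Qed.

Definition codes : finType := n.-tuple (code n (R + n)).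

Definition gens z (t : codes) : seq 'rV[F]_n := map (vec (sample_ext z)) t.

(** The samples mentioned by the names of the rays: at most [n] for each of the [n] rays. The other
    samples are independent of the cone. *)
Definition support (t : codes) : {set 'I_R} :=
  [set a : 'I_R | [exists ij : 'I_n * 'I_n, (tnth t ij.1).2 ij.2 == Some (lshift n a)]].

Lemma card_support t : (#|support t| <= n * n)%N.
Proof.
pose g (ij : 'I_n * 'I_n) : option 'I_R :=
  if (tnth t ij.1).2 ij.2 is Some i then
    match fintype.split i with inl a => Some a | inr _ => None end else None.
have : [set Some a | a in support t] \subset [set g ij | ij in finset.setT].
  apply/fintype.subsetP => x /imsetP[a]; rewrite inE => /existsP[ij /eqP e] ->.
  apply/imsetP; exists ij; rewrite ?inE // /g e.
  by rewrite -[lshift n a]/(unsplit (inl a)) unsplitK.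
move=> /fintype.subset_leq_card; rewrite card_imset; last by move=> a b [].
move=> /leq_trans; apply; rewrite (leq_trans (leq_imset_card _ _)) //.
by rewrite cardsT card_prod !card_ord.
Qed.

Lemma gens_support t (z z' : {ffun 'I_R -> W}) : {in support t, z =1 z'} -> gens z t = gens z' t.
Proof.
move=> H; apply/eq_in_map => q /tnthP[i ->]; rewrite /vec /ray.
congr (_ *: nz_row (kermx _^T)); apply/matrixP => j k; rewrite !mxE /ray_row.
case e: ((tnth t i).2 j) => [x|//]; rewrite /sample_ext.
case ex: (fintype.split x) => [a|//]; rewrite H // inE.
apply/existsP; exists (i, j) => /=; rewrite e -(splitK x) ex; exact: eqxx.
Qed.

Lemma card_codes : #|codes| = ((4 * (R + n).+1 ^ n) ^ n)%N.
Proof.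
rewrite card_tuple; congr (_ ^ _)%N.
by rewrite !card_prod card_ffun card_option !card_ord !card_bool.
Qed.

(** By [iid_miss], the left-hand side of the hypothesis bounds the expected number of heavy cones
    missed by all samples outside their support. Being less than [1], it leaves a sample without
    such cones. *)
Lemma eps_net (e : F) : 0 <= e -> e <= 1 ->
  ((4 * (R + n).+1 ^ n) ^ n)%:R * (1 - e) ^+ (R - n * n) < 1 ->
  exists z : {ffun 'I_R -> W}, forall t : codes,
    (forall i, ~~ crossed (gens z t) (w (z i))) ->
    \sum_(i | crossed (gens z t) (w i)) p i <= e.
Proof.
move=> e0 e1 small; apply/not_existsP => H.
pose D t z (i : W) := crossed (gens z t) (w i).
pose bad t z := (e < \sum_(i | D t z i) p i) && [forall i in ~: support t, ~~ D t z (z i)].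
have : (1 : F) <= \sum_(t : codes) (1 - e) ^+ (R - n * n).
  apply: (@le_trans _ _ (\sum_(t : codes) \sum_z iid p z * (bad t z)%:R)).
    rewrite exchange_big /= -[leLHS](iid_sum R p1) ler_sum // => z _.
    have /existsNP[t /not_implyP[h1 /negP]] := H z; rewrite -ltNge => h2.
    rewrite (bigD1 t) //= -[leLHS]addr0 lerD ?sumr_ge0 //; last first.
      by move=> t' _; apply: mulr_ge0; [exact: iid_ge0|exact: ler0n].
    rewrite (_ : bad t z) ?mulr1 // /bad h2 /=; apply/forall_inP => i _; exact: h1.
  apply: ler_sum => t _; have HD (z z' : {ffun 'I_R -> W}) : {in support t, z =1 z'} -> D t z = D t z'.
    by move=> h; apply/funext => i; rewrite /D (gens_support h).
  apply: (le_trans (iid_miss p0 p1 e1 HD)).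
  by rewrite ler_wiXn2l ?subr_ge0 ?gerBl // leq_sub2l // card_support.
rewrite sumr_const cardT -cardE card_codes -mulr_natl => /le_lt_trans/(_ small).
by rewrite ltxx.
Qed.

Lemma crossedN (vs : seq 'rV[F]_n) u : ~~ crossed vs u ->
  all (fun v => 0 <= dot v u) vs \/ all (fun v => dot v u <= 0) vs.
Proof.
rewrite negb_and => /orP[] /hasPn H; [left|right]; apply/allP => v /H; by rewrite leNgt.
Qed.

(* Simplicial cones of a pulling triangulation of the arrangement of a random
   sample: by Clarkson's argument each of them is crossed by few vectors. *)
Lemma cutting (e : F) : (0 < R + n)%N -> 0 <= e -> e <= 1 ->
  ((4 * (R + n).+1 ^ n) ^ n)%:R * (1 - e) ^+ (R - n * n) < 1 ->
  exists V : seq (seq 'rV[F]_n), (size V <= ((R + n).+1 * (R + n)) ^ n)%N /\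
    forall c, exists vs, [/\ vs \in V, in_cone vs c
      & \sum_(i | crossed vs (w i)) p i <= e].
Proof.
move=> m0 e0 e1 /(eps_net e0 e1)[z Hz].
set zeta := sample_ext z; have spanz := @sample_ext_span z.
have := @sign_patterns F n [seq zeta i | i <- enum 'I_(R + n)] n n 1%:M (rank_leq_col _).
rewrite size_map size_enum_ord => -[S [sS HS]].
pose sg (s : seq bool) (i : 'I_(R + n)) := nth false s i.
(* One cone for each listed sign pattern and each list of [n] constraints; these are the two factors
   of the cardinality. *)
exists [seq map (vec zeta) (pulls zeta (sg s) finset.set0 (tval is_)) | s <- S, is_ <- enum {: n.-tuple 'I_(R + n)}].
split.
  by rewrite size_allpairs -cardE card_tuple card_ord expnMn leq_mul2r sS orbT.
move=> c; set s := [seq dot c x < 0 | x <- [seq zeta i | i <- enum 'I_(R + n)]].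
have sE i : sg s i = (dot c (zeta i) < 0).
  rewrite /sg /s -map_comp (nth_map i) ?size_enum_ord //= nth_ord_enum //.
have fc : face zeta (sg s) finset.set0 c.
  apply/faceP; split => i; rewrite ?inE // sE.
  by case: ltP => h; rewrite ?expr1 ?expr0 ?mulN1r ?mul1r ?oppr_ge0 // ltW.
have [|is_ [sz cone]] := @pulling _ _ _ _ spanz (sg s) n finset.set0 c m0 fc.
  exact: leq_subr.
have szt : size is_ == n by rewrite sz.
exists (map (vec zeta) (pulls zeta (sg s) finset.set0 is_)); split => //.
  apply/allpairsP; exists (s, Tuple szt); split => //=.
    by apply: HS; exact: submx1.
  by rewrite mem_enum.
have szp : size (pulls zeta (sg s) finset.set0 is_) == n by rewrite size_pulls sz.
(* All generators lie in one closed cell of the sample arrangement, so no sample crosses the cone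
   and the net property applies. *)
apply: (Hz (Tuple szp)) => a.
rewrite /gens /= /crossed negb_and; apply/orP.
have h v : v \in map (vec zeta) (pulls zeta (sg s) finset.set0 is_) ->
    0 <= (-1) ^+ sg s (lshift n a) * dot v (w (z a)).
  case/mapP => q qp ->; have /faceP[/(_ (lshift n a)) + _] := pulls_face qp.
  by rewrite /zeta sample_extL.
case: (sg s _) h => h; [right|left]; apply/hasPn => v /h; rewrite -leNgt.
  by rewrite expr1 mulN1r oppr_ge0.
by rewrite expr0 mul1r.
Qed.

End Net.

Local Open Scope classical_set_scope.
Local Open Scope ring_scope.

(** * Covariances of bounded variables under mixing *)

Section Expectation.
Variables (R : realType) (disp : measure_display) (Omega : measurableType disp).
Variable P : probability Omega R.
Implicit Types U V : Omega -> R.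

(** Bounds hold everywhere, not almost surely: the class is closed under the algebraic operations
    and all expectations are finite. Almost sure bounds are turned into such bounds by
    truncation. *)
Definition bmeas U : Prop :=
  measurable_fun setT U /\ exists c, forall w, `|U w| <= c.

Definition Ex U : R := \int[P]_w U w.

Lemma bmeas_int U : bmeas U -> P.-integrable setT (EFin \o U).
Proof.
move=> [mU [c Uc]]; apply: measurable_bounded_integrable => //.
  by rewrite (le_lt_trans (probability_le1 P measurableT)) ?ltry.
exists c; split; first exact: num_real.
by move=> x cx w _; exact: le_trans (Uc w) (ltW cx).
Qed.

Lemma ExE U : bmeas U -> ((Ex U)%:E = \int[P]_w (U w)%:E)%E.
Proof.
by move=> /bmeas_int iU; rewrite /Ex /Rintegral fineK //; exact: integrable_fin_num.
Qed.

Lemma bmeas_cst c : bmeas (fun _ => c).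
Proof. by split; [exact: measurable_cst|exists `|c|]. Qed.

Lemma bmeasD U V : bmeas U -> bmeas V -> bmeas (fun w => U w + V w).
Proof.
move=> [mU [a Ua]] [mV [b Vb]]; split; first exact: measurable_funD.
by exists (a + b) => w; rewrite (le_trans (ler_normD _ _)) // lerD.
Qed.

Lemma bmeasM U V : bmeas U -> bmeas V -> bmeas (fun w => U w * V w).
Proof.
move=> [mU [a Ua]] [mV [b Vb]]; split; first exact: measurable_funM.
by exists (a * b) => w; rewrite normrM ler_pM.
Qed.

Lemma bmeasZ k U : bmeas U -> bmeas (fun w => k * U w).
Proof. by move=> bU; apply: bmeasM => //; exact: bmeas_cst. Qed.

Lemma bmeasN U : bmeas U -> bmeas (fun w => - U w).
Proof.
move=> /(bmeasZ (-1)); congr bmeas; apply/funext => w; exact: mulN1r.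
Qed.

Lemma bmeasB U V : bmeas U -> bmeas V -> bmeas (fun w => U w - V w).
Proof. by move=> bU bV; apply: bmeasD => //; exact: bmeasN. Qed.

Lemma bmeas_sum I (s : seq I) (p : pred I) (F : I -> Omega -> R) :
  (forall i, bmeas (F i)) -> bmeas (fun w => \sum_(i <- s | p i) F i w).
Proof.
move=> bF; elim: s => [|i s IH].
  rewrite (_ : (fun _ => _) = fun=> 0); first exact: bmeas_cst.
  by apply/funext => w; rewrite big_nil.
case pi: (p i); last first.
  by rewrite (_ : (fun _ => _) = fun w => \sum_(i <- s | p i) F i w) //; apply/funext => w; rewrite big_cons pi.
rewrite (_ : (fun _ => _) = fun w => F i w + \sum_(i <- s | p i) F i w); first exact: bmeasD.
by apply/funext => w; rewrite big_cons pi.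
Qed.

Lemma bmeas_bool (b : Omega -> bool) : measurable [set w | b w] ->
  bmeas (fun w => (b w)%:R).
Proof.
move=> mb; split; last by exists 1 => w; rewrite ger0_norm // lern1 leq_b1.
rewrite (_ : (fun _ => _) = \1_[set w | b w]); first exact: measurable_indic.
apply/funext => w; rewrite indicE; case e: (b w).
  by rewrite mem_set.
by rewrite memNset // /= e.
Qed.

Lemma ExD U V : bmeas U -> bmeas V -> Ex (fun w => U w + V w) = Ex U + Ex V.
Proof. by move=> bU bV; rewrite /Ex RintegralD //; exact: bmeas_int. Qed.

Lemma ExZ k U : bmeas U -> Ex (fun w => k * U w) = k * Ex U.
Proof. by move=> bU; rewrite /Ex RintegralZl //; exact: bmeas_int. Qed.

Lemma ExN U : bmeas U -> Ex (fun w => - U w) = - Ex U.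
Proof.
move=> bU; rewrite -mulN1r -ExZ //; congr Ex; apply/funext => w; exact/esym/mulN1r.
Qed.

Lemma ExB U V : bmeas U -> bmeas V -> Ex (fun w => U w - V w) = Ex U - Ex V.
Proof. by move=> bU bV; rewrite ExD ?ExN //; exact: bmeasN. Qed.

Lemma Ex_cst c : Ex (fun _ => c) = c.
Proof.
rewrite /Ex Rintegral_cst // (_ : fine _ = 1) ?mulr1 //.
by rewrite -[RHS]/(fine 1%E); congr fine; exact: probability_setT.
Qed.

Lemma Ex_le U V : bmeas U -> bmeas V -> (forall w, U w <= V w) -> Ex U <= Ex V.
Proof. by move=> bU bV UV; apply: le_Rintegral => //; exact: bmeas_int. Qed.

Lemma Ex_ge0 U : (forall w, 0 <= U w) -> 0 <= Ex U.
Proof. by move=> U0; apply: Rintegral_ge0. Qed.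

Lemma Ex_sum I (s : seq I) (p : pred I) (F : I -> Omega -> R) :
  (forall i, bmeas (F i)) ->
  Ex (fun w => \sum_(i <- s | p i) F i w) = \sum_(i <- s | p i) Ex (F i).
Proof.
move=> bF; elim: s => [|i s IH].
  rewrite big_nil -[RHS](Ex_cst 0); congr Ex; apply/funext => w; exact: big_nil.
rewrite big_cons; case pi: (p i); rewrite -IH; last first.
  by congr Ex; apply/funext => w; rewrite big_cons pi.
rewrite -ExD //; last exact: bmeas_sum.
by congr Ex; apply/funext => w; rewrite big_cons pi.
Qed.

Lemma Ex_bool (b : Omega -> bool) : measurable [set w | b w] ->
  Ex (fun w => (b w)%:R) = fine (P [set w | b w]).
Proof.
move=> mb; rewrite /Ex /Rintegral -[X in P X]setIT -integral_indic //; congr fine.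
apply: eq_integral => w _; rewrite indicE; case e: (b w).
  by rewrite mem_set.
by rewrite memNset // /= e.
Qed.

End Expectation.

Section Covariance.
Variables (R : realType) (disp : measure_display) (Omega : measurableType disp).
Variable P : probability Omega R.
Variables (G1 G2 : set (set Omega)) (a : R).
Hypotheses (sG1 : G1 `<=` measurable) (sG2 : G2 `<=` measurable).
Hypothesis mix : forall A B, <<s G1 >> A -> <<s G2 >> B ->
  (P (A `&` B) <= P A * P B + a%:E)%E.
Implicit Types U V : Omega -> R.

Definition smeas (G : set (set Omega)) U : Prop :=
  @measurable_fun _ _ (g_sigma_algebraType G) R setT U.

Lemma smeas_measurable (G : set (set Omega)) U : G `<=` measurable ->
  smeas G U -> measurable_fun setT U.
Proof.
move=> sG mU _ B mB; have := mU measurableT B mB.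
by apply: smallest_sub => //; exact: sigma_algebra_measurable.
Qed.

Lemma smeas_ge (G : set (set Omega)) U c : smeas G U -> <<s G >> [set w | c <= U w].
Proof.
move=> mU; have := mU measurableT _ (measurable_itv `[c, +oo[).
rewrite setTI (_ : _ @^-1` _ = [set w | c <= U w]) //.
by apply/seteqP; split => w /=; rewrite in_itv /= andbT.
Qed.

(** A layer-cake sum: an average of indicators of superlevel sets, to which mixing applies event by
    event. The levels start at [1 / k], so the approximation is from below. *)
Definition staircase (k : nat) U (w : Omega) : R :=
  k%:R^-1 * \sum_(j < k) (j.+1%:R / k%:R <= U w)%R%:R.

Lemma staircase_bounds k U w : (0 < k)%N -> 0 <= U w <= 1 ->
  staircase k U w <= U w <= staircase k U w + k%:R^-1.
Proof.
move=> k0 /andP[U0 U1]; have kR : (0 : R) < k%:R by rewrite ltr0n.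
set t := Num.truncn (k%:R * U w).
have kU0 : 0 <= k%:R * U w by rewrite mulr_ge0 // ltW.
have tk : (t <= k)%N.
  by rewrite truncn_le_nat (le_lt_trans _ (_ : k%:R < _)) ?ltr_nat // ler_piMr // ltW.
have -> : staircase k U w = k%:R^-1 * t%:R.
  congr (_ * _); transitivity ((\sum_(j < k) (j < t)%N)%:R : R).
    rewrite natr_sum; apply: eq_bigr => j _; congr (_%:R).
    rewrite ler_pdivrMr // mulrC /t; congr nat_of_bool.
    by rewrite -(truncn_ge_nat _ kU0).
  congr (_%:R); have [m ->] : exists m, (k = t + m)%N by exists (k - t)%N; lia.
  rewrite -(big_mkord xpredT (fun j => (j < t)%N : nat)) /= (@big_cat_nat _ _ _ t) ?leq_addr //=.
  rewrite (eq_big_nat _ _ (F2 := fun=> 1%N)) => [|i /andP[_ ->]//].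
  rewrite sum_nat_const_nat subn0 muln1 big_nat_cond big1 ?addn0 //.
  by move=> i /andP[/andP[ti _] _]; rewrite ltnNge ti.
have /andP[h1 h2] := truncn_itv kU0.
apply/andP; split; first by rewrite ler_pdivrMl.
rewrite -[X in _ + X]mulr1 -mulrDr ler_pdivlMl //.
by rewrite (le_trans (ltW h2)) // -natr1.
Qed.

Lemma staircase_bmeas (G : set (set Omega)) k U : G `<=` measurable -> smeas G U ->
  bmeas (staircase k U).
Proof.
move=> sG mU; apply: bmeasZ; apply: bmeas_sum => j; apply: bmeas_bool.
apply: (smallest_sub _ sG) (smeas_ge _ mU); exact: sigma_algebra_measurable.
Qed.

(** For staircases the product expands into pairs of superlevel events. Each pair costs [a], and the
    prefactor [1 / k ^ 2] averages these [k ^ 2] costs back to [a]; the discretization error [2 / k]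
    is arbitrarily small. *)
Lemma cov_le01 U V : smeas G1 U -> smeas G2 V ->
  (forall w, 0 <= U w <= 1) -> (forall w, 0 <= V w <= 1) ->
  Ex P (fun w => U w * V w) <= Ex P U * Ex P V + a.
Proof.
move=> mU mV U01 V01.
have nU w : `|U w| <= 1 by have /andP[h1 h2] := U01 w; rewrite ger0_norm.
have nV w : `|V w| <= 1 by have /andP[h1 h2] := V01 w; rewrite ger0_norm.
have bU : bmeas U by split; [exact: smeas_measurable sG1 mU|exists 1].
have bV : bmeas V by split; [exact: smeas_measurable sG2 mV|exists 1].
apply/ler_addgt0Pr => e e0.
have [k [k0 ke]] : exists k, (0 < k)%N /\ 2 / k%:R <= e.
  exists (Num.truncn (2 / e)).+1; split => //.
  rewrite ler_pdivrMr ?ltr0n // mulrC -ler_pdivrMr //; exact/ltW/truncnS_gt.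
have kR : (0 : R) < k%:R by rewrite ltr0n.
have bUk := staircase_bmeas k sG1 mU; have bVk := staircase_bmeas k sG2 mV.
have hU w := staircase_bounds k0 (U01 w).
have hV w := staircase_bounds k0 (V01 w).
set Uk := staircase k U in bUk hU *; set Vk := staircase k V in bVk hV *.
have Uk0 w : 0 <= Uk w by rewrite mulr_ge0 ?invr_ge0 // sumr_ge0.
have Vk0 w : 0 <= Vk w by rewrite mulr_ge0 ?invr_ge0 // sumr_ge0.
have le1 : Ex P (fun w => U w * V w) <= Ex P (fun w => Uk w * Vk w) + 2 / k%:R.
  rewrite -[X in _ + X](Ex_cst P) -ExD; [|exact: bmeasM|exact: bmeas_cst].
  apply: Ex_le => [||w]; [exact: bmeasM| |].
    by apply: bmeasD; [exact: bmeasM|exact: bmeas_cst].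
  have /andP[a1 a2] := hU w; have /andP[b1 b2] := hV w.
  have /andP[c1 c2] := U01 w; have /andP[d1 d2] := V01 w.
  have kV0 : 0 <= k%:R^-1 :> R by rewrite invr_ge0 ltW.
  have := Uk0 w; have := Vk0 w; rewrite mulrC; move: kV0 a1 a2 b1 b2 c1 c2 d1 d2.
  move: (k%:R^-1) (Uk w) (Vk w) (U w) (V w) => q x y u v q0 a1 a2 b1 b2 c1 c2 d1 d2 y0 x0.
  have h1 : u * v <= (x + q) * v by rewrite ler_wpM2r.
  have h2 : q * v <= q by rewrite ler_piMr.
  have h3 : x * v <= x * (y + q) by rewrite ler_wpM2l.
  have h4 : x * q <= q by rewrite ler_piMl // (le_trans a1).
  lra.
have le2 : Ex P (fun w => Uk w * Vk w) <= Ex P Uk * Ex P Vk + a.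
  pose A j := [set w | j.+1%:R / k%:R <= U w]; pose B j := [set w | j.+1%:R / k%:R <= V w].
  have sA j : <<s G1 >> (A j) by exact: smeas_ge.
  have sB j : <<s G2 >> (B j) by exact: smeas_ge.
  have mA j : measurable (A j).
    by apply: (smallest_sub _ sG1) (sA j); exact: sigma_algebra_measurable.
  have mB j : measurable (B j).
    by apply: (smallest_sub _ sG2) (sB j); exact: sigma_algebra_measurable.
  have EU : Ex P Uk = k%:R^-1 * \sum_(j < k) fine (P (A j)).
    rewrite ExZ ?Ex_sum; [|by move=> j; exact: bmeas_bool (mA j)|by apply: bmeas_sum => j; exact: bmeas_bool (mA j)].
    by congr (_ * _); apply: eq_bigr => j _; rewrite Ex_bool //; exact: mA.
  have EV : Ex P Vk = k%:R^-1 * \sum_(j < k) fine (P (B j)).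
    rewrite ExZ ?Ex_sum; [|by move=> j; exact: bmeas_bool (mB j)|by apply: bmeas_sum => j; exact: bmeas_bool (mB j)].
    by congr (_ * _); apply: eq_bigr => j _; rewrite Ex_bool //; exact: mB.
  have -> : (fun w => Uk w * Vk w) = fun w => (k%:R^-1 * k%:R^-1) *
     \sum_(i < k) \sum_(j < k) ((i.+1%:R / k%:R <= U w) && (j.+1%:R / k%:R <= V w))%R%:R.
    apply/funext => w; rewrite /Uk /Vk /staircase mulrACA; congr (_ * _).
    rewrite mulr_suml; apply: eq_bigr => i _; rewrite mulr_sumr; apply: eq_bigr => j _.
    by rewrite -natrM mulnb.
  have mAB i j : measurable [set w | (i.+1%:R / k%:R <= U w) && (j.+1%:R / k%:R <= V w)].
    rewrite (_ : [set _ | _] = A i `&` B j); first exact: measurableI.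
    by apply/seteqP; split => w /= /andP.
  rewrite ExZ ?Ex_sum; last 2 first.
  - by move=> i; apply: bmeas_sum => j; exact: bmeas_bool.
  - by apply: bmeas_sum => i; apply: bmeas_sum => j; exact: bmeas_bool.
  rewrite EU EV mulrACA.
  have k2 : (0 : R) < k%:R^-1 * k%:R^-1 by rewrite mulr_gt0 ?invr_gt0.
  have -> : a = (k%:R^-1 * k%:R^-1) * \sum_(i < k) \sum_(j < k) a.
    rewrite !sumr_const !card_ord -[a *+ k *+ k]mulr_natr -[a *+ k]mulr_natr; move: (k%:R : R) kR => q q0.
    by field; rewrite gt_eqF.
  rewrite -mulrDr ler_pM2l // mulr_suml -big_split /= ler_sum // => i _.
  rewrite Ex_sum; last by move=> j; exact: bmeas_bool.
  rewrite mulr_sumr -big_split ler_sum //= => j _.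
  rewrite Ex_bool // (_ : [set w | _ && _] = A i `&` B j); last first.
    by apply/seteqP; split => w /= /andP.
  have := mix (sA i) (sB j).
  rewrite -(fineK (fin_num_measure P _ (mA i))) -(fineK (fin_num_measure P _ (mB j))).
  by rewrite -(fineK (fin_num_measure P _ (measurableI _ _ (mA i) (mB j)))) lee_fin.
have le3 : Ex P Uk * Ex P Vk <= Ex P U * Ex P V.
  apply: ler_pM; [exact: Ex_ge0|exact: Ex_ge0| |]; apply: Ex_le => // w.
    by have /andP[] := hU w.
  by have /andP[] := hV w.
apply: le_trans le1 _; lra.
Qed.

(** The upper bound applied to [U] and [1 - V]. *)
Lemma cov_ge01 U V : smeas G1 U -> smeas G2 V ->
  (forall w, 0 <= U w <= 1) -> (forall w, 0 <= V w <= 1) ->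
  Ex P U * Ex P V - a <= Ex P (fun w => U w * V w).
Proof.
move=> mU mV U01 V01.
have nU w : `|U w| <= 1 by have /andP[h1 h2] := U01 w; rewrite ger0_norm.
have nV w : `|V w| <= 1 by have /andP[h1 h2] := V01 w; rewrite ger0_norm.
have bU : bmeas U by split; [exact: smeas_measurable sG1 mU|exists 1].
have bV : bmeas V by split; [exact: smeas_measurable sG2 mV|exists 1].
have := @cov_le01 U (fun w => 1 - V w) mU _ U01 _.
have -> : (fun w => U w * (1 - V w)) = fun w => U w - U w * V w.
  by apply/funext => w; ring.
rewrite ExB //; last exact: bmeasM.
rewrite ExB //; last exact: bmeas_cst.
rewrite Ex_cst => H; have {}H := H _ _.
suff : Ex P U - Ex P (fun w => U w * V w) <= Ex P U * (1 - Ex P V) + a by lra.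
apply: H.
  by apply: measurable_funB => //; exact: measurable_cst.
by move=> w; have := V01 w; lra.
Qed.

(** The factor [4 * u * v] comes from the affine maps onto [[0, 1]], which divide by [2 * u] and
    [2 * v]. *)
Lemma cov_abs U V u v : 0 < u -> 0 < v -> smeas G1 U -> smeas G2 V ->
  (forall w, `|U w| <= u) -> (forall w, `|V w| <= v) ->
  `|Ex P (fun w => U w * V w) - Ex P U * Ex P V| <= 4 * u * v * a.
Proof.
move=> u0 v0 mU mV bU' bV'.
have bU : bmeas U by split; [exact: smeas_measurable sG1 mU|exists u].
have bV : bmeas V by split; [exact: smeas_measurable sG2 mV|exists v].
pose U1 w := (2 * u)^-1 * (U w + u); pose V1 w := (2 * v)^-1 * (V w + v).
have mU1 : smeas G1 U1.
  apply: measurable_funM; first exact: measurable_cst.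
  by apply: measurable_funD => //; exact: measurable_cst.
have mV1 : smeas G2 V1.
  apply: measurable_funM; first exact: measurable_cst.
  by apply: measurable_funD => //; exact: measurable_cst.
have U101 w : 0 <= U1 w <= 1.
  have := bU' w; rewrite ler_norml => /andP[h1 h2].
  rewrite /U1 mulr_ge0 ?invr_ge0 ?mulr_ge0 ?(ltW u0) //=; last by lra.
  by rewrite ler_pdivrMl ?mulr_gt0 // mulr1; lra.
have V101 w : 0 <= V1 w <= 1.
  have := bV' w; rewrite ler_norml => /andP[h1 h2].
  rewrite /V1 mulr_ge0 ?invr_ge0 ?mulr_ge0 ?(ltW v0) //=; last by lra.
  by rewrite ler_pdivrMl ?mulr_gt0 // mulr1; lra.
have := cov_le01 mU1 mV1 U101 V101; have := cov_ge01 mU1 mV1 U101 V101.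
have bUu : bmeas (fun w => U w + u) by apply: bmeasD => //; exact: bmeas_cst.
have bVv : bmeas (fun w => V w + v) by apply: bmeasD => //; exact: bmeas_cst.
have -> : Ex P U1 = (2 * u)^-1 * (Ex P U + u).
  by rewrite ExZ // ExD ?Ex_cst //; exact: bmeas_cst.
have -> : Ex P V1 = (2 * v)^-1 * (Ex P V + v).
  by rewrite ExZ // ExD ?Ex_cst //; exact: bmeas_cst.
have -> : Ex P (fun w => U1 w * V1 w) = (4 * u * v)^-1 *
    (Ex P (fun w => U w * V w) + v * Ex P U + u * Ex P V + u * v).
  have -> : (fun w => U1 w * V1 w) = fun w => (4 * u * v)^-1 *
      (((U w * V w + v * U w) + u * V w) + u * v).
    by apply/funext => w; rewrite /U1 /V1; field; rewrite !gt_eqF.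
  have bUV := bmeasM bU bV.
  have b1 := bmeasD bUV (bmeasZ v bU); have b2 := bmeasD b1 (bmeasZ u bV).
  have bc : bmeas (fun _ : Omega => u * v) := bmeas_cst _ _.
  rewrite ExZ ?(ExD P b2 bc) ?(ExD P b1 (bmeasZ u bV)) ?(ExD P bUV (bmeasZ v bU)) ?Ex_cst ?ExZ //.
  exact: bmeasD.
have -> : (2 * u)^-1 * (Ex P U + u) * ((2 * v)^-1 * (Ex P V + v)) =
  (4 * u * v)^-1 * (Ex P U * Ex P V + v * Ex P U + u * Ex P V + u * v).
  by field; rewrite !gt_eqF.
have c0 : 0 < 4 * u * v by rewrite !mulr_gt0.
move: (Ex P U) (Ex P V) (Ex P (fun w => U w * V w)) c0 => p q e c0 h1 h2.
have d1 : (4 * u * v)^-1 * (p * q - e) <= a by lra.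
have d2 : (4 * u * v)^-1 * (e - p * q) <= a by lra.
rewrite ler_pdivrMl // in d1; rewrite ler_pdivrMl // in d2.
by rewrite ler_norml; apply/andP; split; lra.
Qed.

End Covariance.

(** * Exponential deviations over a window *)

(** Squaring [1 - x / 2 <= expR (- (x / 2))] reduces the bound to a polynomial inequality, whose
    excess factors into terms that are nonnegative when [x] lies in [[-1, 1]]. *)
Lemma expR_le_quadratic (R : realType) (x : R) : `|x| <= 1 -> expR x <= 1 + x + 2 * x ^+ 2.
Proof.
rewrite ler_norml => /andP[h1 h2].
have e1 : 1 - x / 2 <= expR (- (x / 2)) by have := expR_ge1Dx (- (x / 2)).
have e2 : (1 - x / 2) ^+ 2 <= expR (- x).
  have -> : - x = - (x / 2) + - (x / 2) by field.
  by rewrite expRD -expr2 ler_sqr ?nnegrE ?expR_ge0 //; lra.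
have p0 : 0 <= 1 + x + 2 * x ^+ 2 by nra.
have : 1 <= (1 - x / 2) ^+ 2 * (1 + x + 2 * x ^+ 2).
  have -> : (1 - x / 2) ^+ 2 * (1 + x + 2 * x ^+ 2) =
     1 + x ^+ 2 * (1 - x) * (5 / 4 - x / 2) by field.
  by rewrite lerDl; apply: mulr_ge0; [apply: mulr_ge0; [exact: sqr_ge0|lra]|lra].
move=> /le_trans/(_ (ler_wpM2r p0 e2)).
by rewrite expRN ler_pdivlMl ?expR_gt0 // mulr1.
Qed.

Lemma measurable_natr_bool d (T : measurableType d) (R : realType) (b : T -> bool) :
  measurable [set w | b w] -> measurable_fun setT (fun w => (b w)%:R : R).
Proof.
move=> mb; rewrite (_ : (fun _ => _) = \1_[set w | b w]); first exact: measurable_indic.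
apply/funext => w; rewrite indicE; case e: (b w).
  by rewrite mem_set.
by rewrite memNset // /= e.
Qed.

Lemma measurable_set_le d (T : measurableType d) (R : realType) (f : T -> R) c :
  measurable_fun setT f -> measurable [set w | f w <= c].
Proof.
move=> mf; have := mf measurableT _ (measurable_itv `]-oo, c]).
rewrite setTI (_ : _ @^-1` _ = [set w | f w <= c]) //.
Qed.

Section Fields.
Variables (R : realType) (N : nat) (disp d' : measure_display).
Variables (Omega : measurableType disp) (T : measurableType d') (P : probability Omega R).
Variable Z : lattice N -> Omega -> T.
Hypothesis mZ : forall s, measurable_fun setT (Z s).

Definition field_system (I : set (lattice N)) : set (set Omega) :=
  \bigcup_(s in I) preimage_set_system setT (Z s) measurable.

Lemma field_system_measurable I : field_system I `<=` measurable.
Proof. by move=> A [s _ [B mB <-]]; exact: mZ. Qed.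

Lemma smeas_sub (G G' : set (set Omega)) (U : Omega -> R) : G `<=` G' ->
  smeas G U -> smeas G' U.
Proof.
move=> GG mU _ B mB; have := mU measurableT B mB.
by apply: sub_sigma_algebra2.
Qed.

Lemma smeas_field (I : set (lattice N)) s (h : T -> R) : I s ->
  measurable_fun setT h -> smeas (field_system I) (fun w => h (Z s w)).
Proof.
move=> Is mh _ B mB; rewrite setTI; apply: sub_sigma_algebra.
exists s => //; exists (h @^-1` B); last by rewrite setTI.
by rewrite -[X in measurable X]setTI; exact: mh.
Qed.

Lemma field_systemS I J : I `<=` J -> field_system I `<=` field_system J.
Proof. by move=> IJ; apply: bigcup_subset. Qed.

Lemma mixing_ineq (c0 c1 : R) (k : nat) (I J : set (lattice N)) A B :
  strong_mixing P Z c0 c1 -> (forall s t, I s -> J t -> (k <= dist_oo s t)%N) ->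
  <<s field_system I >> A -> <<s field_system J >> B ->
  (P (A `&` B) <= P A * P B + (c0 * expR (- (c1 * k%:R)))%:E)%E.
Proof.
move=> mix dIJ sA sB.
have mA : measurable A.
  apply: smallest_sub sA; [exact: sigma_algebra_measurable|exact: field_system_measurable].
have mB : measurable B.
  apply: smallest_sub sB; [exact: sigma_algebra_measurable|exact: field_system_measurable].
have h : (`|P (A `&` B) - P A * P B| <= (c0 * expR (- (c1 * k%:R)))%:E)%E.
  apply: le_trans (mix k); apply: ereal_sup_ubound.
  exists I, J, A, B; split => //.
  by apply: le_ereal_inf_tmp => _ [s [t [Is Jt ->]]]; rewrite lee_fin ler_nat; exact: dIJ.
move: h.
rewrite -(fineK (fin_num_measure P _ mA)) -(fineK (fin_num_measure P _ mB)).
rewrite -(fineK (fin_num_measure P _ (measurableI _ _ mA mB))).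
rewrite -EFinM -EFinB abse_EFin -EFinD !lee_fin ler_norml => /andP[_].
by rewrite lerBlDr addrC.
Qed.

Section Frozen.
Variables (c0 c1 : R) (a : nat).
Hypothesis (mix : strong_mixing P Z c0 c1).
Variables (h : lattice N -> T -> R) (lam Lam : R).
Hypotheses (mh : forall s, measurable_fun setT (h s)) (h1 : forall s t, `|h s t| <= 1).
Hypothesis (hE : forall s, Ex P (fun w => h s (Z s w)) <= 0).
Hypotheses (lam0 : 0 < lam) (lam1 : lam <= 1) (Lam0 : 0 <= Lam).

Let alpha := c0 * expR (- (c1 * a%:R)).
Let F s w := expR (lam * h s (Z s w) - 2 * lam ^+ 2).

(* The exponential supermartingale is frozen once it exceeds [expR Lam], so
   that it stays bounded by [expR (Lam + 1)]: each step then costs only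
   [expR (Lam + 1)] times the mixing coefficient. *)
Fixpoint frozen (ss : seq (lattice N)) (w : Omega) : R :=
  if ss is s :: ss' then
    if frozen ss' w <= expR Lam then frozen ss' w * F s w else frozen ss' w
  else 1.

Let F_gt0 s w : 0 < F s w. Proof. exact: expR_gt0. Qed.

Let F_le s w : F s w <= expR 1.
Proof.
rewrite ler_expR; have := h1 s (Z s w); rewrite ler_norml => /andP[_ hh].
have : lam * h s (Z s w) <= lam by rewrite ler_piMr // ltW.
move=> hl; have l2 := sqr_ge0 lam; have l1 := lam1; lra.
Qed.

Lemma frozen_bounds ss w : 0 < frozen ss w <= expR (Lam + 1).
Proof.
elim: ss => [|s ss /andP[z0 zL]] /=.
  by rewrite ltr01 -expR0 ler_expR addr_ge0.
case: ifP => [hz|_]; last by rewrite z0.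
by rewrite mulr_gt0 //= expRD ler_pM // ltW.
Qed.

Let F_smeas I s : I s -> smeas (field_system I) (F s).
Proof.
move=> Is; rewrite /F.
apply: (@smeas_field I s (fun t => expR (lam * h s t - 2 * lam ^+ 2)) Is).
apply: measurableT_comp; first exact: measurable_expR.
apply: measurable_funB; last exact: measurable_cst.
by apply: measurable_funM; [exact: measurable_cst|exact: mh].
Qed.

Lemma frozen_smeas ss : smeas (field_system [set` ss]) (frozen ss).
Proof.
elim: ss => [|s ss IH]; first exact: measurable_cst.
have mz : smeas (field_system [set` s :: ss]) (frozen ss).
  by apply: smeas_sub IH; apply: field_systemS => t /= tss; rewrite inE tss orbT.
have mF : smeas (field_system [set` s :: ss]) (F s).
  by apply: F_smeas => /=; rewrite inE eqxx.
have mb : @measurable_fun _ _ (g_sigma_algebraType (field_system [set` s :: ss])) R setT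
    (fun w => (frozen ss w <= expR Lam)%R%:R).
  exact/measurable_natr_bool/measurable_set_le.
rewrite /smeas (_ : frozen (s :: ss) = fun w =>
  frozen ss w * (F s w * (frozen ss w <= expR Lam)%R%:R + (1 - (frozen ss w <= expR Lam)%R%:R))).
  apply: measurable_funM => //; apply: measurable_funD; first exact: measurable_funM.
  by apply: measurable_funB => //; exact: measurable_cst.
apply/funext => w /=; case: ifP => _ /=.
  by rewrite mulr1 subrr addr0.
by rewrite mulr0 add0r subr0 mulr1.
Qed.

Let sys_meas I : field_system I `<=` measurable := @field_system_measurable I.

Lemma frozen_bmeas ss : bmeas (frozen ss).
Proof.
split; first exact (smeas_measurable (@sys_meas _) (@frozen_smeas ss)).
by exists (expR (Lam + 1)) => w; have /andP[z0 zL] := frozen_bounds ss w; rewrite gtr0_norm.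
Qed.

Let hZ_bmeas s : bmeas (fun w => h s (Z s w)).
Proof.
split; last by exists 1.
by apply: measurableT_comp; [exact: mh|exact: mZ].
Qed.

Let F_bmeas s : bmeas (F s).
Proof.
split; last by exists (expR 1) => w; rewrite gtr0_norm.
exact (smeas_measurable (@sys_meas _) (@F_smeas [set s] s erefl)).
Qed.

(** The compensator [2 * lam ^+ 2] absorbs the quadratic term of the exponential, and the linear
    term has nonpositive mean. *)
Lemma Ex_factor_le1 s : Ex P (F s) <= 1.
Proof.
have bq : bmeas (fun w => expR (- (2 * lam ^+ 2)) * (1 + lam * h s (Z s w) + 2 * lam ^+ 2)).
  apply: bmeasZ; apply: bmeasD; last exact: bmeas_cst.
  by apply: bmeasD; [exact: bmeas_cst|exact: bmeasZ].
apply: (@le_trans _ _ (Ex P (fun w => expR (- (2 * lam ^+ 2)) *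
    (1 + lam * h s (Z s w) + 2 * lam ^+ 2)))).
  apply: Ex_le => // w; rewrite /F addrC expRD ler_pM2l ?expR_gt0 //.
  have nl : `|lam * h s (Z s w)| <= lam.
    by rewrite normrM gtr0_norm // ler_piMr // ltW.
  apply: le_trans (expR_le_quadratic (le_trans nl lam1)) _.
  by rewrite lerD2l ler_pM2l // -real_normK ?num_real // lerXn2r ?nnegrE // ltW.
have b1 := bmeasD (bmeas_cst Omega 1) (bmeasZ lam (hZ_bmeas s)).
rewrite ExZ ?ExD ?ExZ ?Ex_cst //; try exact: bmeas_cst; try exact: bmeasZ; last first.
  by apply: bmeasD => //; exact: bmeas_cst.
rewrite expRN ler_pdivrMl ?expR_gt0 // mulr1.
have := expR_ge1Dx (2 * lam ^+ 2); apply: le_trans.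
rewrite lerD2r gerDl; exact: mulr_ge0_le0 (ltW lam0) (hE s).
Qed.

(** The new site is at distance at least [a] from the earlier ones, so its factor, of mean at most
    [1], splits off up to [alpha]. The covariance bound is applied to the active part divided by
    [expR Lam] and to the factor divided by [expR 1], both in [[0, 1]]; undoing this scaling gives
    the cost per site. *)
Lemma frozen_Ex ss : pairwise (fun s t => a <= dist_oo s t)%N ss ->
  Ex P (frozen ss) <= 1 + (size ss)%:R * (expR (Lam + 1) * alpha).
Proof.
elim: ss => [|s ss IH] /=; first by rewrite Ex_cst mul0r addr0.
move=> /andP[/allP ds /IH {}IH].
pose b w : R := (frozen ss w <= expR Lam)%R%:R.
have bz := frozen_bmeas ss.
have mb : smeas (field_system [set` ss]) b.
  by apply: measurable_natr_bool; apply: measurable_set_le; apply: frozen_smeas.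
have bb : bmeas b.
  by split; [exact (smeas_measurable (@sys_meas _) mb)|exists 1 => w; rewrite ger0_norm // lern1 leq_b1].
have bF := F_bmeas s.
have bzb := bmeasM bz bb.
have bzbF := bmeasM bzb bF.
have -> : Ex P (fun w => if frozen ss w <= expR Lam then frozen ss w * F s w else frozen ss w) =
    Ex P (fun w => frozen ss w - frozen ss w * b w) + Ex P (fun w => frozen ss w * b w * F s w).
  rewrite -ExD //; last exact: bmeasB.
  congr Ex; apply/funext => w; rewrite /b; case: ifP => _ /=; ring.
rewrite ExB //.
suff H : Ex P (fun w => frozen ss w * b w * F s w) <=
    Ex P (fun w => frozen ss w * b w) + expR (Lam + 1) * alpha.
  rewrite -natr1; lra.
have eL := expR_gt0 Lam; have e1 := expR_gt0 (1 : R).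
have := @cov_le01 R disp Omega P (field_system [set` ss]) (field_system [set s]) alpha
  (@sys_meas _) (@sys_meas _) _
  (fun w => (expR Lam)^-1 * (frozen ss w * b w)) (fun w => (expR 1)^-1 * F s w).
have -> : (fun w => (expR Lam)^-1 * (frozen ss w * b w) * ((expR 1)^-1 * F s w)) =
   fun w => (expR (Lam + 1))^-1 * (frozen ss w * b w * F s w).
  by apply/funext => w; rewrite expRD invfM; ring.
rewrite !ExZ // => H.
have {}H := H _ _ _ _ _.
have : (expR (Lam + 1))^-1 * Ex P (fun w => frozen ss w * b w * F s w) <=
  (expR Lam)^-1 * Ex P (fun w => frozen ss w * b w) * ((expR 1)^-1 * Ex P (F s)) + alpha.
  apply: H => [A B sA sB|||w|w].
  - apply: mixing_ineq mix _ sA sB => t t' /= /ds + ->.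
    by rewrite /dist_oo; under eq_bigr => i _ do rewrite distnC.
  - by apply: measurable_funM; [exact: measurable_cst|apply: measurable_funM => //; exact: frozen_smeas].
  - by apply: measurable_funM; [exact: measurable_cst|exact: F_smeas].
  - have /andP[z0 _] := frozen_bounds ss w; rewrite /b ler_pdivrMl // mulr1.
    have [hz|_] := boolP (frozen ss w <= expR Lam); rewrite ?mulr1 ?mulr0 ?lexx ?hz ?(ltW eL) ?andbT //.
    by rewrite mulr_ge0 ?invr_ge0 ?ltW.
  - rewrite ler_pdivrMl // mulr1 F_le andbT.
    by rewrite mulr_ge0 ?invr_ge0 ?ltW.
rewrite ler_pdivrMl ?expR_gt0 // mulrDr => /le_trans; apply; rewrite lerD2r.
rewrite expRD (_ : expR Lam * expR 1 * _ = Ex P (fun w => frozen ss w * b w) * Ex P (F s)); last first.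
  by field; rewrite !gt_eqF.
rewrite ler_piMr ?Ex_factor_le1 //; apply: Ex_ge0 => w.
by have /andP[z0 _] := frozen_bounds ss w; rewrite mulr_ge0 // ltW.
Qed.

Lemma frozen_active ss w : frozen ss w <= expR Lam ->
  frozen ss w = expR (lam * (\sum_(s <- ss) h s (Z s w)) - 2 * lam ^+ 2 * (size ss)%:R).
Proof.
elim: ss => [|s ss IH] /=; first by rewrite big_nil !mulr0 subrr expR0.
case: ifP => [zL _|zL]; last by rewrite zL.
rewrite IH // -expRD; congr expR; rewrite big_cons -natr1; ring.
Qed.

(** Were the process still active, [frozen_active] would contradict the size of the sum; so it has
    exceeded [expR Lam], and Markov's inequality concludes. *)
Lemma deviation_pairwise ss : pairwise (fun s t => a <= dist_oo s t)%N ss ->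
  (P [set w | (Lam / lam + 2 * lam * (size ss)%:R < \sum_(s <- ss) h s (Z s w))%R] <=
   (expR (- Lam) + (size ss)%:R * (expR 1 * alpha))%:E)%E.
Proof.
move=> ds; have bz := frozen_bmeas ss.
have mset : measurable [set w | expR Lam < frozen ss w].
  rewrite (_ : [set _ | _] = ~` [set w | frozen ss w <= expR Lam]); last first.
    by apply/seteqP; split => w /=; rewrite ltNge => /negP.
  by apply: measurableC; apply: measurable_set_le; case: bz.
have msum : measurable [set w | Lam / lam + 2 * lam * (size ss)%:R < \sum_(s <- ss) h s (Z s w)].
  rewrite (_ : [set _ | _] = ~` [set w | \sum_(s <- ss) h s (Z s w) <= Lam / lam + 2 * lam * (size ss)%:R]); last first.
    by apply/seteqP; split => w /=; rewrite ltNge => /negP.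
  apply: measurableC; apply: measurable_set_le.
  by have [] := @bmeas_sum _ _ Omega _ ss xpredT (fun s w => h s (Z s w)) hZ_bmeas.
apply: (@le_trans _ _ (P [set w | (expR Lam < frozen ss w)%R])).
  apply: le_measure; rewrite ?inE // => w /= hw; rewrite ltNge; apply/negP => /[dup] /frozen_active ->.
  rewrite ler_expR; move: hw; rewrite -(ltr_pM2l lam0) mulrDr mulrCA divff ?gt_eqF // mulr1.
  by rewrite expr2; lra.
have bb : bmeas (fun w => (expR Lam < frozen ss w)%R%:R : R) by exact: bmeas_bool.
rewrite -(fineK (fin_num_measure P _ mset)) lee_fin -Ex_bool //.
rewrite -(ler_pM2l (expR_gt0 Lam)) -ExZ //.
apply: (@le_trans _ _ (Ex P (frozen ss))).
  apply: Ex_le => // [|w]; first exact: bmeasZ.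
  have /andP[z0 _] := frozen_bounds ss w.
  by case: ltP => [hw|_]; rewrite ?mulr1 ?mulr0 ltW.
apply: le_trans (frozen_Ex ds) _.
rewrite (_ : expR Lam * _ = 1 + (size ss)%:R * (expR (Lam + 1) * alpha)) //.
by rewrite mulrDr -expRD subrr expR0 expRD; ring.
Qed.

End Frozen.
End Fields.

Lemma uniq_pairwiseW (T : eqType) (r : rel T) (ss : seq T) : uniq ss ->
  {in ss &, forall s t, s != t -> r s t} -> pairwise r ss.
Proof.
elim: ss => //= s ss IH /andP[sn us] H; apply/andP; split.
  apply/allP => t tss; apply: H; rewrite ?inE ?eqxx ?tss ?orbT //.
  by apply: contraNneq sn => ->.
by apply: IH => // x y xs ys; apply: H; rewrite inE ?xs ?ys orbT.
Qed.

Section Classes.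
Variables (N a : nat).
Hypothesis a0 : (0 < a)%N.

(** ['I_a.-1.+1] is ['I_a] in a form that is inhabited by construction, as [inord] requires. *)
Definition residue (s : lattice N) : {ffun 'I_N -> 'I_a.-1.+1} :=
  [ffun i => inord `|(s i %% a)%Z|%N].

Lemma residue_dist (s t : lattice N) : residue s = residue t -> s != t ->
  (a <= dist_oo s t)%N.
Proof.
move=> est; have a0z : (a%:Z != 0) by rewrite -lt0n.
move=> nst; have [i nsti] : exists i, s i != t i.
  apply/existsP; apply: contraNT nst => /existsPn H.
  by apply/eqP/ffunP => i; apply/eqP/negPn.
apply: (@leq_trans `|s i - t i|%N); last exact: (@leq_bigmax _ (fun i => `|s i - t i|%N)).
have md (x : int) : (`|(x %% a)%Z| < a.-1.+1)%N.
  rewrite prednK // -ltz_nat gez0_abs ?modz_ge0 //.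
  by have := ltz_pmod x (_ : 0 < a%:Z); apply.
have : (s i == t i %[mod a])%Z.
  have /ffunP/(_ i) := est; rewrite !ffunE => /(congr1 val) /=.
  rewrite !inordK ?md // => /(congr1 Posz).
  by rewrite !gez0_abs ?modz_ge0 // => /eqP.
rewrite eqz_mod_dvd dvdzE absz_nat => /dvdn_leq; apply.
by rewrite absz_gt0 subr_eq0.
Qed.

Lemma card_residue : #|{: {ffun 'I_N -> 'I_a.-1.+1}}| = (a ^ N)%N.
Proof. by rewrite card_ffun !card_ord prednK. Qed.

End Classes.

Section Window.
Variables (R : realType) (N : nat) (disp d' : measure_display).
Variables (Omega : measurableType disp) (T : measurableType d') (P : probability Omega R).

Lemma prob_exists_le (I : finType) (A : I -> set Omega) (c : R) :
  (forall i, measurable (A i)) -> (forall i, (P (A i) <= c%:E)%E) ->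
  measurable [set w | exists i, A i w] /\
  (P [set w | exists i, A i w] <= (#|I|%:R * c)%:E)%E.
Proof.
move=> mA PA.
have e : [set w | exists i, A i w] = \big[setU/set0]_(i <- enum I) A i.
  rewrite -bigcup_seq; apply/seteqP; split => w.
    by move=> [i Ai]; exists i => //=; rewrite mem_enum.
  by move=> [i _ Ai]; exists i.
rewrite e cardE; elim: (enum I) => [|i s [mI IH]].
  by rewrite big_nil measure0 mul0r; split => //; exact: measurable0.
rewrite big_cons; split; first exact: measurableU.
apply: (le_trans (measureU2 _ _ _)) => //.
by rewrite /= -natr1 mulrDl mul1r addrC EFinD leeD.
Qed.

Variable Z : lattice N -> Omega -> T.
Hypothesis mZ : forall s, measurable_fun setT (Z s).
Variables (c0 c1 : R) (a : nat).
Hypotheses (c00 : 0 <= c0) (mix : strong_mixing P Z c0 c1) (a0 : (0 < a)%N).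
Variables (h : T -> R) (lam Lam : R).
Hypotheses (mh : measurable_fun setT h) (h1 : forall t, `|h t| <= 1).
Hypothesis (hE : forall s, Ex P (fun w => h (Z s w)) <= 0).
Hypotheses (lam0 : 0 < lam) (lam1 : lam <= 1) (Lam0 : 0 <= Lam).

(** The threshold is the sum of the thresholds of the [a ^ N] residue classes, so some class exceeds
    its own; distinct sites of one class are at least [a] apart. *)
Lemma deviation_window (ss : seq (lattice N)) : uniq ss ->
  (P [set w | (a ^ N)%:R * (Lam / lam) + 2 * lam * (size ss)%:R < \sum_(s <- ss) h (Z s w)]%R <=
   ((a ^ N)%:R * (expR (- Lam) + (size ss)%:R * (expR 1 * (c0 * expR (- (c1 * a%:R))))))%:E)%E.
Proof.
move=> us; pose cls (r : {ffun 'I_N -> 'I_a.-1.+1}) := [seq s <- ss | residue a s == r].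
pose A r := [set w | Lam / lam + 2 * lam * (size (cls r))%:R < \sum_(s <- cls r) h (Z s w)].
have mhZ s : bmeas (fun w => h (Z s w)).
  by split; [apply: measurableT_comp; [exact: mh|exact: mZ]|exists 1].
have msum (l : seq (lattice N)) c : measurable [set w | c < \sum_(s <- l) h (Z s w)].
  rewrite (_ : [set _ | _] = ~` [set w | \sum_(s <- l) h (Z s w) <= c]); last first.
    by apply/seteqP; split => w /=; rewrite ltNge => /negP.
  apply: measurableC; apply: measurable_set_le.
  by have [] := @bmeas_sum _ _ Omega _ l xpredT (fun s w => h (Z s w)) mhZ.
have PA r : (P (A r) <= (expR (- Lam) + (size ss)%:R * (expR 1 * (c0 * expR (- (c1 * a%:R)))))%:E)%E.
  have pw : pairwise (fun s t => a <= dist_oo s t)%N (cls r).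
    apply: uniq_pairwiseW; first exact: filter_uniq.
    move=> s t; rewrite !mem_filter => /andP[/eqP es _] /andP[/eqP et _].
    by apply: residue_dist => //; rewrite es et.
  have := deviation_pairwise mZ mix (fun _ => mh) (fun _ => h1) hE lam0 lam1 Lam0 pw.
  move=> /le_trans; apply; rewrite lee_fin lerD2l ler_wpM2r //.
    by rewrite !mulr_ge0 ?expR_ge0.
  by rewrite ler_nat size_filter count_size.
have [mE PE] := prob_exists_le (fun r => msum _ _) PA.
rewrite card_residue // in PE; apply: le_trans PE; apply: le_measure; rewrite ?inE //.
move=> w /= hw; apply: contrapT => /forallNP H; move: hw; apply/negP; rewrite -leNgt.
rewrite (partition_big (residue a) xpredT) //=.
have -> : (size ss)%:R = \sum_r (size (cls r))%:R :> R.
  rewrite -natr_sum -sum1_size; congr (_%:R).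
  rewrite (partition_big (residue a) xpredT) //=; apply: eq_bigr => r _.
  by rewrite -big_filter sum1_size.
have -> : (a ^ N)%:R * (Lam / lam) = \sum_(r : {ffun 'I_N -> 'I_a.-1.+1}) (Lam / lam).
  by rewrite sumr_const card_residue // mulr_natl.
rewrite mulr_sumr -big_split /= ler_sum // => r _.
by have /negP := H r; rewrite -leNgt /cls big_filter.
Qed.

End Window.

(** * Brackets for truncated linear combinations *)

Section Discretize.
Variables (R : realType) (d : measure_display) (T : measurableType d).
Variables (mu : probability T R) (K : nat) (g : 'I_K -> T -> R).
Hypothesis mg : forall i, measurable_fun setT (g i).

Lemma tight_bound (eta : R) : 0 < eta -> exists r : nat,
  (mu (~` [set x | (\sum_i `|g i x| <= r%:R)%R]) <= eta%:E)%E.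
Proof.
move=> eta0; pose H x := \sum_i `|g i x|; pose A (r : nat) := [set x | H x <= r%:R].
have mH : measurable_fun setT H.
  by apply: measurable_sum => i; apply: measurableT_comp => //; exact: mg.
have mA r : measurable (A r) by exact: measurable_set_le.
have UA : \bigcup_r A r = setT.
  apply/seteqP; split => // x _; exists (Num.truncn (H x)).+1 => //=.
  exact/ltW/truncnS_gt.
have ndA : {homo A : n m / (n <= m)%N >-> (n <= m)%O}.
  move=> i j ij; apply/subsetPset => x /= h; apply: le_trans h _.
  by rewrite ler_nat.
have cA : (mu \o A) x @[x --> \oo] --> mu (\bigcup_r A r).
  by apply: nondecreasing_cvg_mu => //; rewrite UA; exact: measurableT.
apply: contrapT => /forallNP no.
have /(lime_le (cvgP _ cA)) : \forall n \near \oo, ((mu \o A) n <= (1 - eta)%:E)%E.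
  near=> r => /=; have /negP := no r; rewrite -ltNge -/(A r).
  have := probability_setC mu (mA r) => ->.
  rewrite -(fineK (fin_num_measure mu _ (mA r))) -EFinB lte_fin lee_fin; lra.
rewrite (cvg_lim _ cA) // UA (_ : mu setT = 1%E); last exact: probability_setT.
rewrite lee_fin; lra.
Unshelve. all: by end_near. Qed.

(** The number of cells depends on [mu] and [g] without control, but the size of a cutting does not
    depend on it. The value [None] collects the tail where the functions [g i] are large. *)
Lemma discretize (delta eta : R) : 0 < delta -> 0 < eta ->
  exists (D : nat) (idx : T -> option {ffun 'I_K -> 'I_D.+1})
         (gt : {ffun 'I_K -> 'I_D.+1} -> 'I_K -> R),
    [/\ forall o, measurable [set x | idx x = o],
        forall x w i, idx x = Some w -> `|g i x - gt w i| <= delta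
      & (mu [set x | idx x = None] <= eta%:E)%E].
Proof.
move=> delta0 /tight_bound[r hr].
pose H x := \sum_i `|g i x|.
have mH : measurable_fun setT H.
  by apply: measurable_sum => i; apply: measurableT_comp => //; exact: mg.
pose y i x := (g i x + r%:R) / delta.
have my i : measurable_fun setT (y i).
  by apply: measurable_funM => //; apply: measurable_funD.
pose D := Num.truncn ((2 * r%:R) / delta).
pose idx x : option {ffun 'I_K -> 'I_D.+1} :=
  if H x <= r%:R then Some [ffun i => inord (Num.truncn (y i x))] else None.
have yb i x : H x <= r%:R -> 0 <= y i x <= (2 * r%:R) / delta.
  move=> Hr; have gr : `|g i x| <= r%:R.
    by apply: le_trans Hr; rewrite /H (bigD1 i) //= lerDl sumr_ge0.
  move: gr; rewrite ler_norml => /andP[h1 h2].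
  rewrite /y divr_ge0 ?(ltW delta0) //=; last by lra.
  by rewrite ler_pM2r ?invr_gt0 //; lra.
have yD i x : H x <= r%:R -> (Num.truncn (y i x) < D.+1)%N.
  by move=> /(yb i) /andP[_ h]; rewrite ltnS /D le_truncn.
exists D, idx, (fun (w : {ffun 'I_K -> 'I_D.+1}) i => (w i)%:R * delta - r%:R); split.
- have mN : measurable [set x | idx x = None].
    rewrite (_ : [set _ | _] = ~` [set x | H x <= r%:R]).
      by apply: measurableC; exact: measurable_set_le.
    by apply/seteqP; split => x /=; rewrite /idx; case: ifP.
  case=> [w|//].
  rewrite (_ : [set _ | _] = [set x | H x <= r%:R] `&`
     \bigcap_(i in [set: 'I_K]) [set x | (w i)%:R <= y i x < (w i).+1%:R]).
    apply: measurableI; first exact: measurable_set_le.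
    apply: fin_bigcap_measurable => // i _.
    have := my i measurableT _ (measurable_itv `[(w i)%:R, (w i).+1%:R[).
    rewrite setTI (_ : _ @^-1` _ = [set x | (w i)%:R <= y i x < (w i).+1%:R]) //.
  apply/seteqP; split => x /=.
    rewrite /idx; case: ifP => // Hr [<-]; split => // i _ /=.
    rewrite ffunE inordK ?yD //; apply: truncn_itv.
    by have /andP[] := yb i x Hr.
  move=> [Hr Hi]; rewrite /idx Hr; congr Some; apply/ffunP => i; rewrite ffunE.
  apply: val_inj; rewrite /= inordK ?yD //; apply: truncn_def; exact: (Hi i).
- move=> x w i; rewrite /idx; case: ifP => // Hr [<-].
  rewrite ffunE inordK ?yD //; have /andP[y0 _] := yb i x Hr.
  have /andP[t1 t2] := truncn_itv y0.
  have gy : g i x = y i x * delta - r%:R by rewrite /y divfK ?gt_eqF // addrK.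
  rewrite [X in `|X - _|]gy opprB addrA subrK -mulrBl normrM (gtr0_norm delta0).
  rewrite ger0_norm ?subr_ge0 // -[leRHS]mul1r ler_pM2r //.
  by rewrite lerBlDl natr1 ltW.
- apply: le_trans hr; rewrite (_ : [set _ | _] = ~` [set x | H x <= r%:R]) //.
  by apply/seteqP; split => x /=; rewrite /idx; case: ifP.
Qed.

End Discretize.

Section Trunc.
Variable R : realType.
Implicit Types b y z : R.

Lemma trunc_bounds b y : 0 <= b -> - b <= trunc b y <= b.
Proof.
move=> b0; rewrite /trunc le_max lexx orbT /= ge_max ge_min lexx orbT /=; lra.
Qed.

Lemma trunc_norm b y : 0 <= b -> `|trunc b y| <= b.
Proof. by move=> b0; rewrite ler_norml trunc_bounds. Qed.

Lemma trunc_lip b y z : `|trunc b y - trunc b z| <= `|y - z|.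
Proof.
have h1 := ler_norm (y - z); have := ler_norm (z - y); rewrite distrC => h2.
by rewrite /trunc /Num.max /Num.min; case: (ltP y b) => ?; case: (ltP z b) => ?;
  do 2?case: (ltP _ (- b)) => ?; rewrite ler_norml; apply/andP; split; lra.
Qed.

Lemma trunc_id b y : `|y| <= b -> trunc b y = y.
Proof.
by rewrite ler_norml => /andP[h1 h2]; rewrite /trunc min_l // max_l.
Qed.

Lemma trunc_ge b y z : - b < z -> z <= b -> (z <= trunc b y) = (z <= y).
Proof.
move=> h1 h2; rewrite /trunc le_max le_min h2 andbT.
by rewrite (leNgt z (- b)) h1 orbF.
Qed.

(** Levels lie in []-b, b]], where [trunc_ge] makes truncation invisible: a truncated value reaches
    a level exactly when the untruncated one does. *)
Definition level b (Th l : nat) : R := - b + 2 * b * l.+1%:R / Th%:R.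

(** This is [staircase_bounds] for the rescaled truncated value. Counting the levels reached turns a
    truncated combination into a number of linear inequalities in its coefficients. *)
Lemma trunc_levels b (Th : nat) y : 0 < b -> (0 < Th)%N ->
  - b + 2 * b / Th%:R * #|[pred l : 'I_Th | level b Th l <= y]|%:R <= trunc b y
    <= - b + 2 * b / Th%:R * (#|[pred l : 'I_Th | level b Th l <= y]|%:R + 1).
Proof.
move=> b0 Th0; have ThR : (0 : R) < Th%:R by rewrite ltr0n.
pose u := (trunc b y + b) / (2 * b).
have b2 : 0 < 2 * b by rewrite mulr_gt0.
have u01 : 0 <= u <= 1.
  have /andP[h1 h2] := @trunc_bounds b y (ltW b0).
  rewrite /u divr_ge0 ?(ltW b2) //=; last by lra.
  rewrite ler_pdivrMr //; lra.
(* The type [bool] is a dummy sample space for a constant function. *)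
have := @staircase_bounds R _ bool Th (fun=> u) true Th0 u01.
have -> : staircase Th (fun=> u) true = Th%:R^-1 * #|[pred l : 'I_Th | level b Th l <= y]|%:R.
  rewrite /staircase -sum1_card natr_sum [in RHS]big_mkcond /=; congr (_ * _).
  apply: eq_bigr => l _; rewrite inE -(@trunc_ge b) //; last 2 first.
  - by rewrite /level ltrDl !mulr_gt0 ?invr_gt0.
  - rewrite /level -mulrA; have : l.+1%:R / Th%:R <= 1 :> R.
      by rewrite ler_pdivrMr // mul1r ler_nat.
    by move=> h; have := ler_wpM2l (ltW b2) h; lra.
  rewrite /u ler_pdivlMr // (_ : (_ <= _ + _) = (level b Th l <= trunc b y)); first by case: ifP.
  by rewrite -lerBlDr /level; congr (_ <= _); ring.
have -> : trunc b y = - b + 2 * b * u by rewrite /u mulrCA divff ?mulr1 ?gt_eqF //; ring.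
move: u #|_|%:R u01 => u q _ /andP[h1 h2]; apply/andP; split.
  by have := ler_wpM2l (ltW b2) h1; rewrite mulrA; lra.
have := ler_wpM2l (ltW b2) h2; lra.
Qed.

End Trunc.

Section FiniteIndex.
Variables (R : realType) (d : measure_display) (T : measurableType d).
Variables (mu : probability T R) (I : finType) (idx : T -> I).
Hypothesis midx : forall o, measurable [set x | idx x = o].

Let sum_idx (F : I -> R) : (fun x => F (idx x)) =
  fun x => \sum_o F o * (idx x == o)%:R.
Proof.
apply/funext => x; rewrite (bigD1 (idx x)) //= eqxx mulr1 big1 ?addr0 // => o.
by rewrite eq_sym => /negbTE ->; rewrite mulr0.
Qed.

Let mEq o : measurable [set x | idx x == o].
Proof.
rewrite (_ : [set _ | _] = [set x | idx x = o]) //.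
by apply/seteqP; split => x /= /eqP.
Qed.

Lemma bmeas_idx (F : I -> R) : bmeas (fun x => F (idx x)).
Proof. by rewrite sum_idx; apply: bmeas_sum => o; apply: bmeasZ; apply: bmeas_bool. Qed.

Lemma Ex_idx (F : I -> R) :
  Ex mu (fun x => F (idx x)) = \sum_o fine (mu [set x | idx x = o]) * F o.
Proof.
rewrite sum_idx Ex_sum; last by move=> o; apply: bmeasZ; exact: bmeas_bool.
apply: eq_bigr => o _; rewrite ExZ; last exact: bmeas_bool.
rewrite Ex_bool // mulrC; congr (fine (mu _) * _).
by apply/seteqP; split => x /= /eqP.
Qed.

Lemma sum_idx_prob : \sum_o fine (mu [set x | idx x = o]) = 1.
Proof.
rewrite -[RHS](Ex_cst mu 1) (Ex_idx (fun=> 1)).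
by apply: eq_bigr => o _; rewrite mulr1.
Qed.

End FiniteIndex.

Lemma dot_row_mx (F : realFieldType) m n (a a' : 'rV[F]_m) (b b' : 'rV[F]_n) :
  dot (row_mx a b) (row_mx a' b') = dot a a' + dot b b'.
Proof.
rewrite /dot big_split_ord /=; congr (_ + _); apply: eq_bigr => i _.
  by rewrite !row_mxEl.
by rewrite !row_mxEr.
Qed.

Section Brackets.
Variables (R : realType) (d : measure_display) (T : measurableType d).
Variables (mu : probability T R) (K : nat) (g : 'I_K -> T -> R).
Hypothesis mg : forall i, measurable_fun setT (g i).
Variables (b rho : R) (Th Rn : nat) (e kap : R).
Hypotheses (b0 : 0 < b) (rho0 : 0 <= rho) (Th0 : (0 < Th)%N).
Hypotheses (e0 : 0 <= e) (e1 : e <= 1) (kap0 : 0 < kap).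
Hypothesis small :
  ((4 * (Rn + (K + 1)).+1 ^ (K + 1)) ^ (K + 1))%:R * (1 - e) ^+ (Rn - (K + 1) * (K + 1)) < 1.

(** With the coefficients extended by an entry [1], reaching level [l] on cell [f] is a sign
    condition on a scalar product with [w (Some f, l)]. Within a cone of the cutting this sign is
    settled for every uncrossed pair, so the truncated value is known up to the number of crossed
    levels. The mass of crossed pairs then bounds the integral of the width. *)
Lemma brackets : exists (t : nat) (th o : 'I_t -> T -> R),
  [/\ (t <= ((Rn + (K + 1)).+1 * (Rn + (K + 1))) ^ (K + 1))%N,
      forall q, bmeas (th q) /\ bmeas (o q),
      forall q x, `|th q x| <= b /\ 0 <= o q x <= 2 * b,
      forall q, Ex mu (o q) <= 2 * b * e + 4 * b / Th%:R + kap + 2 * b * kap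
    & forall c : 'I_K -> R, (forall i, `|c i| <= rho) -> exists q, forall x,
        `|trunc b (\sum_i c i * g i x) - th q x| <= o q x].
Proof.
have K1 : 0 < K%:R + 1 :> R by rewrite ltr_wpDl.
(* The mesh is such that [K] coefficients bounded by [rho] move a combination by at most [kap]. *)
have [D [idx [gt [midx hgt hN]]]] := @discretize _ _ _ mu K g mg
  (kap / ((K%:R + 1) * (rho + 1))) kap (divr_gt0 kap0 (mulr_gt0 K1 (ltr_wpDl rho0 ltr01))) kap0.
have ThR : (0 : R) < Th%:R by rewrite ltr0n.
pose cell := option {ffun 'I_K -> 'I_D.+1}.
pose W : finType := (cell * 'I_Th)%type.
pose mass (o : cell) := fine (mu [set x | idx x = o]).
have mass0 o : 0 <= mass o by exact: fine_ge0.
pose p (i : W) := mass i.1 / Th%:R.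
have p0 i : 0 <= p i by rewrite divr_ge0 // ltW.
have p1 : \sum_i p i = 1.
  rewrite -(pair_bigA _ (fun o l => mass o / Th%:R)) /= -[RHS](@sum_idx_prob _ _ _ mu _ idx midx).
  apply: eq_bigr => o _; rewrite sumr_const card_ord -[LHS]mulr_natr divfK //.
  by rewrite gt_eqF.
pose w (i : W) : 'rV[R]_(K + 1) :=
  if i.1 is Some f then row_mx (\row_j gt f j) (const_mx (- level b Th i.2)) else 0.
have m0 : (0 < Rn + (K + 1))%N by rewrite !addn1 addnS.
have [V [sV HV]] := @cutting R (K + 1) W p w Rn p0 p1 e m0 e0 e1 small.
pose vs (q : 'I_(size V)) := nth [::] V q.
pose Nq q (o : cell) := #|[pred l : 'I_Th | all (fun v => 0 <= dot v (w (o, l))) (vs q)]|.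
pose Cq q (o : cell) := #|[pred l : 'I_Th | crossed (vs q) (w (o, l))]|.
(* Only the cells that are crossed by few vectors are used. *)
pose good q := \sum_(i | crossed (vs q) (w i)) p i <= e.
pose th q (o : cell) : R := if o is Some _ then - b + 2 * b / Th%:R * (Nq q o)%:R else 0.
(* Of the two extra levels, one pays for the rounding in [trunc_levels], the other for a level equal
   to the value itself. Cones crossed too often get width [0], so that the integral bound holds for
   every [q]. *)
pose er q (o : cell) : R :=
  if good q then
    (if o is Some _ then Num.min (2 * b) (2 * b / Th%:R * ((Cq q o)%:R + 2) + kap) else 2 * b)
  else 0.
have b2 : 0 < 2 * b by rewrite mulr_gt0.
have bT : 0 < 2 * b / Th%:R by rewrite divr_gt0.
have NTh q o : 2 * b / Th%:R * (Nq q o)%:R <= 2 * b.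
  rewrite -mulrA ler_piMr ?(ltW b2) // mulrC ler_pdivrMr // mul1r ler_nat.
  by rewrite -[X in (_ <= X)%N]card_ord max_card.
have er0 q o : 0 <= er q o.
  rewrite /er; case: ifP => // _; case: o => [f|]; last exact: ltW.
  by rewrite le_min (ltW b2) addr_ge0 ?(ltW kap0) // mulr_ge0 ?(ltW bT) // addr_ge0.
exists (size V), (fun q x => th q (idx x)), (fun q x => er q (idx x)); split => //.
- by move=> q; split; exact: bmeas_idx.
- move=> q x; split.
    rewrite /th; case: (idx x) => [f|]; last by rewrite normr0 ltW.
    have := NTh q (Some f); have : 0 <= 2 * b / Th%:R * (Nq q (Some f))%:R.
      by rewrite mulr_ge0 // ltW.
    by rewrite ler_norml; move: (_ * _) => z *; apply/andP; split; lra.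
  rewrite er0 /= /er; case: ifP => // _; last exact: ltW.
  by case: (idx x) => [f|//]; rewrite ge_min lexx.
- move=> q; rewrite Ex_idx //.
  have [gq|gq] := boolP (good q); last first.
    rewrite big1 => [|o _]; last by rewrite /er (negbTE gq) mulr0.
    by rewrite !addr_ge0 ?mulr_ge0 ?invr_ge0 // ltW.
  have h o : mass o * er q o <= 2 * b * \sum_(l | crossed (vs q) (w (o, l))) p (o, l) +
      mass o * (4 * b / Th%:R + kap) + (o == None)%:R * (2 * b * kap).
    have s0 : 0 <= \sum_(l | crossed (vs q) (w (o, l))) p (o, l) by exact: sumr_ge0.
    rewrite /er gq; case: o s0 => [f|] s0.
      rewrite mul0r addr0 -[leRHS]/(2 * b * _ + _).
      apply: (@le_trans _ _ (mass (Some f) * (2 * b / Th%:R * ((Cq q (Some f))%:R + 2) + kap))).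
        by rewrite ler_wpM2l // ge_min lexx orbT.
      have -> : \sum_(l | crossed (vs q) (w (Some f, l))) p (Some f, l) =
          mass (Some f) / Th%:R * (Cq q (Some f))%:R.
        by rewrite /Cq -sum1_card natr_sum mulr_sumr; apply: eq_bigr => l _; rewrite mulr1.
      rewrite le_eqVlt; apply/orP; left; apply/eqP; field.
      by rewrite gt_eqF.
    have mN : mass None <= kap.
      by rewrite -lee_fin /mass fineK //; exact: fin_num_measure.
    rewrite eqxx mul1r.
    have := ler_wpM2l (ltW b2) mN; rewrite mulrC.
    have : 0 <= mass None * (4 * b / Th%:R + kap).
      by rewrite mulr_ge0 // addr_ge0 ?(ltW kap0) // divr_ge0 ?mulr_ge0 // ltW.
    have : 0 <= 2 * b * \sum_(l | crossed (vs q) (w (None, l))) p (None, l).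
      by rewrite mulr_ge0 // ltW.
    lra.
  apply: (le_trans (ler_sum _ (fun o _ => h o))).
  rewrite !big_split /= -mulr_sumr -mulr_suml (sum_idx_prob mu midx) mul1r.
  have -> : \sum_o (o == None :> cell)%:R * (2 * b * kap) = 2 * b * kap.
    rewrite (bigD1 None) //= mul1r big1 ?addr0 // => o /negbTE ->.
    by rewrite mul0r.
  have : 2 * b * \sum_o \sum_(l | crossed (vs q) (w (o, l))) p (o, l) <= 2 * b * e.
    rewrite ler_pM2l // pair_big_dep /=; apply: le_trans gq.
    by rewrite le_eqVlt; apply/orP; left; apply/eqP; apply: eq_big => -[u l].
  lra.
- move=> c hc.
  have [v [vV cone few]] := HV (row_mx (\row_j c j) (const_mx 1)).
  have iv : (index v V < size V)%N by rewrite index_mem.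
  exists (Ordinal iv) => x; set q := Ordinal iv.
  have vq : vs q = v by rewrite /vs /= nth_index.
  have gq : good q by rewrite /good vq.
  rewrite /er gq; case ix: (idx x) => [f|] /=; last first.
    by rewrite subr0 (le_trans (trunc_norm _ (ltW b0))) //; lra.
  rewrite le_min; apply/andP; split.
    have /andP[t1 t2] := @trunc_bounds _ b (\sum_i c i * g i x) (ltW b0).
    have := NTh q (Some f); have : 0 <= 2 * b / Th%:R * (Nq q (Some f))%:R.
      by rewrite mulr_ge0 // ltW.
    by rewrite ler_norml; move: (_ * _) => z *; apply/andP; split; lra.
  pose y := \sum_i c i * gt f i.
  have dy : `|\sum_i c i * g i x - y| <= kap.
    rewrite /y -sumrB; apply: (le_trans (ler_norm_sum _ _ _)).
    apply: (@le_trans _ _ (\sum_(i < K) rho * (kap / ((K%:R + 1) * (rho + 1))))).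
      apply: ler_sum => i _; rewrite -mulrBr normrM ler_pM //.
      exact: hgt ix.
    rewrite sumr_const card_ord -[X in X <= _]mulr_natr.
    rewrite mulrA mulrAC ler_pdivrMr ?mulr_gt0 // ?ltr_wpDl //.
    have k0 : 0 <= K%:R :> R by [].
    have : 0 <= kap * (K%:R + rho + 1) by rewrite mulr_ge0 ?(ltW kap0) // !addr_ge0.
    lra.
  have dotE l : dot (row_mx (\row_j c j) (const_mx 1)) (w (Some f, l)) = y - level b Th l.
    rewrite /w /= dot_row_mx /dot big_ord1 !mxE mul1r; congr (_ + _).
    by apply: eq_bigr => i _; rewrite !mxE.
  pose L := [pred l : 'I_Th | level b Th l <= y].
  have sub1 : (Nq q (Some f) <= #|L|)%N.
    apply: subset_leq_card; apply/fintype.subsetP => l; rewrite !inE vq => /(in_cone_ge0 cone).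
    by rewrite dotE subr_ge0.
  (* A reached level is reached on the whole cone, or crossed, or else nowhere exceeded on the cone
     and hence equal to [y], which happens for at most one level. *)
  have sub2 : (#|L| <= Nq q (Some f) + Cq q (Some f) + 1)%N.
    pose E := [pred l : 'I_Th | y == level b Th l].
    have cE : (#|E| <= 1)%N.
      apply/card_le1P => l; rewrite !inE => /eqP el l'; rewrite !inE.
      apply/idP/eqP => [/eqP|->]; last exact/eqP.
      rewrite el /level => /addrI /(mulIf (invr_neq0 (lt0r_neq0 ThR))) /(mulfI (lt0r_neq0 b2)).
      by move=> /eqP; rewrite eqr_nat => /eqP[] /val_inj.
    apply: (@leq_trans #|[predU [predU [pred l : 'I_Th | all (fun v => 0 <= dot v (w (Some f, l))) (vs q)]
        & [pred l : 'I_Th | crossed (vs q) (w (Some f, l))]] & E]|).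
      apply: subset_leq_card; apply/fintype.subsetP => l; rewrite !inE => ly.
      have [_|/crossedN[->//|]] := boolP (crossed (vs q) (w (Some f, l))); first by rewrite orbT.
      rewrite vq => /(in_cone_le0 cone); rewrite dotE subr_le0 => ly'.
      by rewrite eq_le ly ly' !orbT.
    have cU (A B : pred 'I_Th) : (#|[predU A & B]| <= #|A| + #|B|)%N.
      by rewrite -cardUI leq_addr.
    apply: (leq_trans (cU _ _)); apply: leq_add => //.
    exact: cU.
  have /andP[l1 l2] := trunc_levels y b0 Th0.
  have := trunc_lip b (\sum_i c i * g i x) y; move=> /le_trans/(_ dy).
  have n1 : (Nq q (Some f))%:R <= #|L|%:R :> R by rewrite ler_nat.
  have n2 : #|L|%:R <= (Nq q (Some f))%:R + (Cq q (Some f))%:R + 1 :> R.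
    by rewrite -natrD natr1 ler_nat -addn1.
  have m1 := ler_wpM2l (ltW bT) n1; have m2 := ler_wpM2l (ltW bT) n2.
  rewrite -/L in l1 l2.
  have c0 : 0 <= 2 * b / Th%:R * (Cq q (Some f))%:R by rewrite mulr_ge0 // ltW.
  rewrite !ler_norml => /andP[k1 k2].
  rewrite !mulrDr mulr1 in m2 l2 *; apply/andP; split; lra.
Qed.

End Brackets.

(** Put [X = 2 * M] and [n = K + 1 <= X]. There are at most [4 ^ n * X ^ (6 * n * n)] codes, crudely
    [expR (2 * n + 6 * n ^ 2 * X)], while the miss probability is at most
    [expR (- (Rn - n ^ 2) / M)]. The first exponent times [M] has degree [4] in [X], so [Rn = X ^ 5]
    wins. The exponent [48 * K] bounds [24 * (K + 1)], which comes from [X ^ 12 <= M ^ 24]. *)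
Lemma net_size (R : realType) (M K : nat) : (2 <= M)%N -> (0 < K)%N -> (K <= M)%N ->
  let Rn := ((2 * M) ^ 5)%N in
  ((4 * (Rn + (K + 1)).+1 ^ (K + 1)) ^ (K + 1))%:R *
    (1 - M%:R^-1 : R) ^+ (Rn - (K + 1) * (K + 1)) < 1 /\
  (((Rn + (K + 1)).+1 * (Rn + (K + 1))) ^ (K + 1) <= M ^ (48 * K))%N.
Proof.
move=> M2 K0 KM Rn; pose X := (2 * M)%N; pose n := (K + 1)%N.
have X4 : (4 <= X)%N by rewrite /X; lia.
have nX : (n <= X)%N by rewrite /n /X; lia.
have hR : ((Rn + n).+1 <= X ^ 6)%N.
  have -> : (X ^ 6 = X ^ 5 * X)%N by rewrite -expnSr.
  apply: (@leq_trans (X ^ 5 * 4)%N); last by rewrite leq_mul2l X4 orbT.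
  have -> : Rn = (X ^ 5)%N by [].
  have : (X <= X ^ 5)%N by rewrite -{1}(expn1 X) leq_exp2l //; apply: leq_trans X4.
  move: nX X4; move: (X ^ 5)%N => q; lia.
split; last first.
  apply: (@leq_trans ((X ^ 12) ^ n)%N).
    apply: leq_expl; have -> : (X ^ 12 = X ^ 6 * X ^ 6)%N by rewrite -expnD.
    by apply: leq_mul => //; exact: leq_trans (leqnSn _) hR.
  apply: (@leq_trans (((M ^ 2) ^ 12) ^ n)%N).
    by apply: leq_expl; apply: leq_expl; rewrite /X -mulnn leq_mul2r M2 orbT.
  rewrite -!expnM leq_exp2l //; rewrite /n; lia.
have M0 : (0 : R) < M%:R by rewrite ltr0n (leq_trans _ M2).
have e2 : 2 <= expR 1 :> R by have := expR_ge1Dx (1 : R).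
have Xe : X%:R <= expR X%:R :> R.
  by apply: le_trans (expR_ge1Dx _); rewrite lerDr.
have h1 : ((4 * (Rn + n).+1 ^ n) ^ n)%:R <= expR (n%:R * 2 + (6 * n * n)%:R * X%:R) :> R.
  rewrite expRD !expRM_natl; apply: (@le_trans _ _ ((4 * (X ^ 6) ^ n) ^ n)%:R).
    rewrite ler_nat; apply: leq_expl; rewrite leq_mul2l /=; exact: leq_expl.
  have -> : ((4 * (X ^ 6) ^ n) ^ n = 4 ^ n * X ^ (6 * n * n))%N by rewrite expnMn -!expnM mulnA.
  rewrite natrM !natrX.
  apply: ler_pM; rewrite ?exprn_ge0 //; last by apply: lerXn2r; rewrite ?nnegrE ?expR_ge0.
  apply: lerXn2r; rewrite ?nnegrE ?expR_ge0 //.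
  have -> : (2 : R) = 1 + 1 by [].
  by rewrite expRD; nra.
have h2 : (1 - M%:R^-1) ^+ (Rn - n * n) <= expR (- ((Rn - n * n)%:R / M%:R)) :> R.
  rewrite -mulrN expRM_natl; apply: lerXn2r; rewrite ?nnegrE ?expR_ge0 //.
    by rewrite subr_ge0 invf_le1 // ler1n (leq_trans _ M2).
  exact: expR_ge1Dx.
apply: (@le_lt_trans _ _ (expR (n%:R * 2 + (6 * n * n)%:R * X%:R) * expR (- ((Rn - n * n)%:R / M%:R)))).
  apply: ler_pM => //.
  by rewrite exprn_ge0 // subr_ge0 invf_le1 // ler1n (leq_trans _ M2).
rewrite -expRD -[ltRHS]expR0 ltr_expR subr_lt0 ltr_pdivlMr //.
rewrite -(natrM _ n 2) -(natrM _ (6 * n * n) X) -natrD -natrM ltr_nat ltn_subRL.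
have -> : Rn = (X ^ 5)%N by [].
apply: (@leq_ltn_trans (X * X + (X * 2 + (6 * X * X) * X) * M)%N).
  apply: leq_add; first exact: leq_mul.
  rewrite leq_mul2r; apply/orP; right; apply: leq_add; first by rewrite leq_mul2r nX.
  by rewrite leq_mul2r; apply/orP; right; apply: leq_mul => //; rewrite leq_mul2l nX orbT.
have -> : (X ^ 5 = X * X * X * X * X)%N by rewrite !expnS expn0 muln1 !mulnA.
rewrite -(ltn_pmul2l (_ : 0 < 2)%N) //.
have eX : X = (2 * M)%N by [].
have -> : (2 * (X * X + (X * 2 + (6 * X * X) * X) * M) =
  2 * X * X + 2 * X * X + 6 * X * X * X * X)%N by rewrite eX; ring.
have h3 : (4 * (X * X * X * X) <= X * X * X * X * X)%N by rewrite mulnC leq_mul2l X4 orbT.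
have h4 : (4 * (X * X) <= X * X * X)%N by rewrite mulnC leq_mul2l X4 orbT.
have h5 : (4 * (X * X * X) <= X * X * X * X)%N by rewrite mulnC leq_mul2l X4 orbT.
have h6 : (16 <= X * X)%N by apply: (leq_mul X4 X4).
move: h3 h4 h5 h6; rewrite -!mulnA; move: (X * (X * (X * (X * X))))%N (X * (X * (X * X)))%N (X * (X * X))%N (X * X)%N => p q r s; lia.
Qed.

Section BracketsM.
Variables (R : realType) (d : measure_display) (T : measurableType d).
Variables (mu : probability T R) (K M : nat) (g : 'I_K -> T -> R).
Hypothesis mg : forall i, measurable_fun setT (g i).
Hypotheses (M2 : (2 <= M)%N) (K0 : (0 < K)%N) (KM : (K <= M)%N).

(** The number of levels is [M], the crossed fraction and the tolerance are [1 / M], so all four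
    error terms have order [1 / M]. The cardinality is free of [rho], which later allows unbounded
    coefficients. *)
Lemma brackets_card (b rho : R) : 0 < b -> 0 <= rho ->
  exists (t : nat) (th o : 'I_t -> T -> R),
  [/\ (t <= M ^ (48 * K))%N,
      forall q, bmeas (th q) /\ bmeas (o q),
      forall q x, `|th q x| <= b /\ 0 <= o q x <= 2 * b,
      forall q, Ex mu (o q) <= (8 * b + 1) / M%:R
    & forall c : 'I_K -> R, (forall i, `|c i| <= rho) -> exists q, forall x,
        `|trunc b (\sum_i c i * g i x) - th q x| <= o q x].
Proof.
move=> b0 rho0; have M0 : (0 < M)%N := leq_trans (isT : 0 < 2)%N M2.
have MR : (0 : R) < M%:R by rewrite ltr0n.
have V0 : 0 < M%:R^-1 :> R by rewrite invr_gt0.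
have V1 : M%:R^-1 <= 1 :> R by rewrite invf_le1 // ler1n.
have [small sT] := @net_size R M K M2 K0 KM.
have [t [th [er [h1 h2 h3 h4 h5]]]] := @brackets R d T mu K g mg b rho M ((2 * M) ^ 5)%N
  M%:R^-1 M%:R^-1 b0 rho0 M0 (ltW V0) V1 V0 small.
exists t, th, er; split => //; first exact: leq_trans h1 sT.
by move=> q; apply: (le_trans (h4 q)); rewrite le_eqVlt; apply/orP; left; apply/eqP; ring.
Qed.

End BracketsM.

(** * Uniform deviations *)

Section UniformDeviation.
Variables (R : realType) (N : nat) (disp d : measure_display).
Variables (Omega : measurableType disp) (T : measurableType d) (P : probability Omega R).
Variables (X : lattice N -> {RV P >-> T}) (Y : lattice N -> {RV P >-> R}).
Variable mu : probability T R.
Hypothesis law : forall s A, measurable A -> distribution P (X s) A = mu A.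

Lemma bmeas_RV (f : T -> R) s : bmeas f -> bmeas (fun w => f (X s w)).
Proof.
move=> [mf [c fc]]; split; last by exists c => w; exact: fc.
by apply: measurableT_comp => //; exact: measurable_funPT.
Qed.

Lemma Ex_law (f : T -> R) s : bmeas f -> Ex P (fun w => f (X s w)) = Ex mu f.
Proof.
move=> bf; rewrite /Ex /Rintegral; congr fine.
rewrite [RHS](eq_measure_integral (distribution P (X s))) => [|A mA _]; last exact/esym/law.
rewrite integral_distribution //.
  by case: bf => mf _; exact/measurable_EFinP.
exact: bmeas_int (bmeas_RV s bf).
Qed.

Let Z s w := (X s w, Y s w).

Let mZ s : measurable_fun setT (Z s).
Proof. by apply: measurable_fun_pair; exact: measurable_funPT. Qed.

Variables (c0 c1 : R) (a : nat).
Hypotheses (c00 : 0 <= c0) (mix : strong_mixing P Z c0 c1) (a0 : (0 < a)%N).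
Variables (K M : nat) (g : 'I_K -> T -> R).
Hypothesis mg : forall i, measurable_fun setT (g i).
Hypotheses (M2 : (2 <= M)%N) (K0 : (0 < K)%N) (KM : (K <= M)%N).
Variables (b lam Lam : R) (mb : T -> R).
Hypotheses (b0 : 0 < b) (lam0 : 0 < lam) (lam1 : lam <= 1) (Lam0 : 0 <= Lam).
Hypotheses (mmb : measurable_fun setT mb) (mbb : forall x, `|mb x| <= b).
Variable ss : seq (lattice N).
Hypotheses (uss : uniq ss) (sM : size ss = M).

Definition sqloss (c : 'I_K -> R) (x : T) : R :=
  (trunc b (\sum_i c i * g i x) - mb x) ^+ 2.

Definition bad_prob : R := (M ^ (48 * K))%:R * ((a ^ N)%:R *
  (expR (- Lam) + M%:R * (expR 1 * (c0 * expR (- (c1 * a%:R)))))).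

(** The first term is the fluctuation of one lower bracket of the loss, whose range has length
    [12 * b ^+ 2]; the second accounts for the [L^1] size of the brackets. *)
Definition dev : R := 12 * b ^+ 2 * ((a ^ N)%:R * (Lam / lam) / M%:R + 2 * lam) +
  8 * b * ((8 * b + 1) / M%:R).

Lemma measurable_trunc (f : T -> R) : measurable_fun setT f ->
  measurable_fun setT (fun x => trunc b (f x)).
Proof.
move=> mf; apply: measurable_maxr; last exact: measurable_cst.
by apply: measurable_minr => //; exact: measurable_cst.
Qed.

Lemma sqloss_bmeas c : bmeas (sqloss c).
Proof.
split; last first.
  exists (4 * b ^+ 2) => x; rewrite ger0_norm ?sqr_ge0 //.
  rewrite (_ : 4 * b ^+ 2 = (2 * b) ^+ 2); last by ring.
  rewrite -[leLHS]real_normK ?num_real // lerXn2r ?nnegrE ?mulr_ge0 ?(ltW b0) //.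
  apply: (le_trans (ler_normB _ _)); have := trunc_norm (\sum_i c i * g i x) (ltW b0).
  by have := mbb x; lra.
apply: measurable_funX; apply: measurable_funB => //; apply: measurable_trunc.
by apply: measurable_sum => i; apply: measurable_funM => //; exact: measurable_cst.
Qed.

Lemma MR_gt0 : (0 : R) < M%:R.
Proof. by rewrite ltr0n (leq_trans _ M2). Qed.

Lemma uniform_bounded (rho : R) : 0 <= rho -> exists Bad : set Omega,
  [/\ measurable Bad, (P Bad <= bad_prob%:E)%E
    & forall w, ~ Bad w -> forall c : 'I_K -> R, (forall i, `|c i| <= rho) ->
      Ex mu (sqloss c) <= M%:R^-1 * (\sum_(s <- ss) sqloss c (X s w)) + dev].
Proof.
move=> rho0; have MR := MR_gt0.
have [t [th [er [tM bth hb Eer hc]]]] := @brackets_card R d T mu K M g mg M2 K0 KM b rho b0 rho0.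
have b20 : 0 < b ^+ 2 by rewrite exprn_gt0.
have bmb : bmeas mb by split => //; exists b.
(* Lower bracket of the loss: for values in [[-b, b]] the squared distance to [mb] changes by at
   most [4 * b] times the displacement, so the loss lies between [l q] and [l q + 8 * b * er q]. *)
pose l q x := (th q x - mb x) ^+ 2 - 4 * b * er q x.
have bl q : bmeas (l q).
  have [b1 b2] := bth q; apply: bmeasB; last exact: bmeasZ.
  by apply: (@bmeasM _ _ _ (fun x => th q x - mb x) (fun x => th q x - mb x)); exact: bmeasB.
have lb q x : - (8 * b ^+ 2) <= l q x <= 4 * b ^+ 2.
  have [t1 /andP[r1 r2]] := hb q x; have t2 := mbb x.
  move: t1 t2; rewrite !ler_norml /l => /andP[u1 u2] /andP[v1 v2].
  have h1 : 0 <= (th q x - mb x) ^+ 2 by exact: sqr_ge0.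
  have h2 : (th q x - mb x) ^+ 2 <= 4 * b ^+ 2 by move: b0; nra.
  have h3 : 0 <= b * er q x by rewrite mulr_ge0 // ltW.
  have h4 : b * er q x <= 2 * b ^+ 2 by move: b0; nra.
  apply/andP; split; lra.
have Elb q : - (8 * b ^+ 2) <= Ex mu (l q) <= 4 * b ^+ 2.
  apply/andP; split; [rewrite -[leLHS](Ex_cst mu)|rewrite -[leRHS](Ex_cst mu)];
    apply: Ex_le => //; try exact: bmeas_cst; by move=> x; have /andP[] := lb q x.
pose h q x := (12 * b ^+ 2)^-1 * (Ex mu (l q) - l q x).
have b12 : 0 < 12 * b ^+ 2 by rewrite mulr_gt0.
have bh q : bmeas (h q) by apply: bmeasZ; apply: bmeasB => //; exact: bmeas_cst.
have h1 q x : `|h q x| <= 1.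
  rewrite /h normrM gtr0_norm ?invr_gt0 // ler_pdivrMl // mulr1.
  have /andP[? ?] := lb q x; have /andP[? ?] := Elb q.
  by rewrite ler_norml; apply/andP; split; lra.
have Eh q s : Ex P (fun w => h q (Z s w).1) <= 0.
  rewrite (@Ex_law (h q)) // ExZ; last by apply: bmeasB => //; exact: bmeas_cst.
  by rewrite ExB ?Ex_cst ?subrr ?mulr0 //; exact: bmeas_cst.
have mh q : measurable_fun setT (fun z : T * R => h q z.1).
  by apply: (measurableT_comp (proj1 (bh q))); exact: measurable_fst.
pose A q := [set w | (a ^ N)%:R * (Lam / lam) + 2 * lam * (size ss)%:R <
  \sum_(s <- ss) h q (Z s w).1].
have mA q : measurable (A q).
  rewrite (_ : A q = ~` [set w | \sum_(s <- ss) h q (Z s w).1 <= (a ^ N)%:R * (Lam / lam) + 2 * lam * (size ss)%:R]).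
    apply: measurableC; apply: measurable_set_le.
    by have [] := @bmeas_sum _ _ Omega _ ss xpredT (fun s w => h q (Z s w).1) (fun s => bmeas_RV s (bh q)).
  by apply/seteqP; split => w /=; rewrite /A /= ltNge => /negP.
have PA q : (P (A q) <= ((a ^ N)%:R * (expR (- Lam) + M%:R *
    (expR 1 * (c0 * expR (- (c1 * a%:R))))))%:E)%E.
  rewrite -sM; exact: (@deviation_window R N disp _ Omega _ P Z mZ c0 c1 a c00 mix a0
    (fun z => h q z.1) lam Lam (mh q) (fun z => h1 q z.1) (Eh q) lam0 lam1 Lam0 ss uss).
have [mB PB] := prob_exists_le mA PA.
exists [set w | exists q, A q w]; split => //.
  apply: le_trans PB _; rewrite lee_fin /bad_prob card_ord ler_wpM2r ?ler_nat //.
  by rewrite !(mulr_ge0, addr_ge0) ?expR_ge0.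
move=> w /forallNP nB c cb.
have [q hq] := hc c cb.
have [bt1 bo1] := bth q.
have le_sq x : l q x <= sqloss c x <= l q x + 8 * b * er q x.
  have [t1 /andP[r1 r2]] := hb q x; have t2 := mbb x.
  have := trunc_norm (\sum_i c i * g i x) (ltW b0); have := hq x.
  rewrite /sqloss /l; move: t1 t2; rewrite !ler_norml.
  move: (trunc b _) (th q x) (mb x) (er q x) r1 r2 => u v m o r1 r2 /andP[? ?] /andP[? ?] /andP[? ?] /andP[? ?].
  have k1 : (u - v) * (u + v - 2 * m) <= 4 * b * o.
    have q1 : 0 <= (o - (u - v)) * (4 * b + (u + v - 2 * m)) by apply: mulr_ge0; lra.
    have q2 : 0 <= (o + (u - v)) * (4 * b - (u + v - 2 * m)) by apply: mulr_ge0; lra.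
    lra.
  have k2 : - (4 * b * o) <= (u - v) * (u + v - 2 * m).
    have q1 : 0 <= (o - (u - v)) * (4 * b - (u + v - 2 * m)) by apply: mulr_ge0; lra.
    have q2 : 0 <= (o + (u - v)) * (4 * b + (u + v - 2 * m)) by apply: mulr_ge0; lra.
    lra.
  have e1 : (u - m) ^+ 2 = (v - m) ^+ 2 + (u - v) * (u + v - 2 * m) by ring.
  rewrite e1; apply/andP; split; lra.
have E1 : Ex mu (sqloss c) <= Ex mu (l q) + 8 * b * ((8 * b + 1) / M%:R).
  apply: (@le_trans _ _ (Ex mu (fun x => l q x + 8 * b * er q x))).
    apply: Ex_le; [exact: sqloss_bmeas|by apply: bmeasD => //; exact: bmeasZ|].
    by move=> x; have /andP[] := le_sq x.
  rewrite ExD //; last exact: bmeasZ.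
  by rewrite ExZ // lerD2l ler_pM2l ?mulr_gt0.
have S1 : Ex mu (l q) - M%:R^-1 * (\sum_(s <- ss) l q (X s w)) <=
    12 * b ^+ 2 * ((a ^ N)%:R * (Lam / lam) / M%:R + 2 * lam).
  have /negP := nB q; rewrite -leNgt sM.
  rewrite -[\sum_(_ <- _) h q _]mulr_sumr sumrB big_const_seq count_predT iter_addr_0 sM -[_ *+ M]mulr_natr.
  rewrite ler_pdivrMl // => HS; rewrite -(ler_pM2r MR).
  apply: le_trans (le_trans _ HS) _.
    by rewrite mulrBl mulrAC mulVf ?gt_eqF // mul1r.
  by rewrite le_eqVlt; apply/orP; left; apply/eqP; field; rewrite !gt_eqF.
have S2 : M%:R^-1 * (\sum_(s <- ss) l q (X s w)) <= M%:R^-1 * (\sum_(s <- ss) sqloss c (X s w)).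
  rewrite ler_pM2l ?invr_gt0 //; apply: ler_sum => s _.
  by have /andP[] := le_sq (X s w).
rewrite /dev; lra.
Qed.

(** The exceptional set is the limit inferior of those for the boxes of radius [n], so its
    probability obeys the same bound. A point outside it avoids [B n] for arbitrarily large [n],
    hence for one whose box contains the given [c]. *)
Lemma uniform_deviation : exists Bad : set Omega,
  [/\ measurable Bad, (P Bad <= bad_prob%:E)%E
    & forall w, ~ Bad w -> forall c : 'I_K -> R,
      Ex mu (sqloss c) <= M%:R^-1 * (\sum_(s <- ss) sqloss c (X s w)) + dev].
Proof.
have /choice[B HB] : forall n : nat, exists Bad : set Omega,
  [/\ measurable Bad, (P Bad <= bad_prob%:E)%E
    & forall w, ~ Bad w -> forall c : 'I_K -> R, (forall i, `|c i| <= n%:R) ->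
      Ex mu (sqloss c) <= M%:R^-1 * (\sum_(s <- ss) sqloss c (X s w)) + dev].
  by move=> n; exact: uniform_bounded.
pose C k := \bigcap_(n in [set n | (k <= n)%N]) B n.
have mC k : measurable (C k).
  by apply: bigcap_measurable => [|n _]; [exists k => /=|have [] := HB n].
exists (\bigcup_k C k); split.
- exact: bigcup_measurable.
- have ndC : {homo C : n m / (n <= m)%N >-> (n <= m)%O}.
    move=> i j ij; apply/subsetPset => w Cw n /= jn; apply: Cw => /=.
    exact: leq_trans jn.
  have cC : (P \o C) x @[x --> \oo] --> P (\bigcup_k C k).
    by apply: nondecreasing_cvg_mu => //; exact: bigcup_measurable.
  rewrite -(cvg_lim _ cC) //; apply: lime_le; first exact: cvgP cC.
  apply: nearW => k /=; have [mB PB _] := HB k.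
  apply: le_trans PB; apply: le_measure; rewrite ?inE //.
  by move=> w; apply => /=.
- move=> w nC c.
  pose k := (\max_(i < K) (Num.truncn `|c i|).+1)%N.
  have /existsNP[n /not_implyP[/= kn nB]] : ~ C k w.
    by move=> Ck; apply: nC; exists k.
  have [_ _] := HB n; apply => // i.
  apply: le_trans (ltW (truncnS_gt _)) _; rewrite ler_nat; apply: leq_trans kn.
  exact: (@leq_bigmax _ (fun i => (Num.truncn `|c i|).+1)).
Qed.

End UniformDeviation.

(** * Windows *)

Section WindowSums.
Variables (N : nat) (n : 'I_N -> nat).

(** Sites are parametrized by functions into a finite type so that sums over the window of products
    over coordinates factorize by distributivity. *)
Definition box_fun (f : {ffun 'I_N -> 'I_(max_side n).+1}) : lattice N :=
  [ffun i => (f i : nat)%:Z].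

Definition box (i : 'I_N) : pred 'I_(max_side n).+1 :=
  [pred k : 'I_(max_side n).+1 | 0 < k <= n i]%N.

Definition sites : seq (lattice N) := finmap.enum_fset (fset_set (window n)).

Lemma box_window (s : lattice N) :
  window n s <-> exists2 f, f \in family box & s = box_fun f.
Proof.
split=> [ws|[f /familyP fb ->] i]; last first.
  by have := fb i; rewrite inE ffunE => /andP[h1 h2]; split; rewrite ?lez_nat.
have le_max i : (n i <= max_side n)%N by exact: leq_bigmax.
exists [ffun i => inord `|s i|%N].
  apply/familyP => i; rewrite inE ffunE /box; have [h1 h2] := ws i.
  rewrite inordK; last by have := le_max i; lia.
  by apply/andP; split; lia.
apply/ffunP => i; rewrite !ffunE; have [h1 h2] := ws i.
rewrite inordK; last by have := le_max i; lia.
by rewrite gez0_abs // (le_trans _ h1).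
Qed.

Lemma window_finite : finite_set (window n).
Proof.
apply: (@sub_finite_set _ _ [set box_fun f | f in [set: {ffun 'I_N -> 'I_(max_side n).+1}]]).
  by move=> s /box_window[f _ ->]; exists f.
by apply: finite_image; exact: finite_finset.
Qed.

Lemma mem_sites s : (s \in sites) = (s \in window n).
Proof. by rewrite -in_fset_set //; exact: window_finite. Qed.

Lemma sites_uniq : uniq sites.
Proof. exact: finmap.fset_uniq. Qed.

Lemma size_sites : size sites = card_window n.
Proof. by []. Qed.

Lemma sum_window (V : nmodType) (F : lattice N -> V) :
  \sum_(s \in window n) F s = \sum_(s <- sites) F s.
Proof. by rewrite fsbig_finite //; exact: window_finite. Qed.

Lemma sum_sites (V : nmodType) (F : lattice N -> V) :
  \sum_(s <- sites) F s = \sum_(f in family box) F (box_fun f).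
Proof.
have p : perm_eq sites [seq box_fun f | f <- enum (family box)].
  apply: uniq_perm; first exact: sites_uniq.
    rewrite map_inj_uniq ?enum_uniq // => f f' e; apply/ffunP => i.
    by have /ffunP/(_ i) := e; rewrite !ffunE => -[] /val_inj.
  move=> s; rewrite mem_sites; apply/idP/mapP => [|[f]].
    by rewrite inE => /box_window[f fb ->]; exists f => //; rewrite mem_enum.
  by rewrite mem_enum => fb ->; rewrite inE; apply/box_window; exists f.
by rewrite (perm_big _ p) big_map big_enum.
Qed.

Lemma sum_box (V : nmodType) (F : nat -> V) i :
  \sum_(k | box i k) F k = \sum_(1 <= k < (n i).+1) F k.
Proof.
have le_max : ((n i).+1 <= (max_side n).+1)%N by rewrite ltnS; exact: (@leq_bigmax _ n).
rewrite big_geq_mkord (big_ord_widen_cond _ (fun k => true && (1 <= k)%N) F le_max) /=.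
by apply: eq_bigl => k.
Qed.

Lemma sum_sites_prod (V : pzSemiRingType) (F : 'I_N -> nat -> V) :
  \sum_(f in family box) \prod_i F i (f i) = \prod_i \sum_(1 <= k < (n i).+1) F i k.
Proof.
under [RHS]eq_bigr => i _ do rewrite -sum_box.
by rewrite (bigA_distr_big_dep box (fun i (k : 'I_(max_side n).+1) => F i k)).
Qed.

Lemma card_windowE : card_window n = (\prod_i n i)%N.
Proof.
rewrite -size_sites -sum1_size (sum_sites (V := nat) (fun=> 1%N)).
transitivity (\sum_(f in family box) \prod_(i < N) 1%N)%N.
  by apply: eq_bigr => f _; rewrite big1.
rewrite (sum_sites_prod (V := nat) (fun _ _ => 1%N)).
by apply: eq_bigr => i _; rewrite sum_nat_const_nat muln1 subn1.
Qed.

End WindowSums.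

Lemma geometric_le (R : realType) (x : R) (m : nat) : 0 <= x -> x < 1 ->
  \sum_(0 <= k < m) x ^+ k <= (1 - x)^-1.
Proof.
move=> x0 x1; have d0 : 0 < 1 - x by rewrite subr_gt0.
rewrite -[leRHS]mul1r ler_pdivlMr //.
suff -> : (\sum_(0 <= k < m) x ^+ k) * (1 - x) = 1 - x ^+ m by rewrite gerBl exprn_ge0.
elim: m => [|m IH]; first by rewrite big_geq // mul0r expr0 subrr.
by rewrite big_nat_recr //= mulrDl IH exprS; ring.
Qed.

Lemma two_sided_geometric_le (R : realType) (x : R) (m k0 : nat) : 0 <= x -> x < 1 ->
  \sum_(1 <= k < m.+1) x ^+ `|k%:Z - k0%:Z|%N <= 2 / (1 - x).
Proof.
move=> x0 x1.
suff H k l : \sum_(0 <= i < l) x ^+ `|i%:Z - k%:Z|%N <=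
    \sum_(0 <= j < k) x ^+ j.+1 + (1 - x)^-1.
  apply: (@le_trans _ _ (\sum_(0 <= i < m.+1) x ^+ `|i%:Z - k0%:Z|%N)).
    by rewrite [leRHS]big_nat_recl // big_add1 lerDr exprn_ge0.
  apply: (le_trans (H _ _)); rewrite mulrDl mul1r lerD2r.
  apply: le_trans (geometric_le k0 x0 x1).
  by apply: ler_sum => j _; rewrite exprS ler_piMl ?exprn_ge0 // ltW.
elim: k l => [|k IH] [|l].
- by rewrite !big_geq // add0r invr_ge0 subr_ge0 ltW.
- rewrite [X in _ <= X + _]big_geq // add0r.
  under eq_bigr => i _ do rewrite subr0 absz_nat.
  exact: geometric_le.
- by rewrite big_geq // addr_ge0 ?sumr_ge0 ?invr_ge0 ?subr_ge0 ?(ltW x1) // => j _; rewrite exprn_ge0.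
- rewrite big_nat_recl // big_nat_recr //.
  have -> : `|0%:Z - k.+1%:Z|%N = k.+1 by lia.
  have h : \sum_(0 <= i < l) x ^+ `|i.+1%:Z - k.+1%:Z|%N <=
      \sum_(0 <= j < k) x ^+ j.+1 + (1 - x)^-1.
    apply: le_trans (IH l); apply: ler_sum => i _.
    by have -> : `|i.+1%:Z - k.+1%:Z|%N = `|i%:Z - k%:Z|%N by lia.
  move: (\sum_(0 <= i < l) _) h => u h; move: (\sum_(0 <= j < k) _) h => v h /=; lra.
Qed.

(** The sup distance is at least the mean of the coordinate distances, so the exponential is at most
    a product of one-dimensional geometric terms of ratio [expR (- (c / N))]. *)
Lemma sum_exp_dist_le (R : realType) N (n : 'I_N -> nat) (c : R) (s : lattice N) :
  (0 < N)%N -> 0 < c -> s \in window n ->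
  \sum_(t <- sites n) expR (- (c * (dist_oo s t)%:R)) <=
  (2 / (1 - expR (- (c / N%:R)))) ^+ N.
Proof.
move=> N0 c_gt0; rewrite inE => /box_window[fs fsb ->].
have NR : (0 : R) < N%:R by rewrite ltr0n.
set x := expR (- (c / N%:R)).
have x0 : 0 <= x by exact: expR_ge0.
have x1 : x < 1 by rewrite -expR0 ltr_expR oppr_lt0 divr_gt0.
rewrite sum_sites.
apply: (@le_trans _ _ (\sum_(f in family (box (n := n)))
    \prod_(i < N) x ^+ `|(f i : nat)%:Z - (fs i : nat)%:Z|%N)).
  apply: ler_sum => f _; rewrite -expr_sum -expRM_natl ler_expR mulrN lerN2.
  rewrite mulrCA ler_pM2l // ler_pdivrMr // -natrM ler_nat.
  apply: (@leq_trans (\sum_(i < N) dist_oo (box_fun fs) (box_fun f))%N); last first.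
    by rewrite sum_nat_const card_ord mulnC.
  apply: leq_sum => i _; rewrite /dist_oo.
  apply: leq_trans (@leq_bigmax _ (fun i => `|box_fun fs i - box_fun f i|%N) i).
  by rewrite !ffunE distnC.
rewrite (@sum_sites_prod _ _ _ (fun i k => x ^+ `|k%:Z - (fs i : nat)%:Z|%N)).
rewrite -[N in leRHS]card_ord -prodr_const; apply: ler_prod => i _.
by rewrite two_sided_geometric_le // andbT sumr_ge0 // => k _; rewrite exprn_ge0.
Qed.

(** * Gram-Schmidt and hard thresholding *)

Section GramSchmidt.
Variables (R : realType) (N d : nat) (n : 'I_N -> nat) (x : lattice N -> Rvec R d).
Local Notation fn := (Rvec R d -> R).
Implicit Types (f g h v : fn) (fs gs : seq fn).

Local Notation ip := (emp_inner n x).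
Local Notation M := ((card_window n)%:R : R).
Local Notation el fs i := (nth (fun=> 0 : R) fs i).

Lemma emp_innerE f h : ip f h = M^-1 * \sum_(s <- sites n) f (x s) * h (x s).
Proof. by rewrite /emp_inner sum_window. Qed.

Lemma emp_innerC f h : ip f h = ip h f.
Proof. by rewrite !emp_innerE; congr (_ * _); apply: eq_bigr => s _; rewrite mulrC. Qed.

Lemma emp_inner_ge0 f : 0 <= ip f f.
Proof. by rewrite emp_innerE mulr_ge0 ?invr_ge0 // sumr_ge0 // => s _; rewrite -expr2 sqr_ge0. Qed.

Lemma emp_innerDl f f' h : ip (fun z => f z + f' z) h = ip f h + ip f' h.
Proof.
rewrite !emp_innerE -mulrDr -big_split; congr (_ * _).
by apply: eq_bigr => s _; rewrite mulrDl.
Qed.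

Lemma emp_innerZl a f h : ip (fun z => a * f z) h = a * ip f h.
Proof.
rewrite !emp_innerE mulrCA; congr (_ * _); rewrite mulr_sumr.
by apply: eq_bigr => s _; rewrite mulrA.
Qed.

Lemma emp_inner_suml k (c : 'I_k -> R) (F : 'I_k -> fn) h :
  ip (fun z => \sum_i c i * F i z) h = \sum_i c i * ip (F i) h.
Proof.
rewrite emp_innerE; under [RHS]eq_bigr => i _ do rewrite emp_innerE mulrCA mulr_sumr.
rewrite -mulr_sumr exchange_big; congr (_ * _); apply: eq_bigr => s _ /=.
by rewrite mulr_suml; apply: eq_bigr => i _; rewrite mulrA.
Qed.

Lemma emp_innerBB f h : ip (fun z => f z - h z) (fun z => f z - h z) =
  ip f f - 2 * ip f h + ip h h.
Proof.
rewrite !emp_innerE [2 * _]mulrCA -mulrBr -mulrDr; congr (_ * _).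
by rewrite mulr_sumr -sumrB -big_split; apply: eq_bigr => s _ /=; ring.
Qed.

Lemma big_fs (V : nmodType) (Phi : fn -> V) fs :
  \sum_(f <- fs) Phi f = \sum_(j < size fs) Phi (el fs j).
Proof. by rewrite (big_nth (fun=> 0 : R)) big_mkord. Qed.

Lemma gs_residualE fs g z : gs_residual n x fs g z =
  g z + (-1) * \sum_(j < size fs) ip g (el fs j) * (el fs j) z.
Proof. by rewrite /gs_residual big_fs mulN1r. Qed.

Definition orthonormal fs : Prop := forall i j, (i < size fs)%N -> (j < size fs)%N ->
  ip (el fs i) (el fs j) = (i == j)%:R.

Lemma residual_orth fs g j : orthonormal fs -> (j < size fs)%N ->
  ip (gs_residual n x fs g) (el fs j) = 0.
Proof.
move=> ofs jfs; rewrite (_ : gs_residual n x fs g = fun z =>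
    g z + (-1) * (fun z => \sum_(j < size fs) ip g (el fs j) * (el fs j) z) z); last first.
  by apply/funext => z; rewrite gs_residualE.
rewrite emp_innerDl emp_innerZl emp_inner_suml (bigD1 (Ordinal jfs)) //= ofs // eqxx mulr1.
rewrite big1 ?addr0 ?mulN1r ?subrr // => i ij.
rewrite ofs // (_ : (i == j :> nat) = false) ?mulr0 //.
by apply/negbTE; apply: contraNneq ij => e; apply/eqP/val_inj.
Qed.

Lemma gs_step_cat fs g : exists e, gs_step n x fs g = fs ++ e /\ (size e <= 1)%N.
Proof.
rewrite /gs_step; case: ifP => _; first by exists [::]; rewrite cats0.
by eexists [:: _]; rewrite -cats1.
Qed.

Lemma gs_step_orth fs g : orthonormal fs -> orthonormal (gs_step n x fs g).
Proof.
move=> ofs; rewrite /gs_step; set h := gs_residual n x fs g.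
case: eqP => // /eqP q0; set q := ip h h in q0 *.
have qp : 0 < q by rewrite lt_def q0 emp_inner_ge0.
set hn : fn := fun z => _.
have hnE : hn = fun z => (Num.sqrt q)^-1 * h z by apply/funext => z; rewrite /hn mulrC.
have oh j : (j < size fs)%N -> ip hn (el fs j) = 0.
  by move=> jfs; rewrite hnE emp_innerZl residual_orth // mulr0.
have hh : ip hn hn = 1.
  rewrite hnE emp_innerZl emp_innerC emp_innerZl -/q mulrA -invfM -expr2 sqr_sqrtr ?(ltW qp) //.
  by rewrite mulVf.
move=> i j; rewrite !size_rcons !ltnS !nth_rcons.
case: (ltngtP i (size fs)) => // [ilt _|ieq _]; case: (ltngtP j (size fs)) => // [jlt _|jeq _].
- exact: ofs.
- by rewrite emp_innerC oh // jeq (ltn_eqF ilt).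
- by rewrite oh // ieq (gtn_eqF jlt).
- by rewrite hh ieq jeq eqxx.
Qed.

Lemma gs_foldl_cat fs gs : exists e, foldl (gs_step n x) fs gs = fs ++ e /\ (size e <= size gs)%N.
Proof.
elim: gs fs => [|g gs IH] fs /=; first by exists [::]; rewrite cats0.
have [e1 [-> s1]] := gs_step_cat fs g; have [e2 [-> s2]] := IH (fs ++ e1).
by exists (e1 ++ e2); rewrite catA size_cat; split => //; rewrite -add1n leq_add.
Qed.

Lemma gram_schmidt_orth gs : orthonormal (gram_schmidt n x gs).
Proof.
rewrite /gram_schmidt; have : orthonormal [::] by [].
by elim: gs [::] => //= g gs IH fs ofs; apply/IH/gs_step_orth.
Qed.

(** Equality is required at the design points only, which is all that the empirical [L^2] space
    sees. *)
Definition in_span fs v : Prop := exists c : nat -> R,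
  {in sites n, forall s, v (x s) = \sum_(j < size fs) c j * (el fs j) (x s)}.

Lemma in_span_cat fs e v : in_span fs v -> in_span (fs ++ e) v.
Proof.
move=> [c Hc]; exists (fun j => if (j < size fs)%N then c j else 0) => s /Hc ->.
rewrite size_cat big_split_ord /= [X in _ + X]big1 ?addr0 => [|j _].
  by apply: eq_bigr => j _; rewrite ltn_ord nth_cat ltn_ord.
by rewrite ltnNge leq_addr mul0r.
Qed.

(** A discarded function has a residual of zero empirical norm, which therefore vanishes at every
    site: nothing is lost on the design. *)
Lemma gs_step_span fs g : in_span (gs_step n x fs g) g.
Proof.
rewrite /gs_step; set h := gs_residual n x fs g.
have gE z : g z = h z + \sum_(j < size fs) ip g (el fs j) * (el fs j) z.
  by rewrite /h gs_residualE mulN1r subrK.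
case: eqP => [q0|/eqP q0].
  exists (fun j => ip g (el fs j)) => s sn.
  suff h0 : h (x s) = 0 by rewrite gE h0 add0r.
  move: q0; rewrite emp_innerE => /eqP; rewrite mulf_eq0 invr_eq0.
  have -> : (M == 0) = false.
    by apply/negbTE; rewrite pnatr_eq0 -lt0n -size_sites; case: (sites n) sn.
  rewrite /= psumr_eq0 => [/allP /(_ s sn) /=|t _]; last by rewrite -expr2 sqr_ge0.
  by rewrite -expr2 sqrf_eq0 => /eqP.
set q := ip h h in q0 *.
have qp : 0 < q by rewrite lt_def q0 emp_inner_ge0.
exists (fun j => if (j < size fs)%N then ip g (el fs j) else Num.sqrt q) => s sn.
rewrite size_rcons big_ord_recr /= ltnn nth_rcons ltnn eqxx gE addrC; congr (_ + _).
  by rewrite mulrC divfK // sqrtr_eq0 -ltNge.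
by apply: eq_bigr => j _; rewrite ltn_ord nth_rcons ltn_ord.
Qed.

Lemma gs_foldl_span fs gs i : (i < size gs)%N -> in_span (foldl (gs_step n x) fs gs) (el gs i).
Proof.
elim: gs fs i => // g gs IH fs [_|i] /=; last by rewrite ltnS; exact: IH.
have [e [-> _]] := gs_foldl_cat (gs_step n x fs g) gs.
exact/in_span_cat/gs_step_span.
Qed.

Lemma in_span_sum fs k (c : 'I_k -> R) (F : 'I_k -> fn) (p : pred 'I_k) :
  (forall i, p i -> in_span fs (F i)) -> in_span fs (fun z => \sum_(i | p i) c i * F i z).
Proof.
move=> H.
have /choice[D HD] : forall i, exists D : nat -> R, p i ->
    {in sites n, forall s, F i (x s) = \sum_(j < size fs) D j * (el fs j) (x s)}.
  move=> i; case pi: (p i); last by exists (fun=> 0).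
  by have [D HD] := H i pi; exists D.
exists (fun j => \sum_(i | p i) c i * D i j) => s sn.
under eq_bigr => i pi do rewrite (HD i pi s sn) mulr_sumr.
rewrite exchange_big; apply: eq_bigr => j _ /=; rewrite mulr_suml.
by apply: eq_bigr => i _; rewrite mulrA.
Qed.

(** Pythagoras: the error inside the span plus the squared distance from [m] to the span. *)
Lemma emp_dist_orth fs (eta : nat -> R) m : orthonormal fs ->
  M^-1 * (\sum_(s <- sites n) (\sum_(j < size fs) eta j * (el fs j) (x s) - m (x s)) ^+ 2) =
  \sum_(j < size fs) (eta j - ip m (el fs j)) ^+ 2 + (ip m m - \sum_(j < size fs) ip m (el fs j) ^+ 2).
Proof.
move=> ofs; pose e : fn := fun z => \sum_(j < size fs) eta j * (el fs j) z.
have -> : M^-1 * (\sum_(s <- sites n) (\sum_(j < size fs) eta j * (el fs j) (x s) - m (x s)) ^+ 2) =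
    ip (fun z => e z - m z) (fun z => e z - m z).
  by rewrite emp_innerE; congr (_ * _); apply: eq_bigr => s _; rewrite expr2.
rewrite emp_innerBB.
have em : ip e m = \sum_(j < size fs) eta j * ip m (el fs j).
  by rewrite emp_inner_suml; apply: eq_bigr => j _; rewrite emp_innerC.
have ee : ip e e = \sum_(j < size fs) eta j ^+ 2.
  rewrite emp_inner_suml; apply: eq_bigr => j _; rewrite expr2; congr (_ * _).
  rewrite emp_innerC emp_inner_suml (bigD1 j) //= ofs // eqxx mulr1 big1 ?addr0 // => i ij.
  by rewrite ofs // (_ : (i == j :> nat) = false) ?mulr0 //; apply/negbTE.
rewrite em ee.
have -> : \sum_(j < size fs) (eta j - ip m (el fs j)) ^+ 2 = \sum_(j < size fs) eta j ^+ 2 -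
   2 * (\sum_(j < size fs) eta j * ip m (el fs j)) + \sum_(j < size fs) ip m (el fs j) ^+ 2.
  rewrite mulr_sumr -sumrB -big_split; apply: eq_bigr => j _ /=; ring.
ring.
Qed.

(** A retained coefficient errs by [z] only; a dropped one errs by [c], with [c + z] below the
    threshold. The first bound serves the [u] leading generators, the second all later functions. *)
Lemma threshold_bound (lam a c z : R) : 0 <= lam -> a = c + z ->
  ((if lam < `|a| then a else 0) - c) ^+ 2 <= 2 * lam ^+ 2 + 2 * z ^+ 2 /\
  ((if lam < `|a| then a else 0) - c) ^+ 2 <= 2 * c ^+ 2 + 2 * z ^+ 2.
Proof.
move=> l0 ->; have z2 := sqr_ge0 z; have c2 := sqr_ge0 c; have l2 := sqr_ge0 lam.
case: ltP => h.
  have -> : c + z - c = z by ring.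
  by split; lra.
rewrite sub0r sqrrN; split; last by lra.
move: h; rewrite ler_norml => /andP[h1 h2].
have : (c + z) ^+ 2 <= lam ^+ 2 by nra.
have : 0 <= (c + z + z) ^+ 2 by exact: sqr_ge0.
rewrite !expr2; lra.
Qed.

Variables (y : lattice N -> R) (lambda : R) (K : nat) (g : 'I_K -> fn).
Hypothesis lambda0 : 0 <= lambda.
Variables (m : fn) (e : lattice N -> R).
Hypothesis ye : {in sites n, forall s, y s = m (x s) + e s}.

Local Notation gl := [seq g i | i <- enum 'I_K].
Local Notation GS := (gram_schmidt n x gl).

Definition noise_coef f : R := M^-1 * \sum_(s <- sites n) f (x s) * e s.

Lemma emp_coefE f : emp_coef n x y f = ip m f + noise_coef f.
Proof.
rewrite /emp_coef sum_window emp_innerE /noise_coef -mulrDr -big_split; congr (_ * _).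
rewrite big_seq [RHS]big_seq; apply: eq_bigr => s /ye -> /=; ring.
Qed.

Lemma hard_thresholdE z : hard_threshold n x y lambda g z =
  \sum_(j < size GS) (if lambda < `|emp_coef n x y (el GS j)| then emp_coef n x y (el GS j) else 0) * (el GS j) z.
Proof.
rewrite /hard_threshold big_mkcond big_fs; apply: eq_bigr => j _.
by case: ifP; rewrite ?mul0r.
Qed.

Lemma size_gram_schmidt : (size GS <= K)%N.
Proof.
rewrite /gram_schmidt; have [e' [-> se]] := gs_foldl_cat [::] gl.
by rewrite /= (leq_trans se) // size_map size_enum_ord.
Qed.

Lemma oracle_inequality (u : nat) v : (u <= K)%N -> subsieve g u v ->
  M^-1 * (\sum_(s <- sites n) (hard_threshold n x y lambda g (x s) - m (x s)) ^+ 2) <=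
  2 * (lambda ^+ 2 * u%:R + M^-1 * (\sum_(s <- sites n) (v (x s) - m (x s)) ^+ 2)) +
  2 * \sum_(f <- GS) noise_coef f ^+ 2.
Proof.
move=> uK [c _ vE].
have [E [GSE sE]] : exists E, GS = gram_schmidt n x (take u gl) ++ E /\ True.
  rewrite /gram_schmidt -{1}(cat_take_drop u gl) foldl_cat.
  by have [E [-> _]] := gs_foldl_cat (foldl (gs_step n x) [::] (take u gl)) (drop u gl); exists E.
set fs1 := gram_schmidt n x (take u gl) in GSE.
have s1 : (size fs1 <= u)%N.
  rewrite /fs1 /gram_schmidt; have [e' [-> se]] := gs_foldl_cat [::] (take u gl).
  by rewrite /= (leq_trans se) // size_take_min geq_minl.
have o1 : orthonormal fs1 by exact: gram_schmidt_orth.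
have oG : orthonormal GS by exact: gram_schmidt_orth.
have [b Hb] : in_span fs1 v.
  rewrite -vE; apply: in_span_sum => i iu.
  have -> : g i = (el (take u gl) i).
    by rewrite nth_take // (nth_map i) ?size_enum_ord // nth_ord_enum.
  by apply: gs_foldl_span; rewrite size_take_min size_map size_enum_ord ltn_min iu /=.
pose eta j := if lambda < `|emp_coef n x y (el GS j)| then emp_coef n x y (el GS j) else 0.
pose cc j := ip m (el GS j); pose zz j := noise_coef (el GS j).
have -> : M^-1 * (\sum_(s <- sites n) (hard_threshold n x y lambda g (x s) - m (x s)) ^+ 2) =
    \sum_(j < size GS) (eta j - cc j) ^+ 2 + (ip m m - \sum_(j < size GS) cc j ^+ 2).
  rewrite -(emp_dist_orth eta m oG); congr (_ * _); apply: eq_bigr => s _.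
  by rewrite hard_thresholdE.
have -> : M^-1 * (\sum_(s <- sites n) (v (x s) - m (x s)) ^+ 2) =
    \sum_(j < size fs1) (b j - ip m (el fs1 j)) ^+ 2 + (ip m m - \sum_(j < size fs1) ip m (el fs1 j) ^+ 2).
  rewrite -(emp_dist_orth b m o1); congr (_ * _).
  rewrite big_seq [RHS]big_seq; apply: eq_bigr => s /Hb ->; by [].
have tb j : (eta j - cc j) ^+ 2 <= 2 * lambda ^+ 2 + 2 * zz j ^+ 2 /\
    (eta j - cc j) ^+ 2 <= 2 * cc j ^+ 2 + 2 * zz j ^+ 2.
  by apply: threshold_bound => //; exact: emp_coefE.
have bessel : \sum_(j < size GS) cc j ^+ 2 <= ip m m.
  have := emp_dist_orth cc m oG.
  rewrite [X in _ = X + _]big1 => [|j _]; last by rewrite subrr expr0n.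
  rewrite add0r => h; rewrite -subr_ge0 -h mulr_ge0 ?invr_ge0 // sumr_ge0 // => s _.
  exact: sqr_ge0.
rewrite big_fs -/(zz _).
have sG : size GS = (size fs1 + size E)%N by rewrite GSE size_cat.
have split_sum (F : nat -> R) : \sum_(j < size GS) F j =
    \sum_(j < size fs1) F j + \sum_(j < size E) F (size fs1 + j)%N.
  by rewrite sG big_split_ord.
have fsj (j : 'I_(size fs1)) : (el GS j) = (el fs1 j) by rewrite GSE nth_cat ltn_ord.
rewrite (split_sum (fun j => (eta j - cc j) ^+ 2)) (split_sum (fun j => cc j ^+ 2)) in bessel *.
rewrite (split_sum (fun j => zz j ^+ 2)).
have c1 : \sum_(j < size fs1) cc j ^+ 2 = \sum_(j < size fs1) ip m (el fs1 j) ^+ 2.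
  by apply: eq_bigr => j _; rewrite /cc fsj.
have A1 : \sum_(j < size fs1) (eta j - cc j) ^+ 2 <=
    2 * lambda ^+ 2 * u%:R + 2 * \sum_(j < size fs1) zz j ^+ 2.
  apply: (@le_trans _ _ (\sum_(j < size fs1) (2 * lambda ^+ 2 + 2 * zz j ^+ 2))).
    by apply: ler_sum => j _; have [] := tb j.
  rewrite big_split /= -[X in _ + X <= _]mulr_sumr lerD2r sumr_const card_ord -[_ *+ _]mulr_natr.
  by rewrite ler_wpM2l ?ler_nat // mulr_ge0 // sqr_ge0.
have A2 : \sum_(j < size E) (eta (size fs1 + j)%N - cc (size fs1 + j)%N) ^+ 2 <=
    2 * (\sum_(j < size E) cc (size fs1 + j)%N ^+ 2) + 2 * \sum_(j < size E) zz (size fs1 + j)%N ^+ 2.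
  rewrite !mulr_sumr -big_split; apply: ler_sum => j _ /=.
  by have [] := tb (size fs1 + j)%N.
have A3 : 0 <= \sum_(j < size fs1) (b j - ip m (el fs1 j)) ^+ 2.
  by apply: sumr_ge0 => j _; exact: sqr_ge0.
rewrite -c1; lra.
Qed.

Lemma sieve_comb k (c : 'I_k -> R) (F : 'I_k -> fn) :
  (forall i, sieve g (F i)) -> sieve g (fun z => \sum_i c i * F i z).
Proof.
move=> H; have /choice[D HD] : forall i, exists D : 'I_K -> R, (fun z => \sum_j D j * g j z) = F i.
  by move=> i; have [D _ HD] := H i; exists D.
exists (fun j => \sum_i c i * D i j) => //; apply/funext => z.
under [RHS]eq_bigr => i _ do rewrite -HD mulr_sumr.
rewrite exchange_big; apply: eq_bigr => j _ /=; rewrite mulr_suml.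
by apply: eq_bigr => i _; rewrite mulrA.
Qed.

Lemma sieveD f h : sieve g f -> sieve g h -> sieve g (fun z => f z + h z).
Proof.
move=> [c _ <-] [c' _ <-]; exists (fun i => c i + c' i) => //.
by apply/funext => z; rewrite -big_split; apply: eq_bigr => i _; rewrite mulrDl.
Qed.

Lemma sieveZ a f : sieve g f -> sieve g (fun z => a * f z).
Proof.
move=> [c _ <-]; exists (fun i => a * c i) => //.
by apply/funext => z; rewrite mulr_sumr; apply: eq_bigr => i _; rewrite mulrA.
Qed.

Lemma gram_schmidt_sieve j : (j < size GS)%N -> sieve g (el GS j).
Proof.
rewrite /gram_schmidt.
suff H gs fs : (forall i, (i < size gs)%N -> sieve g (el gs i)) ->
   (forall i, (i < size fs)%N -> sieve g (el fs i)) ->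
   forall j, (j < size (foldl (gs_step n x) fs gs))%N -> sieve g (el (foldl (gs_step n x) fs gs) j).
  apply: H => // i; rewrite size_map size_enum_ord => iK.
  rewrite (nth_map (Ordinal iK)) ?size_enum_ord //.
  set i' := nth _ _ _; exists (fun k => (k == i')%:R) => //.
  apply/funext => z; rewrite (bigD1 i') //= eqxx mul1r big1 ?addr0 // => k /negbTE ->.
  by rewrite mul0r.
elim: gs fs => // f gs IH fs Hgs Hfs k /=.
apply: IH => [i ig|]; first exact: (Hgs i.+1).
move=> i; rewrite /gs_step; case: ifP => _; first exact: Hfs.
rewrite size_rcons ltnS nth_rcons; case: ltngtP => // [ilt _|_ _]; first exact: Hfs.
set q := ip _ _.
rewrite (_ : (fun z => _) = fun z => (Num.sqrt q)^-1 *
   (f z + (-1) * \sum_(j < size fs) ip f (el fs j) * (el fs j) z)).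
  apply: sieveZ; apply: sieveD; first exact: (Hgs 0%N).
  by apply: sieveZ; apply: sieve_comb => l; exact: Hfs.
by apply/funext => z; rewrite gs_residualE mulrC.
Qed.

Lemma hard_threshold_sieve : sieve g (hard_threshold n x y lambda g).
Proof.
rewrite (_ : hard_threshold n x y lambda g = fun z => \sum_(j < size GS)
  (if lambda < `|emp_coef n x y (el GS j)| then emp_coef n x y (el GS j) else 0) * (el GS j) z).
  by apply: sieve_comb => j; exact: gram_schmidt_sieve.
by apply/funext => z; rewrite hard_thresholdE.
Qed.

(** The matrix, over pairs of sites, of the empirical orthogonal projection onto the sieve. *)
Definition proj_kernel (s t : lattice N) : R := M^-1 * \sum_(f <- GS) f (x s) * f (x t).

Lemma noise_energy : \sum_(f <- GS) noise_coef f ^+ 2 =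
  M^-1 * \sum_(s <- sites n) \sum_(t <- sites n) proj_kernel s t * (e s * e t).
Proof.
have hf f : noise_coef f ^+ 2 = M^-1 * \sum_(s <- sites n) \sum_(t <- sites n)
    M^-1 * (f (x s) * f (x t)) * (e s * e t).
  rewrite /noise_coef expr2 mulrACA -mulrA; congr (_ * _).
  rewrite mulr_suml mulr_sumr; apply: eq_bigr => s _.
  by rewrite !mulr_sumr; apply: eq_bigr => t _; ring.
under eq_bigr => f _ do rewrite hf.
rewrite -mulr_sumr; congr (_ * _); rewrite exchange_big; apply: eq_bigr => s _ /=.
rewrite exchange_big; apply: eq_bigr => t _ /=.
by rewrite /proj_kernel -mulr_suml -mulr_sumr.
Qed.

(** The squared Frobenius norm of an orthogonal projection is its rank. *)
Lemma proj_kernel_energy :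
  \sum_(s <- sites n) \sum_(t <- sites n) proj_kernel s t ^+ 2 = (size GS)%:R.
Proof.
have oG : orthonormal GS by exact: gram_schmidt_orth.
transitivity (\sum_(f <- GS) \sum_(h <- GS) ip f h ^+ 2); last first.
  rewrite big_fs (eq_bigr (fun=> 1)) => [|j _]; first by rewrite sumr_const card_ord.
  rewrite big_fs (bigD1 j) //= oG // eqxx expr1n big1 ?addr0 // => i ij.
  by rewrite oG // eq_sym (_ : (i == j :> nat) = false) ?expr0n //; apply/negbTE.
transitivity (\sum_(s <- sites n) \sum_(t <- sites n) \sum_(f <- GS) \sum_(h <- GS)
   M^-1 ^+ 2 * ((f (x s) * h (x s)) * (f (x t) * h (x t)))).
  apply: eq_bigr => s _; apply: eq_bigr => t _; rewrite /proj_kernel exprMn.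
  rewrite [(\sum_(f <- _) _) ^+ 2]expr2 mulr_suml mulr_sumr; apply: eq_bigr => f _.
  by rewrite !mulr_sumr; apply: eq_bigr => h _; ring.
under eq_bigr => s _ do rewrite exchange_big.
rewrite exchange_big; apply: eq_bigr => f _ /=.
under eq_bigr => s _ do rewrite exchange_big.
rewrite exchange_big; apply: eq_bigr => h _ /=.
rewrite emp_innerE exprMn [(\sum_(s <- _) _) ^+ 2]expr2 mulr_suml mulr_sumr.
by apply: eq_bigr => s _; rewrite !mulr_sumr.
Qed.

End GramSchmidt.

(** * Expected energy of the projected noise *)

Section ProjectionMeasurable.
Variables (R : realType) (N d : nat) (n : 'I_N -> nat).
Local Notation fn := (Rvec R d -> R).
Implicit Types (f g h : fn) (fs gs : seq fn) (x : lattice N -> Rvec R d).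
Local Notation el fs i := (nth (fun=> 0 : R) fs i).

(* Unlike [gs_step], this variant keeps the vanishing residuals, as zero
   functions (Rocq's division gives [0] there), so that the length of the family
   does not depend on the design. *)
Definition gs_keep x fs g : seq fn :=
  let h := gs_residual n x fs g in
  rcons fs (fun z => h z / Num.sqrt (emp_inner n x h h)).

(** Families that differ by zero functions have the same such sums, and both [gs_residual] and
    [proj_kernel] see a family only through them. *)
Definition same_sums fs fs' : Prop := forall Phi : fn -> R, Phi (fun=> 0) = 0 ->
  \sum_(f <- fs) Phi f = \sum_(f <- fs') Phi f.

Lemma same_sums_step x fs fs' g : same_sums fs fs' ->
  same_sums (gs_step n x fs g) (gs_keep x fs' g).
Proof.
move=> H; have hE : gs_residual n x fs g = gs_residual n x fs' g.
  apply/funext => z; rewrite /gs_residual; congr (_ - _).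
  by apply: (H (fun f => emp_inner n x g f * f z)); rewrite mulr0.
move=> Phi P0; rewrite /gs_step /gs_keep -hE; set h := gs_residual n x fs g.
case: eqP => [q0|_]; rewrite -!cats1 !big_cat !big_seq1 (H _ P0) //=.
rewrite q0 sqrtr0 invr0 (_ : (fun z => _) = fun=> 0) ?P0 ?addr0 //.
by apply/funext => z; rewrite mulr0.
Qed.

Lemma same_sums_gram_schmidt x gs :
  same_sums (gram_schmidt n x gs) (foldl (gs_keep x) [::] gs).
Proof.
suff H fs fs' : same_sums fs fs' ->
    same_sums (foldl (gs_step n x) fs gs) (foldl (gs_keep x) fs' gs) by exact: H.
elim: gs fs fs' => //= g gs IH fs fs' H.
exact/IH/same_sums_step.
Qed.

Variables (disp : measure_display) (D : measurableType disp).
Variable x : D -> lattice N -> Rvec R d.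
Hypothesis mx : forall s, measurable_fun setT (fun w => x w s).

Lemma measurable_emp_inner (F H : D -> fn) :
  (forall s, measurable_fun setT (fun w => F w (x w s))) ->
  (forall s, measurable_fun setT (fun w => H w (x w s))) ->
  measurable_fun setT (fun w => emp_inner n (x w) (F w) (H w)).
Proof.
move=> mF mH; under eq_fun do rewrite emp_innerE.
apply: measurable_funM; first exact: measurable_cst.
by apply: measurable_sum => s; exact: measurable_funM.
Qed.

Lemma gs_keep_measurable gs : (forall i, (i < size gs)%N -> measurable_fun setT (el gs i)) ->
  (forall w, size (foldl (gs_keep (x w)) [::] gs) = size gs) /\
  (forall j s, measurable_fun setT (fun w => el (foldl (gs_keep (x w)) [::] gs) j (x w s))).
Proof.
elim/last_ind: gs => [|gs g IH] mgs.
  split=> // j s; under eq_fun do rewrite nth_nil; exact: measurable_cst.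
have [sz mF] : (forall w, size (foldl (gs_keep (x w)) [::] gs) = size gs) /\
  (forall j s, measurable_fun setT (fun w => el (foldl (gs_keep (x w)) [::] gs) j (x w s))).
  apply: IH => i ig; have := mgs i; rewrite size_rcons nth_rcons ig => H.
  by apply: H; rewrite ltnS ltnW.
have mg : measurable_fun setT g.
  by have := mgs (size gs); rewrite size_rcons nth_rcons ltnn eqxx; apply.
pose F w := foldl (gs_keep (x w)) [::] gs.
have mgx s : measurable_fun setT (fun w => g (x w s)) by exact: measurableT_comp.
have mr s : measurable_fun setT (fun w => gs_residual n (x w) (F w) g (x w s)).
  rewrite (_ : (fun _ => _) = fun w => g (x w s) -
     \sum_(0 <= j < size gs) emp_inner n (x w) g (el (F w) j) * el (F w) j (x w s)).
    apply: measurable_funB => //; apply: measurable_sum => j; apply: measurable_funM.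
      by apply: (measurable_emp_inner (F := fun=> g)) => // t; exact: mF.
    exact: mF.
  by apply/funext => w; rewrite /gs_residual (big_nth (fun=> 0 : R)) sz.
have mq : measurable_fun setT (fun w => (Num.sqrt (emp_inner n (x w)
    (gs_residual n (x w) (F w) g) (gs_residual n (x w) (F w) g)))^-1).
  (* The inverse square root becomes a real power, known to be measurable; at [0] both are [0] by
     convention. *)
  rewrite (_ : (fun _ => _) = fun w => (emp_inner n (x w)
    (gs_residual n (x w) (F w) g) (gs_residual n (x w) (F w) g)) `^ (- 2^-1)).
    apply: (measurableT_comp (measurable_powR (- 2^-1))).
    exact: measurable_emp_inner.
  by apply/funext => w; rewrite powRN powR12_sqrt // emp_inner_ge0.
split=> [w|j s]; first by rewrite foldl_rcons /gs_keep !size_rcons sz.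
under eq_fun do rewrite foldl_rcons /gs_keep nth_rcons sz.
case: ltngtP => _.
- exact: mF.
- exact: measurable_cst.
- by apply: measurable_funM.
Qed.

Variables (K : nat) (g : 'I_K -> fn).
Hypothesis mg : forall i, measurable_fun setT (g i).

Lemma proj_kernel_measurable s t :
  measurable_fun setT (fun w => proj_kernel n (x w) g s t).
Proof.
pose gl := [seq g i | i <- enum 'I_K].
have [sz mF] : (forall w, size (foldl (gs_keep (x w)) [::] gl) = size gl) /\
  (forall j s, measurable_fun setT (fun w => el (foldl (gs_keep (x w)) [::] gl) j (x w s))).
  apply: gs_keep_measurable => i; rewrite size_map size_enum_ord => iK.
  by rewrite (nth_map (Ordinal iK)) ?size_enum_ord.
rewrite (_ : (fun _ => _) = fun w => (card_window n)%:R^-1 * \sum_(0 <= j < size gl)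
   el (foldl (gs_keep (x w)) [::] gl) j (x w s) * el (foldl (gs_keep (x w)) [::] gl) j (x w t)).
  apply: measurable_funM; first exact: measurable_cst.
  by apply: measurable_sum => j; exact: measurable_funM.
apply/funext => w; rewrite /proj_kernel; congr (_ * _).
rewrite (same_sums_gram_schmidt (x w) gl (Phi := fun f => f (x w s) * f (x w t))) ?mulr0 //.
by rewrite (big_nth (fun=> 0 : R)) sz.
Qed.

End ProjectionMeasurable.

Section AlmostSure.
Variables (R : realType) (disp : measure_display) (Omega : measurableType disp).
Variable P : probability Omega R.

Lemma Ex_ae (U V : Omega -> R) : bmeas U -> bmeas V ->
  {ae P, forall w, U w = V w} -> Ex P U = Ex P V.
Proof.
move=> [mU _] [mV _] UV; rewrite /Ex /Rintegral; congr fine; apply: ae_eq_integral => //.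
- exact/measurable_EFinP.
- exact/measurable_EFinP.
- by apply: filterS UV => w ->.
Qed.

(** The covariance bound with [a = 0], which avoids product measures. *)
Lemma Ex_indep (G1 G2 : set (set Omega)) (U V : Omega -> R) u v :
  G1 `<=` measurable -> G2 `<=` measurable ->
  (forall A B, <<s G1 >> A -> <<s G2 >> B -> (P (A `&` B) = P A * P B)%E) ->
  smeas G1 U -> smeas G2 V -> (forall w, `|U w| <= u) -> (forall w, `|V w| <= v) ->
  Ex P (fun w => U w * V w) = Ex P U * Ex P V.
Proof.
move=> s1 s2 ind mU mV bU bV; apply/eqP; rewrite -subr_eq0 -normr_le0.
have u0 : 0 <= u by exact: le_trans (bU point).
have v0 : 0 <= v by exact: le_trans (bV point).
have := @cov_abs R disp Omega P G1 G2 0 s1 s2 _ U V (u + 1) (v + 1) _ _ mU mV _ _.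
rewrite mulr0; apply.
- by move=> A B sA sB; rewrite ind // adde0.
- by rewrite ltr_wpDl.
- by rewrite ltr_wpDl.
- by move=> w; apply: le_trans (bU w) _; rewrite lerDl.
- by move=> w; apply: le_trans (bV w) _; rewrite lerDl.
Qed.

End AlmostSure.

Section Noise.
Variables (R : realType) (N d : nat) (disp : measure_display) (Omega : measurableType disp).
Variables (P : probability Omega R) (X : lattice N -> {RV P >-> Rvec R d}).
Variables (Y eps : lattice N -> {RV P >-> R}) (m sigma : Rvec R d -> R).
Variables (c0 c1 S B' : R).
Hypotheses (N0 : (0 < N)%N) (c00 : 0 <= c0) (c10 : 0 < c1) (S0 : 0 <= S) (B'0 : 0 <= B').
Hypothesis mix : strong_mixing P (fun s w => (X s w, Y s w)) c0 c1.
Hypotheses (mm : measurable_fun setT m) (msig : measurable_fun setT sigma).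
Hypothesis Yeq : forall s, {ae P, forall w, Y s w = m (X s w) + sigma (X s w) * eps s w}.
Hypothesis sigS : forall s, {ae P, forall w, `|sigma (X s w)| <= S}.
Hypothesis epsB : forall s, {ae P, forall w, `|eps s w| <= B'}.
Hypothesis eps0 : forall s, ('E_P[eps s] = 0)%E.
Hypothesis indep : independent_fields P (fun s => eps s : Omega -> R)
                       (fun s => X s : Omega -> Rvec R d).
Variables (n : 'I_N -> nat) (K : nat) (g : 'I_K -> Rvec R d -> R).
Hypotheses (M0 : (0 < card_window n)%N) (K0 : (0 < K)%N).
Hypothesis mg : forall i, measurable_fun setT (g i).

Local Notation M := ((card_window n)%:R : R).

(** Truncation at the almost sure bounds alters the noise on a null set only and makes it bounded
    everywhere. *)
Definition sigma_b z : R := trunc S (sigma z).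
Definition eps_b s w : R := trunc B' (eps s w).
Definition noise s w : R := sigma_b (X s w) * eps_b s w.

Definition noise_sq w : R := \sum_(f <- gram_schmidt n (fun s => X s w) [seq g i | i <- enum 'I_K])
  noise_coef n (fun s => X s w) (fun s => noise s w) f ^+ 2.

Let msb : measurable_fun setT sigma_b.
Proof. exact: measurable_trunc. Qed.

Let mtb : measurable_fun setT (trunc B').
Proof. exact: (measurable_trunc B' (@measurable_id _ R setT)). Qed.

Let sb_le z : `|sigma_b z| <= S. Proof. exact: trunc_norm. Qed.
Let eb_le s w : `|eps_b s w| <= B'. Proof. exact: trunc_norm. Qed.

Let mX s : measurable_fun setT (X s : Omega -> Rvec R d). Proof. exact: measurable_funPT. Qed.
Let sysX := field_system (fun s => X s : Omega -> Rvec R d) setT.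
Let sysE := field_system (fun s => eps s : Omega -> R) setT.

Let sysX_meas : sysX `<=` measurable. Proof. exact: field_system_measurable. Qed.
Let sysE_meas : sysE `<=` measurable. Proof. exact: field_system_measurable. Qed.

Let smeasX s (h : Rvec R d -> R) : measurable_fun setT h -> smeas sysX (fun w => h (X s w)).
Proof. by move=> mh; apply: (@smeas_field _ _ _ _ _ _ (fun s => X s : Omega -> Rvec R d)). Qed.

Let smeasE s (h : R -> R) : measurable_fun setT h -> smeas sysE (fun w => h (eps s w)).
Proof. by move=> mh; apply: (@smeas_field _ _ _ _ _ _ (fun s => eps s : Omega -> R)). Qed.

Let indepXE (U V : Omega -> R) u v : smeas sysX U -> smeas sysE V ->
  (forall w, `|U w| <= u) -> (forall w, `|V w| <= v) ->
  Ex P (fun w => U w * V w) = Ex P U * Ex P V.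
Proof.
move=> mU mV; apply: Ex_indep sysX_meas sysE_meas _ mU mV => A C sA sC.
by rewrite setIC muleC; exact: indep.
Qed.

Let beb s : bmeas (eps_b s).
Proof. by split; [exact: measurableT_comp|exists B'; exact: eb_le]. Qed.

Let Ex_eps_b s : Ex P (eps_b s) = 0.
Proof.
apply: EFin_inj; rewrite ExE //; apply: etrans (eps0 s); rewrite unlock; apply: ae_eq_integral => //.
- by apply/measurable_EFinP; have [] := beb s.
- exact/measurable_EFinP.
- by apply: filterS (epsB s) => w h _; rewrite /= /eps_b trunc_id.
Qed.

Let Gam s t := Ex P (fun w => eps_b s w * eps_b t w).

Let Gam_le s t : `|Gam s t| <= B' ^+ 2.
Proof.
have h w : `|eps_b s w * eps_b t w| <= B' ^+ 2 by rewrite normrM expr2 ler_pM.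
have bb : bmeas (fun w => eps_b s w * eps_b t w) by exact: bmeasM.
rewrite ler_norml; apply/andP; split.
  rewrite -(Ex_cst P (- B' ^+ 2)); apply: Ex_le => // [|w]; first exact: bmeas_cst.
  by have := h w; rewrite ler_norml => /andP[].
rewrite -(Ex_cst P (B' ^+ 2)); apply: Ex_le => // [|w]; first exact: bmeas_cst.
by have := h w; rewrite ler_norml => /andP[].
Qed.

(* [sigma] need not be bounded away from 0, so the covariances of the errors are
   only controlled through those of [|sigma (X s)| * eps s], which is a function
   of [(X s, Y s)]. *)
Let sgb z : R := 2 * (0 <= sigma_b z)%R%:R - 1.
Let V s w : R := trunc (S * B') (sgb (X s w) * (Y s w - m (X s w))).

Let V_ae s : {ae P, forall w, V s w = `|sigma_b (X s w)| * eps_b s w}.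
Proof.
apply: filterS3 (Yeq s) (sigS s) (epsB s) => w yE sS eB.
rewrite /V yE addrAC subrr add0r.
have e1 : sigma (X s w) = sigma_b (X s w) by rewrite /sigma_b trunc_id.
have e2 : eps s w = eps_b s w by rewrite /eps_b trunc_id.
rewrite e1 e2 mulrA (_ : sgb _ * _ = `|sigma_b (X s w)|).
  by rewrite trunc_id // normrM normr_id ler_pM.
rewrite /sgb; case: leP => h /=; first by rewrite mulr1 ger0_norm //; ring.
by rewrite mulr0 sub0r mulN1r ltr0_norm.
Qed.

Let msgb : measurable_fun setT sgb.
Proof.
apply: measurable_funB; last exact: measurable_cst.
apply: measurable_funM; first exact: measurable_cst.
apply: measurable_natr_bool; have := msb measurableT (measurable_itv `[0, +oo[).
by rewrite setTI (_ : _ @^-1` _ = [set w | 0 <= sigma_b w]) //; apply/seteqP; split => w /=; rewrite in_itv /= andbT.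
Qed.

Let SB0 : 0 <= S * B'. Proof. exact: mulr_ge0. Qed.
Let V_le s w : `|V s w| <= S * B'. Proof. exact: trunc_norm. Qed.

Let hV (z : Rvec R d * R) : R := trunc (S * B') (sgb z.1 * (z.2 - m z.1)).

Let mhV : measurable_fun setT hV.
Proof.
apply: measurable_trunc; apply: measurable_funM.
  by apply: measurableT_comp => //; exact: measurable_fst.
apply: measurable_funB; first exact: measurable_snd.
by apply: measurableT_comp => //; exact: measurable_fst.
Qed.

Let mZ s : measurable_fun setT (fun w => (X s w, Y s w)).
Proof. exact: measurable_fun_pair. Qed.

Let bV s : bmeas (V s).
Proof.
split; last by exists (S * B').
exact: (measurableT_comp mhV (mZ s)).
Qed.

Let bsb s : bmeas (fun w => sigma_b (X s w)).
Proof. by split; [exact: measurableT_comp|exists S]. Qed.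

Let babs (U : Omega -> R) : bmeas U -> bmeas (fun w => `|U w| : R).
Proof.
move=> [mU [c Uc]]; split; last by exists c => w; rewrite normr_id.
exact: measurableT_comp.
Qed.

Let Ex_V s : Ex P (V s) = 0.
Proof.
rewrite (Ex_ae (bV s) _ (V_ae s)); last by apply: bmeasM => //; exact: babs.
rewrite (@indepXE _ _ S B') ?Ex_eps_b ?mulr0 //.
- by apply: (@smeasX s (fun z => `|sigma_b z|)); exact: measurableT_comp.
- exact: (@smeasE s (trunc B')).
- by move=> w; rewrite normr_id.
Qed.

(** The design factors out by independence. Since mixing bounds the left-hand side, it controls the
    error covariance weighted by the mean product of the two scales. *)
Let Ex_VV s t : Ex P (fun w => V s w * V t w) =
  Ex P (fun w => `|sigma_b (X s w)| * `|sigma_b (X t w)|) * Gam s t.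
Proof.
have b1 := babs (bsb s); have b2 := babs (bsb t).
rewrite -(@indepXE _ _ (S * S) (B' * B')).
- apply: Ex_ae; first exact: bmeasM.
    by apply: bmeasM; exact: bmeasM.
  by apply: filterS2 (V_ae s) (V_ae t) => w -> ->; ring.
- apply: measurable_funM.
    by apply: (@smeasX s (fun z => `|sigma_b z|)); exact: measurableT_comp.
  by apply: (@smeasX t (fun z => `|sigma_b z|)); exact: measurableT_comp.
- by apply: measurable_funM; exact: (@smeasE _ (trunc B')).
- by move=> w; rewrite normrM !normr_id ler_pM.
- by move=> w; rewrite normrM ler_pM.
Qed.

Let cov_V s t : `|Ex P (fun w => V s w * V t w)| <=
  4 * (S * B' + 1) ^+ 2 * (c0 * expR (- (c1 * (dist_oo s t)%:R))).
Proof.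
have V1 u w : `|V u w| <= S * B' + 1 by apply: (le_trans (V_le u w)); rewrite lerDl.
have p0 : 0 < S * B' + 1 by rewrite ltr_wpDl.
have sV u : smeas (field_system (fun s w => (X s w, Y s w)) [set u]) (V u).
  exact: (@smeas_field _ _ _ _ _ _ (fun s w => (X s w, Y s w)) [set u] u hV erefl mhV).
have sub u : field_system (fun s w => (X s w, Y s w)) [set u] `<=` measurable.
  exact: field_system_measurable.
have := @cov_abs R disp Omega P _ _ (c0 * expR (- (c1 * (dist_oo s t)%:R)))
  (sub s) (sub t) _ (V s) (V t) _ _ p0 p0 (sV s) (sV t) (V1 s) (V1 t).
rewrite !Ex_V mulr0 subr0 expr2 [4 * (_ * _)]mulrA; apply => A B sA sB.
by apply: (mixing_ineq mZ mix _ sA sB) => u v /= -> ->.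
Qed.

(** Truncation at [K] bounds the kernel for all pairs of sites. On the window it changes nothing: a
    squared entry is at most the total energy, which is at most [K]. *)
Let H s t w : R := trunc K%:R (proj_kernel n (fun s => X s w) g s t).

(** Measurability is with respect to the design alone, so the whole kernel is independent of the
    errors. *)
Let mH s t : smeas sysX (H s t).
Proof.
apply: measurable_trunc.
apply: (@proj_kernel_measurable R N d n _ (g_sigma_algebraType sysX) (fun w s => X s w)) => // u.
move=> _ A mA; rewrite setTI; apply: sub_sigma_algebra.
by exists u => //; exists A => //; rewrite setTI.
Qed.

Let H_le s t w : `|H s t w| <= K%:R. Proof. exact: trunc_norm. Qed.

Let bH s t : bmeas (H s t).
Proof. by split; [exact (smeas_measurable sysX_meas (@mH s t))|exists K%:R]. Qed.

Let HE s t w : s \in sites n -> t \in sites n -> H s t w = proj_kernel n (fun s => X s w) g s t.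
Proof.
move=> sn tn; apply: trunc_id.
have K1 : 1 <= K%:R :> R by rewrite ler1n.
set h := proj_kernel _ _ _ _ _.
suff : h ^+ 2 <= K%:R ^+ 2 by rewrite -[leLHS]real_normK ?num_real // ler_sqr ?nnegrE.
apply: (@le_trans _ _ K%:R); last by rewrite expr2 ler_peMr.
have : (size (gram_schmidt n (fun s => X s w) [seq g i | i <- enum 'I_K]))%:R <= K%:R :> R.
  by rewrite ler_nat size_gram_schmidt.
apply: le_trans; rewrite -proj_kernel_energy.
rewrite (big_rem s) //= (big_rem t) //= -/h -addrA lerDl addr_ge0 ?sumr_ge0 // => u _.
  exact: sqr_ge0.
by apply: sumr_ge0 => v _; exact: sqr_ge0.
Qed.

Let noise_sqE w : noise_sq w = M^-1 * \sum_(s <- sites n) \sum_(t <- sites n)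
  H s t w * (noise s w * noise t w).
Proof.
rewrite /noise_sq noise_energy; congr (_ * _); rewrite big_seq [RHS]big_seq.
apply: eq_bigr => s sn; rewrite big_seq [RHS]big_seq; apply: eq_bigr => t tn.
by rewrite HE.
Qed.

Let H_energy w : \sum_(s <- sites n) \sum_(t <- sites n) H s t w ^+ 2 <= K%:R.
Proof.
apply: (@le_trans _ _ (size (gram_schmidt n (fun s => X s w) [seq g i | i <- enum 'I_K]))%:R).
  rewrite -proj_kernel_energy big_seq [leRHS]big_seq; apply: ler_sum => s sn.
  rewrite big_seq [leRHS]big_seq; apply: ler_sum => t tn.
  by rewrite HE.
by rewrite ler_nat size_gram_schmidt.
Qed.

Let bnoise s : bmeas (noise s). Proof. exact: bmeasM. Qed.

Let bterm s t : bmeas (fun w => H s t w * (noise s w * noise t w)).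
Proof. by apply: bmeasM => //; exact: bmeasM. Qed.

Lemma noise_sq_bmeas : bmeas noise_sq.
Proof.
rewrite (_ : noise_sq = fun w => M^-1 * \sum_(s <- sites n) \sum_(t <- sites n)
  H s t w * (noise s w * noise t w)).
  by apply: bmeasZ; apply: bmeas_sum => s; apply: bmeas_sum.
by apply/funext => w; exact: noise_sqE.
Qed.

Definition noise_const : R :=
  S ^+ 2 * B' ^+ 2 * (4 * (S * B' + 1) ^+ 2 * c0) * (2 / (1 - expR (- (c1 / N%:R)))) ^+ N.

(** Once the errors are integrated out, [h * r <= eta / 2 * h ^ 2 + r ^ 2 / (2 * eta)], with [r] the
    covariance weighted by the scales. One factor of [r ^ 2] is bounded by [S ^ 2 * B' ^ 2]; the
    other is kept, as its mean is what [cov_V] bounds. *)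
Let term_le s t (eta : R) : 0 < eta ->
  Ex P (fun w => H s t w * (noise s w * noise t w)) <=
  eta / 2 * Ex P (fun w => H s t w ^+ 2) +
  (2 * eta)^-1 * (S ^+ 2 * B' ^+ 2 * (4 * (S * B' + 1) ^+ 2 * c0) *
     expR (- (c1 * (dist_oo s t)%:R))).
Proof.
move=> eta0.
have bs := bsb s; have bt := bsb t; have bh := bH s t.
have bss := bmeasM bs bt; have bhss := bmeasM bh bss.
have -> : (fun w => H s t w * (noise s w * noise t w)) =
   fun w => (H s t w * (sigma_b (X s w) * sigma_b (X t w))) * (eps_b s w * eps_b t w).
  by apply/funext => w; rewrite /noise; ring.
rewrite (@indepXE _ _ (K%:R * (S * S)) (B' * B')); last 4 first.
- apply: measurable_funM; first exact: mH.
  by apply: measurable_funM; exact: smeasX.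
- by apply: measurable_funM; exact: (@smeasE _ (trunc B')).
- by move=> w; rewrite normrM ler_pM // normrM ler_pM.
- by move=> w; rewrite normrM ler_pM.
rewrite -/(Gam s t) [leLHS]mulrC -[leLHS]ExZ //.
have bHH : bmeas (fun w => H s t w ^+ 2).
  by rewrite (_ : (fun _ => _) = fun w => H s t w * H s t w) //; exact: bmeasM.
have bab : bmeas (fun w => `|sigma_b (X s w)| * `|sigma_b (X t w)|).
  by apply: bmeasM; exact: babs.
pose G := `|Gam s t|.
apply: (@le_trans _ _ (Ex P (fun w => eta / 2 * H s t w ^+ 2 +
   ((2 * eta)^-1 * (S ^+ 2 * B' ^+ 2) * G) * (`|sigma_b (X s w)| * `|sigma_b (X t w)|)))).
  apply: Ex_le => [||w]; [exact: bmeasZ|by apply: bmeasD; exact: bmeasZ|].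
  set p := sigma_b (X s w); set q := sigma_b (X t w); set h := H s t w.
  have pS : `|p| <= S by exact: sb_le.
  have qS : `|q| <= S by exact: sb_le.
  have GB : G <= B' ^+ 2 by exact: Gam_le.
  apply: (@le_trans _ _ (`|h| * (G * (`|p| * `|q|)))).
    apply: le_trans (ler_norm _) _; rewrite !normrM -/G; rewrite le_eqVlt; apply/orP; left; apply/eqP; ring.
  set r := G * (`|p| * `|q|).
  have G0 : 0 <= G by exact: normr_ge0.
  have r0 : 0 <= r by rewrite /r !mulr_ge0.
  have rr : r ^+ 2 <= S ^+ 2 * B' ^+ 2 * G * (`|p| * `|q|).
    rewrite expr2 {1}/r -[leRHS]mulrA -/r.
    apply: ler_wpM2r => //; rewrite mulrC; apply: ler_pM => //.
      by rewrite expr2 ler_pM.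
  have am : 0 <= (eta * `|h| - r) ^+ 2 by exact: sqr_ge0.
  have h2 : `|h| ^+ 2 = h ^+ 2 by rewrite real_normK ?num_real.
  rewrite -h2 -(ler_pM2l (mulr_gt0 (ltr0n R 2) eta0)).
  have -> : 2 * eta * (eta / 2 * `|h| ^+ 2 + (2 * eta)^-1 * (S ^+ 2 * B' ^+ 2) * G * (`|p| * `|q|)) =
    eta ^+ 2 * `|h| ^+ 2 + S ^+ 2 * B' ^+ 2 * G * (`|p| * `|q|) by field; rewrite gt_eqF.
  rewrite !expr2 in am rr *; lra.
rewrite ExD; [|exact: bmeasZ|exact: bmeasZ]; rewrite !ExZ // lerD2l -!mulrA.
rewrite ler_pM2l ?invr_gt0 ?mulr_gt0 // !mulrA.
have E0 : 0 <= Ex P (fun w => `|sigma_b (X s w)| * `|sigma_b (X t w)|).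
  by apply: Ex_ge0 => w; exact: mulr_ge0.
have := cov_V s t; rewrite Ex_VV normrM (ger0_norm E0) -/G => hc.
have SB2 : 0 <= S ^+ 2 * B' ^+ 2 by rewrite mulr_ge0 ?sqr_ge0.
have := ler_wpM2l SB2 hc; rewrite !mulrA; apply: le_trans.
by rewrite le_eqVlt; apply/orP; left; apply/eqP; ring.
Qed.

(** The choice [eta = Num.sqrt M] balances the kernel energy, at most [K], against [M] rows of
    summable covariances. *)
Lemma Ex_noise_sq_le : Ex P noise_sq <= (K%:R + noise_const) / Num.sqrt M.
Proof.
have MR : 0 < M by rewrite ltr0n.
have q0 : 0 < Num.sqrt M by rewrite sqrtr_gt0.
have qq : Num.sqrt M * Num.sqrt M = M by rewrite -expr2 sqr_sqrtr // ltW.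
rewrite (_ : noise_sq = fun w => M^-1 * \sum_(s <- sites n) \sum_(t <- sites n)
  H s t w * (noise s w * noise t w)); last by apply/funext => w; exact: noise_sqE.
have b1 s : bmeas (fun w => \sum_(t <- sites n) H s t w * (noise s w * noise t w)).
  by apply: bmeas_sum => t.
rewrite ExZ ?Ex_sum //; last by apply: bmeas_sum.
rewrite (eq_bigr _ (fun s _ => Ex_sum P (sites n) xpredT (bterm s))).
set C := S ^+ 2 * B' ^+ 2 * (4 * (S * B' + 1) ^+ 2 * c0).
have SB1 : 0 <= S * B' + 1 by rewrite addr_ge0.
have C0 : 0 <= C.
  rewrite /C; apply: mulr_ge0; first by apply: mulr_ge0; exact: exprn_ge0.
  by apply: mulr_ge0 => //; apply: mulr_ge0 => //; exact: exprn_ge0.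
have x1 : expR (- (c1 / N%:R)) < 1.
  by rewrite -[ltRHS]expR0 ltr_expR oppr_lt0 divr_gt0 ?ltr0n.
set D := (2 / (1 - expR (- (c1 / N%:R)))) ^+ N.
have D0 : 0 <= D by rewrite exprn_ge0 // divr_ge0 // subr_ge0 ltW.
have bHH s t : bmeas (fun w => H s t w ^+ 2).
  by rewrite (_ : (fun _ => _) = fun w => H s t w * H s t w) //; exact: bmeasM.
have bHs s : bmeas (fun w => \sum_(t <- sites n) H s t w ^+ 2).
  by apply: bmeas_sum => t.
have main : \sum_(s <- sites n) \sum_(t <- sites n) Ex P (fun w => H s t w * (noise s w * noise t w)) <=
    Num.sqrt M / 2 * K%:R + (2 * Num.sqrt M)^-1 * (M * (C * D)).
  apply: (le_trans (ler_sum _ (fun s _ => ler_sum _ (fun t _ => term_le s t q0)))).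
  under eq_bigr => s _ do rewrite big_split /= -!mulr_sumr.
  rewrite big_split /= -!mulr_sumr; apply: lerD.
    rewrite ler_pM2l ?divr_gt0 //.
    rewrite -(eq_bigr _ (fun s _ => Ex_sum P (sites n) xpredT (bHH s))) -Ex_sum //.
    rewrite -[leRHS](Ex_cst P); apply: Ex_le; [by apply: bmeas_sum|exact: bmeas_cst|].
    exact: H_energy.
  rewrite ler_pM2l ?invr_gt0 ?mulr_gt0 // -/C mulrCA ler_wpM2l //.
  apply: (@le_trans _ _ (\sum_(s <- sites n) D)).
    rewrite big_seq [leRHS]big_seq; apply: ler_sum => s sn.
    by apply: sum_exp_dist_le => //; rewrite -mem_sites.
  by rewrite big_const_seq count_predT iter_addr_0 size_sites [leRHS]mulr_natl.
apply: (@le_trans _ _ (M^-1 * (Num.sqrt M / 2 * K%:R + (2 * Num.sqrt M)^-1 * (M * (C * D))))).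
  by rewrite ler_pM2l ?invr_gt0.
rewrite /noise_const -/C -/D.
have E q k c : 0 < q -> (q * q)^-1 * (q / 2 * k + (2 * q)^-1 * (q * q * c)) = (k / 2 + c / 2) / q :> R.
  by move=> qp; field; rewrite gt_eqF.
have := E _ K%:R (C * D) q0; rewrite qq => ->.
rewrite ler_pM2r ?invr_gt0 //.
have : 0 <= K%:R :> R by []. have := mulr_ge0 C0 D0; lra.
Qed.

End Noise.

(** * Rates *)

Section Rates.
Variable R : realType.

Lemma ln2_ge : 2^-1 <= ln 2 :> R.
Proof.
have h : ln (2^-1 : R) <= - 2^-1.
  have e : (2^-1 : R) = 1 + - 2^-1 by lra.
  by rewrite [X in ln X]e; apply: le_ln1Dx; lra.
by move: h; rewrite lnV ?posrE // lerN2.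
Qed.

Lemma ln_nat_ge (k : nat) : (1 < k)%N -> 2^-1 <= ln k%:R :> R.
Proof.
move=> k1; apply: le_trans ln2_ge _; rewrite ler_ln ?posrE ?ltr0n //.
  by rewrite ler_nat.
exact: leq_trans k1.
Qed.

Lemma prod_log_ge (N : nat) (n : 'I_N -> nat) : (forall i, (1 < n i)%N) ->
  (2^-1) ^+ N <= prod_log n R.
Proof.
move=> n1; rewrite -[N in leLHS]card_ord -prodr_const /prod_log.
by apply: ler_prod => i _; rewrite ln_nat_ge // andbT; lra.
Qed.

(** Every [2 * ln (n i)] is at least [1], so one logarithm is at most [2 ^ N] times the product, and
    the product at most [4 ^ N] times its cube. This converts a rate with a single [ln M] into the
    stated one. *)
Lemma ln_card_le (N : nat) (n : 'I_N -> nat) : (forall i, (1 < n i)%N) ->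
  ln (card_window n)%:R <= (N * 8 ^ N)%:R * prod_log n R ^+ 3.
Proof.
move=> n1; have pl := prod_log_ge n1; set PL := prod_log n R in pl *.
have half0 : 0 < (2^-1 : R) ^+ N by rewrite exprn_gt0.
have PL0 : 0 < PL by exact: lt_le_trans pl.
have lnE : ln (card_window n)%:R = \sum_i ln (n i)%:R :> R.
  rewrite card_windowE natr_prod.
  suff H (s : seq 'I_N) : 0 < \prod_(i <- s) (n i)%:R :> R /\
      ln (\prod_(i <- s) (n i)%:R) = \sum_(i <- s) ln (n i)%:R :> R.
    by have [] := H (index_enum 'I_N).
  elim: s => [|i s [p0 IH]]; first by rewrite !big_nil ln1.
  have ni0 : 0 < (n i)%:R :> R by rewrite ltr0n (leq_trans _ (n1 i)).
  by rewrite !big_cons mulr_gt0 // lnM ?posrE // IH.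
have h2 i : ln (n i)%:R <= 2 ^+ N * PL.
  have pi : 2^-1 <= \prod_(j < N | j != i) (2 * ln (n j)%:R) :> R.
    apply: (@le_trans _ _ 1); first by lra.
    elim/big_ind: _ => // [x y x1 y1|j _]; first exact: mulr_ege1.
    by have := ln_nat_ge (n1 j); lra.
  have l0 := ln_nat_ge (n1 i).
  have -> : 2 ^+ N * PL = \prod_(j < N) (2 * ln (n j)%:R) :> R.
    by rewrite big_split /= prodr_const card_ord.
  rewrite (bigD1 i) //=.
  have := ler_wpM2l (_ : 0 <= 2 * ln (n i)%:R :> R) pi; move=> /(_ ltac:(lra)).
  by apply: le_trans; lra.
rewrite lnE; apply: (@le_trans _ _ (\sum_(i < N) 2 ^+ N * PL)); first exact: ler_sum.
rewrite sumr_const card_ord -[_ *+ N]mulr_natl natrM -mulrA ler_wpM2l //.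
rewrite natrX (_ : (8 : R) = 2 * (2 * 2)); last by lra.
rewrite exprMn -mulrA ler_wpM2l ?exprn_ge0 //.
have h4 : 1 <= (2 * 2) ^+ N * PL ^+ 2.
  have hh : (2^-1) ^+ N * (2^-1) ^+ N <= PL * PL by rewrite ler_pM // ltW.
  have p4 : 0 <= (2 * 2 : R) ^+ N by rewrite exprn_ge0.
  have := ler_wpM2l p4 hh; rewrite -!exprMn -expr2; apply: le_trans.
  by rewrite (_ : 2 * 2 * (2^-1 * 2^-1) = 1 :> R) ?expr1n //; lra.
by rewrite exprSr mulrA ler_peMl // ltW.
Qed.

(** * Choice of the deviation exponent, the mesh and the step *)

Section Choice.
Variables (N K M : nat) (c1 : R).
Hypotheses (N0 : (0 < N)%N) (K0 : (0 < K)%N) (M2 : (2 <= M)%N) (c10 : 0 < c1).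

Let l : R := ln M%:R.
(** [expR (- Lam_of)] is [M ^ (- 50 * K)]: against [M ^ (48 * K)] brackets it leaves at most
    [M ^ (- 2)], one factor for the residue classes and one for the rate. *)
Definition Lam_of : R := 50 * K%:R * l.
(** With this mesh, the mixing cost of [M] steps is at most [c0 * expR (- Lam_of)]. *)
Definition lag_of : nat := (Num.truncn ((Lam_of + 1 + l) / c1)).+1.
(** As [K * ln M] is at least [1 / 2], the summand [1 + ln M] raises the factor [50] by at most [3],
    and rounding up adds at most [2]. *)
Definition lag_rate : R := 53 / c1 + 2.
Definition rate_of : R := K%:R * l / M%:R `^ (N.+1%:R^-1).

Let l_ge : 2^-1 <= l. Proof. exact: ln_nat_ge. Qed.
Let K_ge : 1 <= K%:R :> R. Proof. by rewrite ler1n. Qed.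
Let Kl_ge : 2^-1 <= K%:R * l.
Proof. by apply: le_trans l_ge _; rewrite ler_peMl ?K_ge //; have := l_ge; lra. Qed.
Let M0 : 0 < M%:R :> R. Proof. by rewrite ltr0n (leq_trans _ M2). Qed.
Let M1 : 1 <= M%:R :> R. Proof. by rewrite ler1n (leq_trans _ M2). Qed.

Lemma Lam_of_ge : K%:R <= Lam_of.
Proof. by rewrite /Lam_of mulrAC ler_peMl //; have := l_ge; lra. Qed.

Lemma Lam_of_gt0 : 0 < Lam_of.
Proof. by apply: lt_le_trans Lam_of_ge; rewrite ltr0n. Qed.

Lemma lag_of_ge : Lam_of + 1 + l <= c1 * lag_of%:R.
Proof. by rewrite -ler_pdivrMl // mulrC; exact/ltW/truncnS_gt. Qed.

Lemma lag_of_le : lag_of%:R <= lag_rate * (K%:R * l).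
Proof.
have h0 : 0 <= (Lam_of + 1 + l) / c1.
  rewrite divr_ge0 ?(ltW c10) //; have := Lam_of_ge; have := K_ge; have := l_ge; lra.
have /andP[t1 _] := truncn_itv h0.
rewrite /lag_of -natr1; apply: (le_trans (lerD t1 (lexx 1))).
have lK : l <= K%:R * l by rewrite ler_peMl //; have := l_ge; lra.
have := Kl_ge; rewrite /lag_rate /Lam_of -(mulrA 50); move: (K%:R * l) lK => q lq q2.
have : (50 * q + 1 + l) / c1 <= 53 * q / c1 by rewrite ler_pM2r ?invr_gt0 //; lra.
rewrite mulrDl (mulrAC 53); lra.
Qed.

Let root : R := M%:R `^ (N.+1%:R^-1).
Let root_gt0 : 0 < root. Proof. exact: powR_gt0. Qed.
Let rootX : root ^+ N.+1 = M%:R.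
Proof.
by rewrite -powR_mulrn ?ltW // -powRrM mulVf ?pnatr_eq0 // powRr1 // ltW.
Qed.
Let root_ge1 : 1 <= root.
Proof. by rewrite /root -[leLHS](powRr0 M%:R) ler_powR // invr_ge0. Qed.

Lemma rate_of_gt0 : 0 < rate_of.
Proof. by rewrite /rate_of divr_gt0 //; have := Kl_ge; lra. Qed.

Lemma sqrt_rate : K%:R / Num.sqrt M%:R <= 2 * rate_of.
Proof.
have q0 : 0 < Num.sqrt M%:R :> R by rewrite sqrtr_gt0.
have rq : root <= Num.sqrt M%:R.
  have h : root ^+ 2 <= M%:R by rewrite -rootX ler_weXn2l // ltnS.
  by rewrite -(ler_sqr (ltW root_gt0) (ltW q0)) sqr_sqrtr // ltW.
have r0 : 0 < root^-1 by rewrite invr_gt0.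
apply: (@le_trans _ _ (K%:R / root)); first by rewrite ler_wpM2l // lef_pV2.
rewrite /rate_of -/root mulrA ler_pM2r // mulrCA ler_peMr //.
have := l_ge; lra.
Qed.

Lemma inv_rate : M%:R^-1 <= 2 * rate_of.
Proof.
apply: le_trans sqrt_rate.
have q0 : 0 < Num.sqrt M%:R :> R by rewrite sqrtr_gt0.
have q1 : 1 <= Num.sqrt M%:R :> R by rewrite -[leLHS]sqrtr1 ler_wsqrtr.
rewrite -{1}(sqr_sqrtr (ltW M0)) expr2 invfM mulrC.
apply: ler_pM; rewrite ?invr_ge0 ?(ltW q0) //.
by apply: le_trans K_ge; rewrite invf_le1.
Qed.

Lemma block_rate : Lam_of * lag_of%:R ^+ N / M%:R <= 50 * lag_rate ^+ N * rate_of ^+ N.+1.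
Proof.
have L0 : 0 <= Lam_of by apply: le_trans Lam_of_ge.
have r0 : 0 <= lag_rate by rewrite addr_ge0 // divr_ge0 // ltW.
rewrite /rate_of expr_div_n -/root rootX mulrA ler_pM2r ?invr_gt0 //.
apply: (@le_trans _ _ (Lam_of * (lag_rate * (K%:R * l)) ^+ N)).
  by rewrite ler_wpM2l // lerXn2r ?nnegrE ?lag_of_le // mulr_ge0 //; have := Kl_ge; lra.
by rewrite /Lam_of exprMn exprS le_eqVlt; apply/orP; left; apply/eqP; ring.
Qed.

(** If the window is too small for the blocks, [block_rate] bounds the rate below by a constant, and
    the a priori bound on the risk will do. *)
Lemma blocks_trivial : M%:R < Lam_of * lag_of%:R ^+ N ->
  1 <= (1 + 50 * lag_rate ^+ N) * rate_of.
Proof.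
move=> h; have y0 := rate_of_gt0.
have r0 : 0 <= lag_rate by rewrite addr_ge0 // divr_ge0 // ltW.
have D0 : 0 <= 50 * lag_rate ^+ N by rewrite mulr_ge0 // exprn_ge0.
have [y1|y1] := leP 1 rate_of; first by rewrite mulrDl mul1r; have := mulr_ge0 D0 (ltW y0); lra.
have : 1 <= 50 * lag_rate ^+ N * rate_of ^+ N.+1.
  by apply: le_trans block_rate; rewrite ler_pdivlMr // mul1r ltW.
have : rate_of ^+ N.+1 <= rate_of by rewrite exprS ler_piMr ?(ltW y0) // exprn_ile1 ?(ltW y0) ?(ltW y1).
move=> /(ler_wpM2l D0); rewrite mulrDl mul1r; lra.
Qed.

(** The value of [lam] at which [a ^ N * Lam / (lam * M)] equals [lam]. *)
Definition step_of : R := Num.sqrt (Lam_of * lag_of%:R ^+ N / M%:R).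

Lemma step_of_gt0 : 0 < step_of.
Proof.
by rewrite sqrtr_gt0 divr_gt0 // mulr_gt0 ?Lam_of_gt0 ?exprn_gt0 // ltr0n.
Qed.

Lemma step_of_sqr : step_of ^+ 2 = Lam_of * lag_of%:R ^+ N / M%:R.
Proof. rewrite sqr_sqrtr //; apply: divr_ge0 => //; apply: mulr_ge0 (ltW Lam_of_gt0) _; exact: exprn_ge0. Qed.

Lemma step_of_le1 : Lam_of * lag_of%:R ^+ N <= M%:R -> step_of <= 1.
Proof.
by move=> h; rewrite -[leRHS]sqrtr1 ler_wsqrtr // ler_pdivrMr // mul1r.
Qed.

(** The square of the step has order [rate_of ^+ N.+1], at most [rate_of ^+ 2] when the rate is at
    most [1] because [N] is positive; for a larger rate, [step_of <= 1] suffices. *)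
Lemma step_of_le : Lam_of * lag_of%:R ^+ N <= M%:R ->
  step_of <= (1 + Num.sqrt (50 * lag_rate ^+ N)) * rate_of.
Proof.
move=> h; have y0 := rate_of_gt0.
have r0 : 0 <= lag_rate by rewrite addr_ge0 // divr_ge0 // ltW.
have D0 : 0 <= 50 * lag_rate ^+ N by rewrite mulr_ge0 // exprn_ge0.
have s0 : 0 <= Num.sqrt (50 * lag_rate ^+ N) * rate_of by rewrite mulr_ge0 ?sqrtr_ge0 // ltW.
rewrite mulrDl mul1r; have [y1|y1] := leP 1 rate_of.
  by have := step_of_le1 h; lra.
suff : step_of <= Num.sqrt (50 * lag_rate ^+ N) * rate_of by lra.
rewrite -ler_sqr ?nnegrE ?(ltW step_of_gt0) // step_of_sqr exprMn sqr_sqrtr //.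
apply: (le_trans block_rate); rewrite ler_wpM2l //.
by rewrite ler_wiXn2l ?ltnS // ltW.
Qed.

Lemma lag_pow_le : Lam_of * lag_of%:R ^+ N <= M%:R -> lag_of%:R ^+ N <= M%:R :> R.
Proof.
apply: le_trans; rewrite ler_peMl ?exprn_ge0 //.
exact: le_trans K_ge Lam_of_ge.
Qed.

Lemma K_le_M : Lam_of * lag_of%:R ^+ N <= M%:R -> (K <= M)%N.
Proof.
move=> h; rewrite -(ler_nat R); apply: le_trans (le_trans Lam_of_ge _) h.
by rewrite ler_peMr ?exprn_ege1 ?ler1n // ltW // Lam_of_gt0.
Qed.

Lemma bad_prob_le c0 : 0 <= c0 -> Lam_of * lag_of%:R ^+ N <= M%:R ->
  bad_prob N c0 c1 lag_of K M Lam_of <= (1 + c0) / M%:R.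
Proof.
move=> c00 h; rewrite /bad_prob !natrX.
have eM : expR l = M%:R by rewrite lnK // posrE.
have hl : expR (- (c1 * lag_of%:R)) <= expR (- Lam_of) * expR (- 1) * M%:R^-1.
  rewrite -eM -expRN -!expRD ler_expR; have := lag_of_ge; lra.
have h1 : expR (- Lam_of) + M%:R * (expR 1 * (c0 * expR (- (c1 * lag_of%:R)))) <=
    expR (- Lam_of) * (1 + c0).
  rewrite mulrDr mulr1 lerD2l.
  have p : 0 <= M%:R * expR 1 * c0 by rewrite !mulr_ge0 ?expR_ge0 // ltW.
  have := ler_wpM2l p hl; rewrite !mulrA => /le_trans; apply.
  rewrite le_eqVlt; apply/orP; left; apply/eqP; rewrite expRN [expR (- 1)]expRN.
  by field; rewrite !gt_eqF ?expR_gt0.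
have p1 : 0 <= M%:R ^+ (48 * K) * lag_of%:R ^+ N :> R by rewrite mulr_ge0 ?exprn_ge0 // ltW.
rewrite mulrA; apply: (le_trans (ler_wpM2l p1 h1)).
have h2 : M%:R ^+ (48 * K) * expR (- Lam_of) <= M%:R^-1 * M%:R^-1.
  rewrite -eM -expRM_natl -expRN -!expRD ler_expR /Lam_of natrM.
  have : l <= K%:R * l by rewrite ler_peMl //; have := l_ge; lra.
  by rewrite -!(mulrA _ K%:R l); move: (K%:R * l); move=> q; lra.
have c1' : 0 <= 1 + c0 by rewrite addr_ge0.
have h3 := lag_pow_le h.
have a0 : 0 <= lag_of%:R ^+ N :> R by rewrite exprn_ge0.
have V0 : 0 <= M%:R^-1 :> R by rewrite invr_ge0 ltW.
have a0V : lag_of%:R ^+ N * M%:R^-1 <= 1 :> R by rewrite ler_pdivrMr // mul1r.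
set u := M%:R ^+ (48 * K) in h2 *; set e := expR (- Lam_of) in h2 *.
set q := lag_of%:R ^+ N in a0 a0V *.
have -> : u * q * (e * (1 + c0)) = u * e * (q * (1 + c0)) by ring.
apply: (@le_trans _ _ (M%:R^-1 * M%:R^-1 * (q * (1 + c0)))).
  by apply: ler_wpM2r h2; rewrite mulr_ge0.
have -> : M%:R^-1 * M%:R^-1 * (q * (1 + c0)) = (q * M%:R^-1) * ((1 + c0) / M%:R) by ring.
by rewrite ler_piMl // mulr_ge0.
Qed.

End Choice.
End Rates.

(** * Risk bound *)

Section Integrals.
Import HBNNSimple.
Variables (R : realType) (d : measure_display) (T : measurableType d).
Implicit Type mu : probability T R.

(* The risk of a data-driven estimator is only integrated, never shown to be a
   measurable function of the data: [f] is arbitrary here. *)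
Lemma ae_le_integral_dominated mu (f g : T -> \bar R) : (forall x, 0 <= f x)%E ->
  (forall x, 0 <= g x)%E -> measurable_fun setT g -> {ae mu, forall x, (f x <= g x)%E} ->
  (\int[mu]_x f x <= \int[mu]_x g x)%E.
Proof.
move=> f0 g0 mg fg; rewrite ge0_integralTE //; apply: ge_ereal_sup => _ [h /= hf <-].
rewrite -integralT_nnsfun; apply: ae_ge0_le_integral => //.
- by move=> x _; rewrite lee_fin; exact: fun_ge0.
- exact/measurable_EFinP.
- by apply: filterS fg => x fgx _; exact: le_trans (hf x) fgx.
Qed.

Lemma ae_norm_le mu (f : T -> R) (b : R) : ('N[mu]_+oo[EFin \o f] = b%:E)%E ->
  {ae mu, forall x, `|f x| <= b}.
Proof.
have muT : (0 < mu [set: T])%E by rewrite (_ : mu [set: T] = 1%E) //; exact: probability_setT.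
rewrite unlock muT => e.
by have := ess_sup_ge mu (abse \o (EFin \o f)); rewrite e; apply: filterS.
Qed.

Lemma Linfty_ge0 mu (f : T -> R) (b : R) : ('N[mu]_+oo[EFin \o f] = b%:E)%E -> 0 <= b.
Proof. by move=> e; rewrite -lee_fin -e Lnorm_ge0. Qed.

End Integrals.

Section Law.
Variables (R : realType) (disp d : measure_display).
Variables (Omega : measurableType disp) (T : measurableType d) (P : probability Omega R).
Variables (X : {RV P >-> T}) (mu : probability T R).
Hypothesis law : forall A, measurable A -> distribution P X A = mu A.

Lemma ae_law (Q : T -> Prop) : {ae mu, forall x, Q x} -> {ae P, forall w, Q (X w)}.
Proof.
move=> [A [mA A0 QA]]; exists (X @^-1` A); split.
- by rewrite -[X in measurable X]setTI; exact: (measurable_funPT X).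
- by rewrite -A0 -law.
- by move=> w /= nQ; apply: QA.
Qed.

Lemma integral_law (f : T -> R) : measurable_fun setT f -> (forall x, 0 <= f x) ->
  (\int[P]_w (f (X w))%:E = \int[mu]_x (f x)%:E)%E.
Proof.
move=> mf f0; rewrite [RHS](eq_measure_integral (distribution P X)) => [|A mA _]; last exact/esym/law.
by rewrite ge0_integral_distribution //; exact/measurable_EFinP.
Qed.

End Law.

Section Stage.
Variables (R : realType) (N d : nat) (disp : measure_display) (Omega : measurableType disp).
Variables (P : probability Omega R) (X : lattice N -> {RV P >-> Rvec R d}).
Variables (Y eps : lattice N -> {RV P >-> R}) (mu : probability (Rvec R d) R).
Variables (m sigma : Rvec R d -> R) (c0 c1 B S B' : R).
Hypotheses (N0 : (0 < N)%N) (c00 : 0 <= c0) (c10 : 0 < c1).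
Hypotheses (B0 : 0 <= B) (S0 : 0 <= S) (B'0 : 0 <= B').
Hypothesis law : forall s A, measurable A -> distribution P (X s) A = mu A.
Hypothesis mix : strong_mixing P (fun s w => (X s w, Y s w)) c0 c1.
Hypotheses (mm : measurable_fun setT m) (msig : measurable_fun setT sigma).
Hypothesis Yeq : forall s, {ae P, forall w, Y s w = m (X s w) + sigma (X s w) * eps s w}.
Hypothesis mB : {ae mu, forall z, `|m z| <= B}.
Hypothesis sigS : {ae mu, forall z, `|sigma z| <= S}.
Hypothesis epsB : forall s, {ae P, forall w, `|eps s w| <= B'}.
Hypothesis eps0 : forall s, ('E_P[eps s] = 0)%E.
Hypothesis indep : independent_fields P (fun s => eps s : Omega -> R)
                       (fun s => X s : Omega -> Rvec R d).
Variables (n : 'I_N -> nat) (K : nat) (g : 'I_K -> Rvec R d -> R) (lambda : R).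
Hypotheses (n1 : forall i, (1 < n i)%N) (K0 : (0 < K)%N) (lambda0 : 0 <= lambda).
Hypothesis mg : forall i, measurable_fun setT (g i).

Local Notation M := (card_window n).
Local Notation MR := (M%:R : R).
Local Notation beta := (B + S * B').
Local Notation est w := (truncated_estimator n (fun s => X s w) (fun s => Y s w) beta lambda g).
Local Notation thr w := (hard_threshold n (fun s => X s w) (fun s => Y s w) lambda g).

Definition risk (w : Omega) : \bar R := (\int[mu]_z ((`|est w z - m z| ^+ 2)%R)%:E)%E.

Let beta0 : 0 <= beta. Proof. by rewrite addr_ge0 ?mulr_ge0. Qed.

Let Bbeta : B <= beta. Proof. by rewrite lerDl mulr_ge0. Qed.

Let M2 : (2 <= M)%N.
Proof.
rewrite card_windowE (bigD1 (Ordinal N0)) //= -[2%N]muln1 leq_mul //.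
by apply: prodn_cond_gt0 => i _; exact: ltnW.
Qed.

Let M0 : (0 < M)%N. Proof. exact: leq_trans M2. Qed.

Let risk_ge0 w : (0 <= risk w)%E.
Proof. by apply: integral_ge0 => z _; rewrite lee_fin sqr_ge0. Qed.

Let int_cst d' (T : measurableType d') (Q : probability T R) (c : R) :
  (\int[Q]_x c%:E = c%:E)%E.
Proof. by rewrite -(@ExE _ _ _ Q (fun=> c)) ?Ex_cst //; exact: bmeas_cst. Qed.

Let b4 : 0 <= 4 * beta ^+ 2. Proof. by rewrite mulr_ge0 // sqr_ge0. Qed.

Lemma risk_le_const w : (risk w <= (4 * beta ^+ 2)%:E)%E.
Proof.
rewrite -(int_cst mu); apply: ae_le_integral_dominated => //.
apply: filterS mB => z mz; rewrite lee_fin.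
rewrite (_ : 4 * beta ^+ 2 = (2 * beta) ^+ 2); last by ring.
rewrite lerXn2r ?nnegrE ?mulr_ge0 //.
apply: (le_trans (ler_normB _ _)); have := trunc_norm (thr w z) beta0.
by have := Bbeta; rewrite /truncated_estimator; lra.
Qed.

Lemma int_risk_le_const : (\int[P]_w risk w <= (4 * beta ^+ 2)%:E)%E.
Proof.
rewrite -[leRHS](int_cst P); apply: ae_le_integral_dominated => //.
by apply: aeW => w; exact: risk_le_const.
Qed.

Let mb z := trunc beta (m z).

Let mmb : measurable_fun setT mb. Proof. exact: measurable_trunc. Qed.

Let mbb z : `|mb z| <= beta. Proof. exact: trunc_norm. Qed.

Lemma risk_sqloss w c : 0 < beta -> thr w = (fun z => \sum_i c i * g i z) ->
  (risk w <= (Ex mu (sqloss g beta mb c))%:E)%E.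
Proof.
move=> b0 ec; have bl := sqloss_bmeas mg b0 mmb mbb c.
rewrite ExE //; apply: ae_le_integral_dominated.
- by move=> z; rewrite lee_fin sqr_ge0.
- by move=> z; rewrite lee_fin sqr_ge0.
- by apply/measurable_EFinP; case: bl.
apply: filterS mB => z mz; rewrite lee_fin /sqloss /truncated_estimator ec.
by rewrite real_normK ?num_real // /mb [trunc _ (m z)]trunc_id // (le_trans mz).
Qed.

Lemma ae_sites (Q : lattice N -> Omega -> Prop) : (forall s, {ae P, forall w, Q s w}) ->
  {ae P, forall w, {in sites n, forall s, Q s w}}.
Proof.
move=> aeQ; elim: (sites n) => [|s ss IH]; first exact: aeW.
apply: filterS2 (aeQ s) IH => w Qs Qss t; rewrite inE => /predU1P[-> //|]; exact: Qss.
Qed.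

Definition sieve_loss (v : Rvec R d -> R) w : R :=
  MR^-1 * \sum_(s <- sites n) (v (X s w) - m (X s w)) ^+ 2.

Lemma integral_sieve_loss v : measurable_fun setT v ->
  (\int[P]_w (sieve_loss v w)%:E = \int[mu]_z ((`|v z - m z| ^+ 2)%R)%:E)%E.
Proof.
move=> mv; have mvm : measurable_fun setT (fun z => `|v z - m z| ^+ 2).
  apply: measurable_funX; apply: measurableT_comp => //; exact: measurable_funB.
have mX s : measurable_fun setT (fun w => `|v (X s w) - m (X s w)| ^+ 2).
  by apply: (measurableT_comp mvm); exact: measurable_funPT.
have e w : (sieve_loss v w)%:E =
    (MR^-1%:E * \sum_(s <- sites n) (`|v (X s w) - m (X s w)| ^+ 2)%:E)%E.
  rewrite sumEFin -EFinM; congr (_ * _)%:E; apply: eq_bigr => s _.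
  by rewrite real_normK // num_real.
under eq_integral do rewrite e.
rewrite ge0_integralZl //.
- rewrite ge0_integral_sum //; last first.
    by move=> s; apply/measurable_EFinP.
  under eq_bigr => s _ do rewrite (integral_law (law s) mvm (fun z => sqr_ge0 _)).
  have sumc (ss : seq (lattice N)) (x : \bar R) :
      ((\sum_(s <- ss) x) = (size ss)%:R%:E * x)%E.
    elim: ss => [|s ss IH]; first by rewrite big_nil mul0e.
    by rewrite big_cons IH /= -natr1 addrC EFinD ge0_muleDl ?lee_fin // mul1e.
  rewrite sumc size_sites muleA -EFinM mulVf ?mul1e //.
  by rewrite pnatr_eq0 -lt0n.
- by apply: emeasurable_sum => s; apply/measurable_EFinP.
- by move=> w _; apply: sume_ge0 => s _; rewrite lee_fin sqr_ge0.
Qed.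

Lemma dev_ge0 a (lam Lam : R) : 0 < lam -> 0 <= Lam -> 0 <= dev N a M beta lam Lam.
Proof.
move=> lam0 Lam0; have p1 : 0 <= Lam / lam := divr_ge0 Lam0 (ltW lam0).
apply: addr_ge0; apply: mulr_ge0.
- exact: mulr_ge0 (sqr_ge0 _).
- by apply: addr_ge0; [apply: divr_ge0 => //; exact: mulr_ge0|rewrite mulr_ge0 // ltW].
- exact: mulr_ge0.
- by apply: divr_ge0 => //; rewrite addr_ge0 // mulr_ge0.
Qed.

Lemma sieve_loss_ge0 v w : 0 <= sieve_loss v w.
Proof. by rewrite mulr_ge0 ?invr_ge0 //; apply: sumr_ge0 => s _; exact: sqr_ge0. Qed.

Lemma measurable_sieve_loss v : measurable_fun setT v -> measurable_fun setT (sieve_loss v).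
Proof.
move=> mv; apply: measurable_funM; first exact: measurable_cst.
apply: measurable_sum => s; apply: measurable_funX; apply: measurable_funB.
  by apply: (measurableT_comp mv); exact: measurable_funPT.
by apply: (measurableT_comp mm); exact: measurable_funPT.
Qed.

(** On [Bad] the a priori bound takes over. Elsewhere, truncating both the estimator and [m] brings
    them no further apart, so the empirical loss in the uniform deviation is at most the one in the
    oracle inequality. *)
Lemma risk_bound_ae a (lam Lam : R) u v : 0 < beta -> (0 < a)%N -> (K <= M)%N ->
  0 < lam -> lam <= 1 -> 0 <= Lam -> (u <= K)%N -> subsieve g u v ->
  exists2 Bad : set Omega, measurable Bad /\ (P Bad <= (bad_prob N c0 c1 a K M Lam)%:E)%E &
  {ae P, forall w, (risk w <= (2 * (lambda ^+ 2 * u%:R + sieve_loss v w) +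
    (2 * noise_sq X eps sigma S B' n g w + (dev N a M beta lam Lam +
      4 * beta ^+ 2 * (w \in Bad)%:R)))%:E)%E}.
Proof.
move=> b0 a0 KM lam0 lam1 Lam0 uK gv.
have [Bad [mBad PBad HBad]] := uniform_deviation law c00 mix a0 mg M2 K0 KM b0 lam0 lam1 Lam0
  mmb mbb (sites_uniq n) (size_sites n).
exists Bad => //.
have aeY : {ae P, forall w, {in sites n, forall s, Y s w = m (X s w) + noise X eps sigma S B' s w}}.
  apply: ae_sites => s; apply: filterS3 (Yeq s) (ae_law (law s) sigS) (epsB s) => w -> sS eB.
  by rewrite /noise /sigma_b /eps_b !trunc_id.
apply: filterS aeY => w yw.
have := oracle_inequality lambda0 yw uK gv.
have [c _ ec] := hard_threshold_sieve n (fun s => X s w) (fun s => Y s w) lambda g.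
have ec' := esym ec; rewrite -/(sieve_loss v w) -/(noise_sq X eps sigma S B' n g w).
have q0 : 0 <= noise_sq X eps sigma S B' n g w by apply: sumr_ge0 => f _; exact: sqr_ge0.
have s0 := sieve_loss_ge0 v w.
have l0 : 0 <= lambda ^+ 2 * u%:R by rewrite mulr_ge0 ?sqr_ge0.
set L := _^-1 * _ => HL.
have [wB|wB] := boolP (w \in Bad).
  apply: (le_trans (risk_le_const w)); rewrite lee_fin mulr1.
  have d0 := dev_ge0 a lam0 Lam0.
  lra.
apply: (le_trans (risk_sqloss b0 ec')); rewrite lee_fin.
have sqL : MR^-1 * \sum_(s <- sites n) sqloss g beta mb c (X s w) <= L.
  rewrite ler_wpM2l ?invr_ge0 //; apply: ler_sum => s _.
  rewrite /sqloss ec' -[leLHS]real_normK ?num_real // -[leRHS]real_normK ?num_real //.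
  by rewrite lerXn2r ?nnegrE //; exact: trunc_lip.
have := HBad w (fun h => negP wB (mem_set h)) c; rewrite mulr0 addr0; lra.
Qed.

Let A : R := lag_rate c1.
Let y : R := rate_of R N K M.

(** In order: projected noise, fluctuation of a bracket ([36] is [12 * (1 + 2)]), size of the
    brackets, exceptional set, and windows too small for the blocks. *)
Definition stage_const : R := 4 * (1 + noise_const N c0 c1 S B') +
  36 * beta ^+ 2 * (1 + Num.sqrt (50 * A ^+ N)) + 16 * beta * (8 * beta + 1) +
  8 * beta ^+ 2 * (1 + c0) + 4 * beta ^+ 2 * (1 + 50 * A ^+ N).

Let y0 : 0 < y. Proof. exact: rate_of_gt0. Qed.

Let A0 : 0 <= 50 * A ^+ N.
Proof. by rewrite mulr_ge0 // exprn_ge0 // addr_ge0 // divr_ge0 // ltW. Qed.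

Let nc0 : 0 <= noise_const N c0 c1 S B'.
Proof.
have SB0 : 0 <= S * B' by exact: mulr_ge0.
apply: mulr_ge0; first by rewrite !mulr_ge0 // ?sqr_ge0 // addr_ge0.
apply: exprn_ge0; rewrite divr_ge0 // subr_ge0 -[leRHS]expR0 ler_expR oppr_le0.
by rewrite divr_ge0 // ltW.
Qed.

Let sc1 : 0 <= 4 * (1 + noise_const N c0 c1 S B').
Proof. by rewrite mulr_ge0 // addr_ge0. Qed.
Let sc2 : 0 <= 36 * beta ^+ 2 * (1 + Num.sqrt (50 * A ^+ N)).
Proof. by apply: mulr_ge0 (mulr_ge0 _ (sqr_ge0 _)) _ => //; rewrite addr_ge0. Qed.
Let sc3 : 0 <= 16 * beta * (8 * beta + 1).
Proof. by apply: mulr_ge0; [exact: mulr_ge0|rewrite addr_ge0 // mulr_ge0]. Qed.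
Let sc4 : 0 <= 8 * beta ^+ 2 * (1 + c0).
Proof. by apply: mulr_ge0 (mulr_ge0 _ (sqr_ge0 _)) _ => //; rewrite addr_ge0. Qed.
Let sc5 : 0 <= 4 * beta ^+ 2 * (1 + 50 * A ^+ N).
Proof. by apply: mulr_ge0 => //; rewrite addr_ge0. Qed.

Lemma stage_const_ge0 : 0 <= stage_const.
Proof. by rewrite /stage_const !addr_ge0. Qed.

(** The cases [beta = 0] and too small a window follow from the a priori bound [4 * beta ^+ 2]. In
    the main case the oracle term arises with factor [2], enlarged to [4] at the end. *)
Lemma stage_bound u v : (u <= K)%N -> subsieve g u v -> measurable_fun setT v ->
  (\int[P]_w risk w <= 4%:E * ((lambda ^+ 2 * u%:R)%:E +
    \int[mu]_z ((`|v z - m z| ^+ 2)%R)%:E) + (stage_const * y)%:E)%E.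
Proof.
move=> uK gv mv; set V := (\int[mu]_z _)%E.
have V0 : (0 <= V)%E by apply: integral_ge0 => z _; rewrite lee_fin sqr_ge0.
have l0 : 0 <= lambda ^+ 2 * u%:R by rewrite mulr_ge0 ?sqr_ge0.
have rhs0 : (0 <= 4%:E * ((lambda ^+ 2 * u%:R)%:E + V))%E.
  by rewrite mule_ge0 // adde_ge0 // lee_fin.
have triv : 4 * beta ^+ 2 <= stage_const * y -> (\int[P]_w risk w <=
    4%:E * ((lambda ^+ 2 * u%:R)%:E + V) + (stage_const * y)%:E)%E.
  move=> h; apply: (le_trans int_risk_le_const); rewrite -[leLHS]add0e.
  by apply: leeD => //; rewrite lee_fin.
have [b0|b0] := eqVneq beta 0.
  by apply: triv; rewrite b0 expr0n mulr0 mulr_ge0 ?stage_const_ge0 // ltW.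
have {}b0 : 0 < beta by rewrite lt_neqAle eq_sym b0.
have [h|h] := leP (Lam_of R K M * (lag_of K M c1)%:R ^+ N) M%:R; last first.
  apply: triv; have := blocks_trivial K0 M2 c10 h; rewrite -/y -/A => h1.
  apply: (@le_trans _ _ (4 * beta ^+ 2 * (1 + 50 * A ^+ N) * y)).
    by rewrite -mulrA ler_peMr.
  by rewrite ler_wpM2r ?(ltW y0) // /stage_const lerDr !addr_ge0.
have KM := K_le_M K0 M2 h.
have st0 := step_of_gt0 N c1 K0 M2.
have [Bad [mBad PBad] HBad] := risk_bound_ae b0 (ltn0Sn _ : (0 < lag_of K M c1)%N) KM
   st0 (step_of_le1 M2 h) (ltW (Lam_of_gt0 R K0 M2)) uK gv.
set q := noise_sq _ _ _ _ _ _ _ in HBad; set dv := dev _ _ _ _ _ _ in HBad.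
have bq : bmeas q by exact: noise_sq_bmeas.
have mB' : measurable [set w | w \in Bad] by rewrite (_ : [set w | _] = Bad) //; apply: set_mem_set.
have bB := bmeas_bool R mB'.
pose r w := 2 * (lambda ^+ 2 * u%:R) + (2 * q w + (dv + 4 * beta ^+ 2 * (w \in Bad)%:R)).
have br : bmeas r.
  apply: bmeasD; first exact: bmeas_cst.
  by apply: bmeasD; [exact: bmeasZ|apply: bmeasD; [exact: bmeas_cst|exact: bmeasZ]].
have Er : Ex P r = 2 * (lambda ^+ 2 * u%:R) + (2 * Ex P q + (dv + 4 * beta ^+ 2 * fine (P Bad))).
  rewrite /r ExD ?Ex_cst //; [|exact: bmeas_cst|].
    rewrite ExD ?ExZ //; [|exact: bmeasZ|by apply: bmeasD; [exact: bmeas_cst|exact: bmeasZ]].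
    rewrite ExD ?Ex_cst ?ExZ ?Ex_bool //; [|exact: bmeas_cst|exact: bmeasZ].
    by rewrite (_ : [set w | _] = Bad) //; apply: set_mem_set.
  by apply: bmeasD; [exact: bmeasZ|apply: bmeasD; [exact: bmeas_cst|exact: bmeasZ]].
have q0 w : 0 <= q w by apply: sumr_ge0 => f _; exact: sqr_ge0.
have dv0 : 0 <= dv by apply: dev_ge0 => //; exact/ltW/Lam_of_gt0.
have r0 w : 0 <= r w.
  rewrite /r; apply: addr_ge0; first exact: mulr_ge0.
  apply: addr_ge0; first exact: mulr_ge0.
  by apply: addr_ge0 => //; exact: mulr_ge0.
have mloss := measurable_sieve_loss mv.
have step1 : (\int[P]_w risk w <= (Ex P r)%:E + 2%:E * V)%E.
  have mr : measurable_fun setT (EFin \o r) by apply/measurable_EFinP; case: br.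
  have ml : measurable_fun setT (fun w => 2%:E * (sieve_loss v w)%:E)%E.
    by apply: measurable_funeM; exact/measurable_EFinP.
  have l2 w : (0 <= 2%:E * (sieve_loss v w)%:E)%E by rewrite -EFinM lee_fin mulr_ge0 ?sieve_loss_ge0.
  rewrite ExE // /V -integral_sieve_loss // -ge0_integralZl //; first last.
  - by move=> w _; rewrite lee_fin sieve_loss_ge0.
  - exact/measurable_EFinP.
  rewrite -ge0_integralD //; last by move=> w _; rewrite lee_fin.
  apply: ae_le_integral_dominated => //.
  - by move=> w; rewrite adde_ge0 // lee_fin.
  - exact: emeasurable_funD.
  apply: filterS HBad => w /le_trans; apply.
  rewrite -EFinM -EFinD lee_fin /r; lra.
have V1 : MR^-1 <= 2 * y := inv_rate R N0 K0 M2.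
have hdv : dv <= (36 * beta ^+ 2 * (1 + Num.sqrt (50 * A ^+ N)) + 16 * beta * (8 * beta + 1)) * y.
  have st := step_of_le N0 K0 M2 c10 h; rewrite -/A -/y in st.
  have e1 : (lag_of K M c1 ^ N)%:R * (Lam_of R K M / step_of N K M c1) / MR = step_of N K M c1.
    rewrite natrX -[RHS](mulfK (lt0r_neq0 st0)) -expr2 (step_of_sqr N c1 K0 M2).
    by field; rewrite !gt_eqF // ltr0n.
  rewrite /dv /dev e1 [leRHS]mulrDl; apply: lerD.
    have := ler_wpM2l (mulr_ge0 (ler0n R 36) (sqr_ge0 beta)) st; lra.
  have b81 : 0 <= 8 * beta * (8 * beta + 1) by rewrite !(mulr_ge0, addr_ge0).
  have := ler_wpM2l b81 V1; lra.
have hq : 2 * Ex P q <= 4 * (1 + noise_const N c0 c1 S B') * y.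
  have H := @Ex_noise_sq_le R N d disp Omega P X Y eps m sigma c0 c1 S B' N0 c00 c10 S0 B'0 mix
    mm msig Yeq (fun s => ae_law (law s) sigS) epsB eps0 indep n K g M0 K0 mg.
  have h2 := sqrt_rate R K N0 M2; rewrite -/y in h2.
  have i0 : 0 <= (Num.sqrt MR)^-1 by rewrite invr_ge0 sqrtr_ge0.
  have k1 : K%:R + noise_const N c0 c1 S B' <= (1 + noise_const N c0 c1 S B') * K%:R.
    by rewrite mulrDl mul1r lerD2l ler_peMr // ler1n.
  have h3 := ler_wpM2r i0 k1; have n1' : 0 <= 1 + noise_const N c0 c1 S B' by rewrite addr_ge0.
  have h4 := ler_wpM2l n1' h2; rewrite -/q in H.
  have := le_trans H h3; rewrite -mulrA; lra.
have hB : 4 * beta ^+ 2 * fine (P Bad) <= 8 * beta ^+ 2 * (1 + c0) * y.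
  have PB1 : fine (P Bad) <= (1 + c0) / MR.
    rewrite -lee_fin fineK ?fin_num_measure //; apply: (le_trans PBad); rewrite lee_fin.
    exact: bad_prob_le.
  have c1' : 0 <= 1 + c0 by rewrite addr_ge0.
  have h5 := ler_wpM2l c1' V1.
  have := ler_wpM2l b4 (le_trans PB1 h5); lra.
have hr : Ex P r <= 2 * (lambda ^+ 2 * u%:R) + stage_const * y.
  have := mulr_ge0 sc5 (ltW y0); rewrite Er /stage_const !(mulrDl _ _ y).
  by move: hdv; rewrite !(mulrDl _ _ y); lra.
apply: (le_trans step1); clear step1 triv rhs0; clearbody V.
apply: (@le_trans _ _ ((2 * (lambda ^+ 2 * u%:R) + stage_const * y)%:E + 2%:E * V)%E).
  by rewrite leeD2r // lee_fin.
rewrite EFinD addeAC leeD2r // ge0_muleDr ?lee_fin //; apply: leeD.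
  by rewrite lee_fin; lra.
by rewrite lee_wpmul2r // lee_fin; lra.
Qed.

End Stage.

Theorem theorem3p3 (R : realType) (N : nat) (hN : (0 < N)%N)
    (B B' S c0 c1 : R) (hB' : 0 <= B') (hc0 : 0 < c0) (hc1 : 0 < c1) :
  exists C : R, 0 <= C /\
  forall (d : nat) (disp : measure_display) (Omega : measurableType disp)
    (P : probability Omega R)
    (X : lattice N -> {RV P >-> Rvec R d})
    (Y eps : lattice N -> {RV P >-> R})
    (mu : probability (Rvec R d) R)
    (m sigma : Rvec R d -> R)
    (kappa0 kappa1 tau : R)
    (n : nat -> 'I_N -> nat)
    (K : nat -> nat)
    (g : forall k : nat, 'I_(K k) -> Rvec R d -> R)
    (lambda : nat -> R),
  (forall s, (Y s : Omega -> R) \in Lfun P 2%:E) ->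
  identically_distributed P (fun s w => (X s w, Y s w)) ->
  (forall s A, measurable A -> distribution P (X s) A = mu A) ->
  strong_mixing P (fun s w => (X s w, Y s w)) c0 c1 ->
  measurable_fun setT m ->
  measurable_fun setT sigma ->
  (forall s, {ae P, forall w,
     Y s w = m (X s w) + sigma (X s w) * eps s w}) ->
  ('N[mu]_+oo[EFin \o m] = B%:E)%E ->
  ('N[mu]_+oo[EFin \o (fun z => sigma z ^+ 2)%R] < +oo)%E ->
  ('N[mu]_+oo[EFin \o sigma] = S%:E)%E ->
  (forall s, ('E_P[eps s] = 0)%E) ->
  (forall s, ('V_P[eps s] = 1)%E) ->
  identically_distributed P (fun s => eps s : Omega -> R) ->
  independent_fields P (fun s => eps s : Omega -> R)
                       (fun s => X s : Omega -> Rvec R d) ->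
  0 < kappa0 -> 0 < kappa1 -> 0 < tau ->
  (forall s (z : R), 0 <= z ->
     (P [set w | (z < `|eps s w|)%R]
        <= (kappa0 * expR (- (kappa1 * z `^ tau)))%:E)%E) ->
  (forall s, {ae P, forall w, `|eps s w| <= B'}) ->
  (forall k i, (0 < n k i)%N) ->
  (forall k i, (n k i <= n k.+1 i)%N) ->
  0 < inf (range (fun k => (min_side (n k))%:R / (max_side (n k))%:R : R)) ->
  (fun k => max_side (n k)) @ \oo --> \oo ->
  (forall k, (0 < K k)%N) ->
  (forall k, sieve (g k) `<=` sieve (g k.+1)) ->
  dense_in_L2 mu (fun k => sieve (g k)) ->
  (forall k, 0 <= lambda k) ->
  lambda @ \oo --> (0 : R) ->
  (fun k => (K k)%:R * lambda k ^+ 2) @ \oo --> (0 : R) ->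
  (fun k => (K k)%:R `^ (1 + 2 / tau) * prod_log (n k) R `^ (3 + 4 / tau)
              / (card_window (n k))%:R `^ (N.+1%:R^-1)) @ \oo --> (0 : R) ->
  forall k : nat, (forall i, (1 < n k i)%N) ->
  (\int[P]_w \int[mu]_z
      ((`|truncated_estimator (n k) (fun s => X s w) (fun s => Y s w)
            (B + S * B') (lambda k) (g k) z - m z| ^+ 2)%R)%:E
   <= 4%:E * \big[Order.min/+oo]_(1 <= u < (K k).+1)
        ((lambda k ^+ 2 * u%:R)%:E
         + ereal_inf [set \int[mu]_z ((`|f z - m z| ^+ 2)%R)%:E
                       | f in subsieve (g k) u])
      + (C * ((K k)%:R * prod_log (n k) R ^+ 3
              / (card_window (n k))%:R `^ (N.+1%:R^-1)))%:E)%E.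
Proof.
(* A negative [B] or [S] cannot be an essential supremum norm, so the hypotheses are then
   contradictory. *)
have [/andP[B0 S0]|nBS] := boolP ((0 <= B) && (0 <= S)); last first.
  exists 0; split=> // d disp Omega P X Y eps mu m sigma ? ? ? ? ? ? ? _ _ _ _ _ _ _ eB _ eS.
  by move: nBS; rewrite (Linfty_ge0 eB) (Linfty_ge0 eS).
pose A := stage_const N c0 c1 B S B'; pose D : R := (N * 8 ^ N)%:R.
have A0 : 0 <= A by exact: stage_const_ge0 (ltW hc0) hc1 B0 S0 hB'.
(* [A] is the constant for the rate with [ln M], and [D] the price of [ln_card_le]. *)
exists (A * D); split; first exact: mulr_ge0.
move=> d disp Omega P X Y eps mu m sigma kappa0 kappa1 tau n K g lambda.
move=> _ _ law mix mm msig Yeq eB _ eS eps0 _ _ indep _ _ _ _ epsB _ _ _ _ K0 _ dense lambda0 _ _ _ k n1.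
(* Each generator lies in its sieve, hence in [L^2], and membership there includes measurability. *)
have mg i : measurable_fun setT (g k i).
  have /sub_Lfun_mfun : g k i \in Lfun mu 2%:E.
    apply: (proj1 dense k); exists (fun j => (j == i)%:R) => //; apply/funext => z.
    by rewrite (bigD1 i) //= eqxx mul1r big1 ?addr0 // => j /negPf ->; rewrite mul0r.
  by rewrite inE.
set L := (\int[P]_w _)%E; set rate := _ / _.
have HL u v : (u <= K k)%N -> subsieve (g k) u v ->
  (L <= 4%:E * ((lambda k ^+ 2 * u%:R)%:E + \int[mu]_z ((`|v z - m z| ^+ 2)%R)%:E) + (A * D * rate)%:E)%E.
  move=> uK gv.
  have mv : measurable_fun setT v.
    case: gv => a _ <-; under eq_fun do rewrite big_mkcond.
    apply: measurable_sum => i; case: (i < u)%N; last exact: measurable_cst.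
    by apply: measurable_funM => //; exact: measurable_cst.
  have H := stage_bound hN (ltW hc0) hc1 B0 S0 hB' law mix mm msig Yeq (ae_norm_le eB) (ae_norm_le eS)
    epsB eps0 indep n1 (K0 k) (lambda0 k) mg uK gv mv.
  apply: (le_trans H); rewrite leeD2l // lee_fin -mulrA ler_wpM2l //.
  have M0 : 0 < (card_window (n k))%:R :> R.
    by rewrite ltr0n card_windowE; apply: prodn_gt0 => i; exact: ltnW.
  rewrite /rate_of /rate mulrA ler_pM2r; last by rewrite invr_gt0 powR_gt0.
  by rewrite mulrCA ler_wpM2l // ln_card_le.
(* With the constants moved to the left, the minimum and the infimum are bounded below term by term;
   the default [+oo] of the minimum satisfies the bound. *)
rewrite -leeBlDr // -lee_pdivrMl //.
rewrite big_seq; elim/big_ind: _ => [|x y hx hy|u]; first by rewrite leey.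
  by rewrite le_min hx.
rewrite mem_index_iota ltnS => /andP[_ uK].
rewrite -leeBlDl //; apply: le_ereal_inf_tmp => _ [v gv <-].
by rewrite leeBlDl // lee_pdivrMl // leeBlDr //; exact: HL.
Qed.
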